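(* Consider the problem $-\varepsilon\Delta u-bu_x+cu=f$ in $\Omega=(0,1)^2$, $u=0$ on $\partial\Omega$, with data as in the context. Assume that its solution $u$ satisfies, for some $\delta>0$, with $E(y)=e^{-y\delta/\sqrt\varepsilon}+e^{-(1-y)\delta/\sqrt\varepsilon}$ and a constant $C'$ independent of $\varepsilon$, $$|\partial_x^i\partial_y^ju(x,y)|\le C'\Big(1+\varepsilon^{-i}e^{-\beta x/\varepsilon}+\varepsilon^{-j/2}E(y)+\varepsilon^{-(i+j/2)}e^{-\beta x/\varepsilon}E(y)\Big)$$ for all $(x,y)\in\Omega$ and $0\le i+j\le2$. Let $u^h\in V^h$ be the Galerkin finite element solution with bilinear elements on the DL mesh. Then there is a constant $C$ independent of $\varepsilon$ and $h$ such that $$\|u-u^h\|_\varepsilon\le C\,h|\ln\varepsilon|\qquad\text{and}\qquad h|\ln\varepsilon|\le C\,\frac{1}{\sqrt M}\ln^2\varepsilon,$$ where $M$ is the total number of mesh points.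
   Context: **Problem.** $\Omega=(0,1)^2$; $b\in W^{1,\infty}(\Omega)$, $c\in L^\infty(\Omega)$, $b\ge\beta>0$ and $c\ge0$ on $\bar\Omega$, $c+\frac12 b_x\ge\gamma>0$ on $\Omega$, with $\beta,\gamma$ constants; $f\in L^2(\Omega)$. The parameter satisfies $0<\varepsilon\ll1$, i.e. $0<\varepsilon\le\varepsilon_0$ for a sufficiently small fixed $\varepsilon_0\in(0,1)$ independent of $h$. The functions $b,c$ do not depend on $\varepsilon$. **DL (Duran–Lombardi) mesh.** Let $0<h<1$. In $x$: $x_0=0$; $x_i=ih\varepsilon$ for $1\le i\le\lceil1/h\rceil$; $x_{i+1}=x_i+hx_i$ for $\lceil1/h\rceil\le i\le M_x-2$; $x_{M_x}=1$, where $M_x$ is such that $x_{M_x-1}<1\le(1+h)x_{M_x-1}$. In $y$: $y_0=0$; $y_j=jh\sqrt\varepsilon$ for $1\le j\le\lceil1/h\rceil$; $y_{j+1}=y_j+hy_j$ for $\lceil1/h\rceil\le j\le M_y-2$; $y_{M_y}=1/2$, where $y_{M_y-1}<\frac12\le(1+h)y_{M_y-1}$; and $y_{M_y+j}=1-y_{M_y-j}$, $1\le j\le M_y$. The last interval $(x_{M_x-1},1)$ is assumed not too small compared with the previous one (its length is at least a fixed positive constant times that of the previous one); otherwise the node $x_{M_x-1}$ is removed. The same convention is used in $y$ at $1/2$, symmetrically. The mesh is the tensor product, consisting of rectangles $[x_{i-1},x_i]\times[y_{j-1},y_j]$; $M$ is the total number of mesh points. $V^h\subset H_0^1(\Omega)$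 is the space of continuous piecewise bilinear functions on the mesh vanishing on $\partial\Omega$. **Galerkin FEM.** $a_G(w,v)=\varepsilon(\nabla w,\nabla v)+(-bw_x+cw,v)$ with the $L^2(\Omega)$ inner product; $u^h\in V^h$ satisfies $a_G(u^h,v^h)=(f,v^h)$ for all $v^h\in V^h$. **Norm.** $\|v\|_\varepsilon^2=\varepsilon\|\nabla v\|_{0,\Omega}^2+\|v\|_{0,\Omega}^2$, with $\|\cdot\|_{0,\Omega}$ the $L^2(\Omega)$ norm. *)

(* Defs.v *)
From HB Require Import structures.
From mathcomp Require Import all_boot all_order all_algebra.
From mathcomp Require Import all_classical all_reals all_analysis.

Set Implicit Arguments.
Unset Strict Implicit.
Unset Printing Implicit Defensive.

Import Order.TTheory GRing.Theory Num.Theory.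
Import numFieldNormedType.Exports.

Local Open Scope classical_set_scope.
Local Open Scope ring_scope.

Section Domain.
Context {R : realType}.

Definition Omega : set (R * R) := [set p | 0 < p.1 < 1 /\ 0 < p.2 < 1].
Definition Omega_closed : set (R * R) :=
  [set p | 0 <= p.1 <= 1 /\ 0 <= p.2 <= 1].
Definition Omega_boundary : set (R * R) := Omega_closed `\` Omega.

(* Two-dimensional Lebesgue measure, on the Borel sets of the plane; every
   Lebesgue measurable function is a.e. equal to a Borel one. *)
Definition leb2 :
    {measure set (measurableTypeR R * measurableTypeR R)%type -> \bar R} :=
  (@lebesgue_measure R \x @lebesgue_measure R)%E.

(* f represents an element of L^p(Omega); its values off Omega are irrelevant. *)
Definition in_Lp (p : \bar R) (f : R * R -> R) : Prop :=
  (f \_ Omega : measurableTypeR R * measurableTypeR R -> R) \in Lfun leb2 p.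

Definition L2ip (v w : R * R -> R) : R :=
  \int[leb2]_(p in Omega) (v p * w p).

(* Valued in the extended reals, so that an upper bound on it also asserts
   finiteness. *)
Definition L2norm (v : R * R -> R) : \bar R :=
  'N[leb2]_2%:E [EFin \o (v \_ Omega)].

(* Pointwise partial derivatives.  By convention they take a junk value where
   the derivative does not exist; for a piecewise bilinear function this
   concerns only the mesh lines, a null set, and elsewhere they agree with the
   weak derivatives. *)
Definition pdx (v : R * R -> R) : R * R -> R :=
  fun p => derive1 (fun t : R => v (t, p.2)) p.1.
Definition pdy (v : R * R -> R) : R * R -> R :=
  fun p => derive1 (fun t : R => v (p.1, t)) p.2.
Definition derivable_x (v : R * R -> R) (p : R * R) : Prop :=
  derivable (fun t : R => v (t, p.2)) p.1 1.
Definition derivable_y (v : R * R -> R) (p : R * R) : Prop :=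
  derivable (fun t : R => v (p.1, t)) p.2 1.

Definition partial (i j : nat) (v : R * R -> R) : R * R -> R :=
  iter i pdx (iter j pdy v).

(* All the derivatives partial i j v with i + j <= 2 exist in Omega; their
   continuity is not required, so this is weaker than C^2(Omega). *)
Definition has_partials2 (v : R * R -> R) : Prop :=
  forall p, Omega p ->
    [/\ derivable_x v p, derivable_y v p, derivable_x (pdx v) p,
        derivable_x (pdy v) p & derivable_y (pdy v) p].

(* C^1 functions with compact support in Omega. *)
Definition test_fun (phi : R * R -> R) : Prop :=
  [/\ forall p, derivable_x phi p /\ derivable_y phi p,
      continuous (pdx phi), continuous (pdy phi) &
      exists2 K : set (R * R), compact K /\ K `<=` Omega &
        forall p, ~ K p -> phi p = 0].

Definition weak_dx (b g : R * R -> R) : Prop :=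
  forall phi, test_fun phi -> L2ip b (pdx phi) = - L2ip g phi.
Definition weak_dy (b g : R * R -> R) : Prop :=
  forall phi, test_fun phi -> L2ip b (pdy phi) = - L2ip g phi.

(* b is in W^{1,oo}(Omega), with weak partial derivatives b_x and b_y. *)
Definition in_W1oo (b b_x b_y : R * R -> R) : Prop :=
  [/\ in_Lp +oo%E b, in_Lp +oo%E b_x, in_Lp +oo%E b_y,
      weak_dx b b_x & weak_dy b b_y].

Definition problem_data (beta gamma : R) (b b_x b_y c : R * R -> R) : Prop :=
  [/\ in_W1oo b b_x b_y /\ in_Lp +oo%E c,
      0 < beta /\ (forall p, Omega_closed p -> beta <= b p),
      {ae leb2, forall p, Omega_closed p -> 0 <= c p},
      0 < gamma &
      {ae leb2, forall p, Omega p -> gamma <= c p + 2^-1 * b_x p}].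

(* As f is only in L^2 and c only in L^oo, the equation holds a.e. *)
Definition solves (eps : R) (b c f u : R * R -> R) : Prop :=
  [/\ has_partials2 u,
      {ae leb2, forall p, Omega p ->
         - eps * (partial 2 0 u p + partial 0 2 u p)
         - b p * partial 1 0 u p + c p * u p = f p},
      {within Omega_closed, continuous u} &
      forall p, Omega_boundary p -> u p = 0].

Definition layerE (delta eps y : R) : R :=
  expR (- (y * delta / Num.sqrt eps)) + expR (- ((1 - y) * delta / Num.sqrt eps)).

Definition derivative_bounds (C' beta delta eps : R) (u : R * R -> R) : Prop :=
  forall (i j : nat), (i + j <= 2)%N -> forall p, Omega p ->
    `|partial i j u p| <=
      C' * (1 + eps `^ (- i%:R) * expR (- (beta * p.1 / eps))
            + eps `^ (- (j%:R / 2)) * layerE delta eps p.2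
            + eps `^ (- (i%:R + j%:R / 2)) * expR (- (beta * p.1 / eps))
              * layerE delta eps p.2).

Definition galerkin_form (eps : R) (b c w v : R * R -> R) : R :=
  eps * (L2ip (pdx w) (pdx v) + L2ip (pdy w) (pdy v))
  + L2ip (fun p => - b p * pdx w p + c p * w p) v.

Definition energy_norm (eps : R) (v : R * R -> R) : \bar R :=
  ((eps%:E * (L2norm (pdx v) ^+ 2 + L2norm (pdy v) ^+ 2) + L2norm v ^+ 2)
     `^ 2^-1)%E.

End Domain.

Section Mesh.
Context {R : realType}.

Definition dl_N (h : R) : nat := `|Num.ceil h^-1|%N.

(* i h sigma for i <= ceil(1/h), then geometric growth with ratio 1 + h. *)
Fixpoint dl_pt (h sigma : R) (i : nat) : R :=
  if i is k.+1 then
    if (i <= dl_N h)%N then i%:R * h * sigma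
    else dl_pt h sigma k + h * dl_pt h sigma k
  else 0.

(* The nodes of [0, L] for the layer width sigma.  The node of index m.-1 is
   removed when the last interval is shorter than kappa times the previous
   one. *)
Definition dl_graded (kappa h sigma L : R) (s : seq R) : Prop :=
  exists m : nat,
    [/\ (dl_N h < m)%N,
        dl_pt h sigma m.-1 < L,
        L <= (1 + h) * dl_pt h sigma m.-1 &
        s = rcons (mkseq (dl_pt h sigma)
              (if kappa * (dl_pt h sigma m.-1 - dl_pt h sigma m.-2)
                    <= L - dl_pt h sigma m.-1 then m else m.-1)) L].

Definition dl_mesh (kappa eps h : R) (xs ys : seq R) : Prop :=
  dl_graded kappa h eps 1 xs /\
  exists2 s : seq R, dl_graded kappa h (Num.sqrt eps) 2^-1 s &
    ys = s ++ behead (rev [seq 1 - y | y <- s]).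

Definition mesh_points (xs ys : seq R) : nat := (size xs * size ys)%N.

Definition mesh_cell (xs ys : seq R) (i j : nat) : set (R * R) :=
  [set p | xs`_i <= p.1 <= xs`_i.+1 /\ ys`_j <= p.2 <= ys`_j.+1].

(* Elements are functions on the whole plane, only their restrictions to the
   closed square matter. *)
Definition Vh (xs ys : seq R) : set (R * R -> R) :=
  [set v | [/\ {within Omega_closed, continuous v},
      forall i j, (i.+1 < size xs)%N -> (j.+1 < size ys)%N ->
        exists a0 a1 a2 a3 : R, forall p, mesh_cell xs ys i j p ->
          v p = a0 + a1 * p.1 + a2 * p.2 + a3 * (p.1 * p.2) &
      forall p, Omega_boundary p -> v p = 0]].

Definition galerkin_solution (eps : R) (b c f : R * R -> R) (xs ys : seq R)
    (uh : R * R -> R) : Prop :=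
  Vh xs ys uh /\
  forall vh, Vh xs ys vh -> galerkin_form eps b c uh vh = L2ip f vh.

End Mesh.

(* Main.v *)
Require Import Defs.
From HB Require Import structures.
From mathcomp Require Import all_boot all_order all_algebra.
From mathcomp Require Import ring lra.
From mathcomp Require Import all_classical all_reals all_analysis measurable_realfun ess_sup_inf.
Import Order.TTheory GRing.Theory Num.Theory.
Import numFieldNormedType.Exports.
Set Implicit Arguments.
Unset Strict Implicit.
Unset Printing Implicit Defensive.
Local Open Scope classical_set_scope.
Local Open Scope ring_scope.

(** Let [e = u - u^h], let [u^I] be the nodal interpolant of [u] and [d = u^I - u^h].
On a Duran-Lombardi mesh a cell has width at most [(1 + kappa) h max(eps, x)] in
[x], and at most [(1 + kappa) h max(sqrt eps, dist)] in [y], where [dist] is its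
distance to the sides [y = 0] and [y = 1].  The assumed derivative bounds then
give [|u - u^I| <= C h], [sqrt eps |(u - u^I)_y| <= C h] and
[|(u - u^I)_x| <= C h (1 + B)] with the layer weight [B(x) = exp(-k x/eps)/eps].

As [c + b_x/2 >= gamma], coercivity and Galerkin orthogonality bound the energy
of [d] by the bilinear form at [(u^I - u, d)], where only the convective term is
critical.  The weight has mass at most [1/k], and since [d] vanishes at [x = 0] we
have [d^2 <= x int d_x^2], whence [int B d^2 <= (4/k^2) eps ||d_x||^2]; Young's
inequality with weight [1 + B] therefore absorbs the convective term.  This proves
[||u - u^h||_eps <= C h]; the logarithm only enters when mesh points are counted.

The weak derivative of [b] has to be tested with products of hat functions, which
are merely Lipschitz and do not have compact support.  Their Steklov averages,
composed with a slight dilation about the centre of the interval, are C^1 with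
compact support, and converge boundedly together with their derivatives. *)

(** * One-dimensional calculus *)

Section OneDim.
Context {R : realType}.
Implicit Types (g dg : R -> R) (s : seq R) (a b K x : R).
Local Notation mu := (@lebesgue_measure R).

(** An unweighted Cauchy-Schwarz inequality fails on the convective term: the norm of (u - u^I)_x is
    of order h / sqrt eps, which the L^2 norm of d cannot compensate. Hence the weight, and its rate
    k = beta / (2 (2 + kappa)): half of the exponent beta pays for the growth of the mesh width from
    eps to x, and the factor 2 + kappa for replacing the left end of a cell by an arbitrary point of
    it.

    The rest is shaped by the weak hypotheses. The partial derivatives of u exist pointwise but may
    be discontinuous, so integration by parts relies on difference quotients and dominated
    convergence, and the interpolation estimates on mean values. Nothing is known of them on the
    boundary, where u is merely continuous. The derivatives of finite element functions take default
    values on mesh lines; they are traded for the formal derivatives of an expansion in products of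
    hats, which are bounded and agree with them off finitely many lines. Bounds that only serve
    integrability may depend on eps; the interpolation and energy constants may not. *)

Lemma bounded_derive_le g dg s K a b : a <= b ->
  {within `[a, b], continuous g} ->
  (forall x, a < x < b -> x \notin s -> is_derive x 1 g (dg x) /\ `|dg x| <= K) ->
  `|g b - g a| <= K * (b - a).
Proof.
elim: s a b => [|c s IHs] a b.
  rewrite le_eqVlt => /predU1P[->|ab] cg dgK; first by rewrite !subrr normr0 mulr0.
  have [|x xab ->] := @MVT R g dg a b ab _ cg.
    by move=> x; rewrite in_itv/= => /dgK -/(_ isT)[].
  move: xab; rewrite in_itv/= => /dgK -/(_ isT)[_ dgxK].
  by rewrite normrM (gtr0_norm (x := b - a)) ?subr_gt0// ler_pM2r ?subr_gt0.
(* An exceptional point inside the interval splits it in two, and the bound is additive over the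
   pieces. *)
move=> ab cg dgK; have [/andP[ac cb]|cab] := boolP (a < c < b); last first.
  apply: IHs => // x xab xs; apply: dgK => //; rewrite inE negb_or xs andbT.
  by apply: contraNneq cab => <-.
have -> : g b - g a = (g b - g c) + (g c - g a) by ring.
have -> : K * (b - a) = K * (b - c) + K * (c - a) by ring.
apply: (le_trans (ler_normD _ _)); apply: lerD; apply: IHs => //.
- exact: ltW.
- apply: continuous_subspaceW cg => x /=; rewrite !in_itv/= => /andP[cx ->].
  by rewrite (le_trans (ltW ac)).
- move=> x /andP[cx xb] xs; apply: dgK; first by rewrite (lt_trans ac).
  by rewrite inE negb_or xs gt_eqF.
- exact: ltW.
- apply: continuous_subspaceW cg => x /=; rewrite !in_itv/= => /andP[-> cx].
  by rewrite (le_trans cx (ltW cb)).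
- move=> x /andP[cx xb] xs; apply: dgK; first by rewrite cx (lt_trans xb).
  by rewrite inE negb_or xs lt_eqF.
Qed.

(** Division-free form of the derivative: one-sided derivatives, affine substitutions and changes of
    the function away from the point become plain estimates of a remainder. *)
Lemma is_derive_expansion g x d : is_derive x 1 g d <->
  forall e, 0 < e -> exists2 r, 0 < r &
    forall t, `|t| < r -> `|g (x + t) - g x - d * t| <= e * `|t|.
Proof.
have E (t : R) : t != 0 -> `|d - t^-1 *: ((g \o shift x) (t *: (1 : R)) - g x)|
    = `|g (x + t) - g x - d * t| / `|t|.
  move=> t0; rewrite /= {1}/GRing.scale/= {1}/GRing.scale/= mulr1 (addrC t) -normfV.
  by rewrite -normrM distrC; congr `| _ |; field.
split=> [[dgx dE] e e0|H].
  have /cvgrPdist_le/(_ e e0) := dgx; rewrite -/('D_1 g x) dE.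
  rewrite near_withinE => /nbhs_ballP[r/= r0 Hr]; exists r => // t tr.
  have [->|t0] := eqVneq t 0; first by rewrite addr0 mulr0 !subrr normr0 mulr0.
  have := Hr t; rewrite /ball/= sub0r normrN => /(_ tr t0).
  by rewrite E// ler_pdivrMr ?normr_gt0.
suff dgx : (fun h => h^-1 *: ((g \o shift x) (h *: (1 : R)) - g x)) @ 0^' --> d.
  by split; [exact: cvgP dgx|exact: cvg_lim dgx].
apply/cvgrPdist_le => e e0; have [r r0 Hr] := H e e0.
rewrite near_withinE; apply/nbhs_ballP; exists r => //= t.
rewrite /ball/= sub0r normrN => tr t0.
by rewrite E// ler_pdivrMr ?normr_gt0 ?Hr.
Qed.

Lemma cvg_EFin_comp (u : nat -> R) (l : R) : u @ \oo --> l -> (u n)%:E @[n --> \oo] --> l%:E.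
Proof. by move=> ul; apply: cvg_EFin => //; exact: nearW. Qed.

Lemma near_inv_succ (e : R) : 0 < e -> \forall n \near \oo, n.+1%:R^-1 < e.
Proof.
move=> e0; have /cvgrPdist_lt/(_ e e0) := @cvg_harmonic R.
by apply: filterS => n; rewrite sub0r normrN ger0_norm ?harmonic_ge0.
Qed.

Lemma is_derive_quotient_cvg g x d (t_ : nat -> R) : is_derive x 1 g d ->
  (forall n, t_ n != 0) -> t_ @ \oo --> 0 ->
  (fun n => (t_ n)^-1 * (g (x + t_ n) - g x)) @ \oo --> d.
Proof.
move=> /is_derive_expansion H tn0 t0; apply/cvgrPdist_le => e e0.
have [r r0 Hr] := H e e0; move/cvgrPdist_lt : t0 => /(_ r r0).
apply: filterS => n; rewrite sub0r normrN => /Hr.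
rewrite -ler_pdivrMr ?normr_gt0// -normfV -normrM distrC; congr (`| _ | <= _).
by field.
Qed.

Lemma cvg_inv_succ : (fun n => n.+1%:R^-1 : R) @ \oo --> 0.
Proof. exact: cvg_harmonic. Qed.

Lemma ex_antiderivative g a b : continuous g ->
  exists G, forall x, a < x < b -> is_derive x 1 G (g x).
Proof.
move=> cg; exists (fun x => \int[mu]_(t in `[a, x]) g t) => x /andP[ax xb].
have [||dG GE] := @continuous_FTC1_closed R g a x b xb _ ax; last first.
- by split; [exact: dG|rewrite -derive1E; exact: GE].
- exact: cg.
- apply: continuous_compact_integrable; first exact: segment_compact.
  exact: continuous_subspaceT.
Qed.

(** Starting the integral at minus infinity yields a primitive on the whole line; the bounded
    support makes it finite. *)
Lemma ex_antiderivative_support g : continuous g -> (forall x, ~~ (0 <= x <= 1) -> g x = 0) ->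
  exists G, forall x, is_derive x 1 G (g x).
Proof.
move=> cg g0; pose G x := \int[mu]_(t in `]-oo, x]) g t.
exists G => x.
have [||||dG GE] := @continuous_FTC1 R g -oo%O x (x + 1); last first.
- by split; [exact: dG|rewrite -derive1E; exact: GE].
- exact: cg.
- by rewrite ltNye.
- have : mu.-integrable `[0, 1] (EFin \o g).
    apply: continuous_compact_integrable; first exact: segment_compact.
    exact: continuous_subspaceT.
  move=> ig0; have /= ig := (@integrable_mkcond _ _ R mu `[0 : R, 1] (EFin \o g) (measurable_itv _)).1 ig0.
  apply: (@integrableS _ _ _ mu setT) => //.
  apply: eq_integrable ig => // t _; rewrite /patch /=; case: ifPn => //.
  by rewrite mem_setE => /= t01; rewrite g0// -in_itv.
- by rewrite ltrDl.
Qed.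

Lemma finite_null s (A : set R) : A `<=` [set` s] -> mu.-negligible A.
Proof.
move=> As; exists [set` s]; split => //.
  by apply: countable_measurable => //; exact/finite_set_countable/finite_seq.
by apply: countable_lebesgue_measure0; exact/finite_set_countable/finite_seq.
Qed.

Lemma lipschitz_continuous g K : 0 <= K ->
  (forall x y, x <= y -> `|g y - g x| <= K * (y - x)) -> continuous g.
Proof.
move=> K0 gK x; apply/cvgrPdist_le => e e0.
have K1 : 0 < K + 1 by rewrite ltr_wpDl.
have eK : 0 < e / (K + 1) by rewrite divr_gt0.
apply/nbhs_ballP; exists (e / (K + 1)) => //= y; rewrite /ball/= => xy.
have gxy : `|g x - g y| <= K * `|x - y|.
  have [xley|/ltW ylex] := leP x y.
    by rewrite distrC (ler0_norm (x := x - y)) ?subr_le0// opprB gK.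
  by rewrite (ger0_norm (x := x - y)) ?subr_ge0// gK.
apply: (le_trans gxy); apply: (@le_trans _ _ ((K + 1) * (e / (K + 1)))).
  by apply: ler_pM => //; [rewrite lerDl|exact: ltW].
by rewrite mulrC divfK// gt_eqF.
Qed.

Lemma is_derive_continuous g x d : is_derive x 1 g d -> {for x, continuous g}.
Proof. by move=> [dg _]; apply: differentiable_continuous; apply/derivable1_diffP. Qed.

Lemma itv_measure_lty a b : (mu `]a, b[ < +oo)%E.
Proof. by rewrite lebesgue_measure_itv/=; case: ifP => _; rewrite -?EFinB ltry. Qed.

(** Here [dg] is merely bounded and measurable, so the fundamental theorem for continuous integrands
    is applied to the difference quotients [D n] of [g]. Their primitives [F n] are means of the
    extended [g] over intervals of length 1/(n+1) and tend to [g], while [D n] tends to [dg] off [s]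
    under a uniform bound; dominated convergence joins the two limits. *)
Lemma integral_derive g dg s K a b : a < b -> {within `[a, b], continuous g} ->
  (forall x, a < x < b -> x \notin s -> is_derive x 1 g (dg x) /\ `|dg x| <= K) ->
  measurable_fun `]a, b[ dg ->
  \int[mu]_(x in `]a, b[) dg x = g b - g a.
Proof.
move=> ab cg dgK0 mdg.
have dgK x : a < x < b -> x \notin s -> is_derive x 1 g (dg x) /\ `|dg x| <= `|K|.
  by move=> xab xs; have [dgx dgxK] := dgK0 x xab xs; split => //; rewrite (le_trans dgxK) ?ler_norm.
(* Extending [g] by its end values keeps the Lipschitz bound and gives a meaning to the quotients
   that reach beyond [b]. *)
pose cl x := Num.max a (Num.min x b).
have cl_itv x : a <= cl x <= b.
  by rewrite /cl le_max lexx ge_max (ltW ab) ge_min lexx orbT.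
have cl_le x y : x <= y -> cl x <= cl y /\ cl y - cl x <= y - x.
  move=> xy; rewrite /cl; have ab' := ltW ab; clear cg dgK0 mdg dgK cl_itv.
  by case: (leP x b) => xb; case: (leP y b) => yb; rewrite ?(max_r ab');
    try case: (leP a x) => ax; try case: (leP a y) => ay; split; lra.
pose ge x := g (cl x).
have ge_lip x y : x <= y -> `|ge y - ge x| <= `|K| * (y - x).
  move=> /cl_le[cxy cxyl]; apply: (@le_trans _ _ (`|K| * (cl y - cl x))).
    have [/andP[ax xb] /andP[ay yb]] := (cl_itv x, cl_itv y).
    apply: (@bounded_derive_le g dg s) => //.
      apply: continuous_subspaceW cg => z /=; rewrite !in_itv/= => /andP[xz zy].
      by rewrite (le_trans ax)// (le_trans zy).
    by move=> z /andP[xz zy]; apply: dgK; rewrite (le_lt_trans ax)// (lt_le_trans zy).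
  by rewrite ler_wpM2l.
have cge : continuous ge by exact: (@lipschitz_continuous _ `|K|).
have geE x : a <= x <= b -> ge x = g x.
  by move=> /andP[ax xb]; rewrite /ge /cl min_l// max_r.
(* The margin beyond [b] leaves room for shifts of length at most 1. *)
have [G dG] := @ex_antiderivative ge (a - 1) (b + 3) cge.
pose D n x := n.+1%:R * (ge (x + n.+1%:R^-1) - ge x).
pose F n x := n.+1%:R * (G (x + n.+1%:R^-1) - G x).
have inv01 n : 0 < (n.+1%:R^-1 : R) <= 1.
  by rewrite invr_gt0 ltr0n invf_le1 ?ltr0n// ler1n.
have cD n : continuous (D n).
  move=> x; apply: cvgM; first exact: cvg_cst.
  apply: cvgB; last exact: cge.
  by apply: (@cvg_comp _ _ _ (fun x => x + n.+1%:R^-1) ge); [apply: cvgD; [exact: cvg_id|exact: cvg_cst]|exact: cge].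
have dF n x : a <= x <= b -> is_derive x 1 (F n) (D n x).
  move=> /andP[ax xb]; have /andP[r0 r1] := inv01 n.
  have d1 : is_derive (x + n.+1%:R^-1) 1 G (ge (x + n.+1%:R^-1)) by apply: dG; move: r0 r1; set r := n.+1%:R^-1 => r0 r1; lra.
  have d2 : is_derive x 1 G (ge x) by apply: dG; lra.
  have d3 : is_derive x 1 (fun x => G (x + n.+1%:R^-1)) (ge (x + n.+1%:R^-1)).
    apply/is_derive_expansion => e e0.
    have [r r1' Hr] := (is_derive_expansion _ _ _).1 d1 e e0.
    by exists r => // t /Hr; rewrite (addrAC x t).
  by apply: is_deriveZ; exact: is_deriveB.
have D_int n : (\int[mu]_(x in `]a, b[) (D n x)%:E = (F n b - F n a)%:E)%E.
  rewrite EFinB -(@continuous_FTC2 R (D n) (F n) a b ab).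
  - by rewrite [RHS]integral_itv_bndoo//; apply/measurable_EFinP; apply: measurable_funTS; exact: continuous_measurable_fun.
  - exact: continuous_subspaceT.
  - split.
    + by move=> x; rewrite in_itv/= => /andP[ax xb]; have [] := dF n x _; rewrite ?(ltW ax) ?(ltW xb).
    + by apply/cvg_at_right_filter/is_derive_continuous/dF; rewrite lexx ltW.
    + by apply/cvg_at_left_filter/is_derive_continuous/dF; rewrite lexx ltW.
  - by move=> x; rewrite in_itv/= derive1E => /andP[ax xb]; have [] := dF n x _; rewrite ?(ltW ax) ?(ltW xb).
have F_cvg : (fun n => F n b - F n a) @ \oo --> g b - g a.
  have H x : a <= x <= b -> (fun n => F n x) @ \oo --> g x.
    move=> xab; rewrite -(geE x)//.
    have dGx : is_derive x 1 G (ge x) by apply: dG; move: xab => /andP[? ?]; lra.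
    have := @is_derive_quotient_cvg G x (ge x) (fun n => n.+1%:R^-1) dGx _ cvg_inv_succ.
    by rewrite /F; under eq_fun do rewrite invrK; apply.
  by apply: cvgB; apply: H; rewrite lexx ltW.
have [_ _] : [/\ mu.-integrable `]a, b[ (EFin \o dg),
  (fun n => \int[mu]_(x in `]a, b[) (`|(D n x)%:E - (dg x)%:E|)%E)%E @ \oo --> 0%E &
  (fun n => \int[mu]_(x in `]a, b[) (D n x)%:E)%E @ \oo --> (\int[mu]_(x in `]a, b[) (dg x)%:E)%E].
  apply: (@dominated_convergence _ _ R mu _ _ (fun n x => (D n x)%:E) (EFin \o dg) (fun=> `|K|%:E)).
  - exact: measurable_itv.
  - by move=> n; apply/measurable_EFinP; apply: measurable_funTS; exact: continuous_measurable_fun.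
  - exact/measurable_EFinP.
  - apply: (@finite_null s) => x /=; apply: contra_notP => xs xab.
    have [dgx _] := dgK x xab (introN idP xs).
    have := @is_derive_quotient_cvg g x (dg x) (fun n => n.+1%:R^-1) dgx _ cvg_inv_succ.
    under eq_fun do rewrite invrK.
    move=> /(_ (fun n => lt0r_neq0 (proj1 (andP (inv01 n))))) Dg.
    apply: cvg_EFin_comp; apply: cvg_trans Dg; apply: near_eq_cvg.
    move: xab; rewrite in_itv/= => /andP[ax xb].
    have bx : 0 < b - x by rewrite subr_gt0.
    apply: filterS (near_inv_succ bx) => n nbx; rewrite /D !geE//.
      by rewrite !ltW.
    by move: nbx ax; have /andP[] := inv01 n; set r := n.+1%:R^-1 => h1 h2 h3 h4; lra.
  - apply: (@measurable_bounded_integrable _ _ R mu (cst `|K|)) => //.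
    + exact: itv_measure_lty.
    + exact: bounded_cst.
  - apply: aeW => x n xab; rewrite lee_fin.
    have /andP[r0 r1] := inv01 n.
    rewrite normrM ger0_norm// -ler_pdivlMl ?ltr0n// mulrC.
    by rewrite (le_trans (ge_lip _ _ _)) ?lerDl ?(ltW r0)// addrC addKr.
under eq_fun do rewrite D_int.
move=> Dcvg; rewrite /Rintegral.
have -> : (\int[mu]_(x in `]a, b[) (dg x)%:E)%E = (g b - g a)%:E.
  have H : (fun n => (F n b - F n a)%:E) @ \oo --> (g b - g a)%:E by exact: cvg_EFin_comp F_cvg.
  exact: (cvg_unique _ Dcvg H).
by [].
Qed.

End OneDim.

(** * Integration over the square *)

Section TwoDim.
Context {R : realType}.
Local Notation mu := (@lebesgue_measure R).
Local Notation mu2 := (@leb2 R).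
Local Notation plane := (measurableTypeR R * measurableTypeR R)%type.
Implicit Types (F G H : R * R -> R) (M x y : R).

Lemma Omega_setX : @Omega R = `]0, 1[ `*` `]0, 1[.
Proof. by apply/seteqP; split=> -[x y]; rewrite /Omega/= !in_itv. Qed.

Lemma measurable_Omega : measurable (@Omega R : set plane).
Proof. by rewrite Omega_setX; apply: measurableX; exact: measurable_itv. Qed.

Lemma leb2_Omega : mu2 Omega = 1%E.
Proof.
rewrite Omega_setX; transitivity (mu `]0%R, 1%R[ * mu `]0%R, 1%R[)%E.
  by apply: product_measure1E; exact: measurable_itv.
by rewrite lebesgue_measure_itv/= lte_fin ltr01 sube0 mule1.
Qed.

#[global] Instance ae_leb2_filter : Filter (nbhs (almost_everywhere mu2)).
Proof. exact: (@ae_filter_ringOfSetsType _ plane R mu2). Qed.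

Definition integralO F := \int[mu2]_(p in Omega) F p.

Definition meas F := measurable_fun (Omega : set plane) (F : plane -> R).

(** Essential boundedness is what the data [b], [b_x] and [c] provide; on a domain of measure one it
    gives integrability, so that no integral of such a function takes a default value. *)
Definition bmeas F := meas F /\ exists M, {ae mu2, forall p, Omega p -> `|F p| <= M}.

Lemma bmeas_integrable F : bmeas F -> mu2.-integrable (Omega : set plane) (EFin \o F).
Proof.
move=> [mF [M FM]]; apply/integrableP; split; first exact/measurable_EFinP.
apply: (@le_lt_trans _ _ (`|M|%:E * mu2 Omega)%E).
  apply: integral_le_bound => //; [exact: measurable_Omega|exact/measurable_EFinP|].
  by apply: filterS FM => p FM Op; rewrite lee_fin (le_trans (FM Op)) ?ler_norm.
by rewrite leb2_Omega mule1 ltry.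
Qed.

Lemma meas_cst (a : R) : meas (fun=> a).
Proof. exact: measurable_cst. Qed.

Lemma measD F G : meas F -> meas G -> meas (fun p => F p + G p).
Proof. exact: measurable_funD. Qed.

Lemma measN F : meas F -> meas (fun p => - F p).
Proof. by move=> mF; exact: measurableT_comp. Qed.

Lemma measB F G : meas F -> meas G -> meas (fun p => F p - G p).
Proof. exact: measurable_funB. Qed.

Lemma measM F G : meas F -> meas G -> meas (fun p => F p * G p).
Proof. exact: measurable_funM. Qed.

Lemma bmeas_cst (a : R) : bmeas (fun=> a).
Proof. by split; [exact: meas_cst|exists `|a|; exact: aeW]. Qed.

Lemma bmeasD F G : bmeas F -> bmeas G -> bmeas (fun p => F p + G p).
Proof.
move=> [mF [M FM]] [mG [N GN]]; split; first exact: measD.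
exists (M + N); apply: filterS2 FM GN => p Fp Gp Op.
by rewrite (le_trans (ler_normD _ _))// lerD ?Fp ?Gp.
Qed.

Lemma bmeasM F G : bmeas F -> bmeas G -> bmeas (fun p => F p * G p).
Proof.
move=> [mF [M FM]] [mG [N GN]]; split; first exact: measM.
exists (M * N); apply: filterS2 FM GN => p Fp Gp Op.
by rewrite normrM ler_pM ?Fp ?Gp.
Qed.

Lemma bmeasZ (a : R) F : bmeas F -> bmeas (fun p => a * F p).
Proof. by move=> bF; apply: bmeasM => //; exact: bmeas_cst. Qed.

Lemma bmeasN F : bmeas F -> bmeas (fun p => - F p).
Proof.
move=> [mF [M FM]]; split; first exact: measN.
by exists M; apply: filterS FM => p Fp Op; rewrite normrN Fp.
Qed.

Lemma bmeasB F G : bmeas F -> bmeas G -> bmeas (fun p => F p - G p).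
Proof. by move=> bF bG; apply: bmeasD => //; exact: bmeasN. Qed.

Lemma integralOD F G : bmeas F -> bmeas G ->
  integralO (fun p => F p + G p) = integralO F + integralO G.
Proof.
by move=> bF bG; apply: RintegralD; [exact: measurable_Omega|exact: bmeas_integrable..].
Qed.

Lemma integralOB F G : bmeas F -> bmeas G ->
  integralO (fun p => F p - G p) = integralO F - integralO G.
Proof.
by move=> bF bG; apply: RintegralB; [exact: measurable_Omega|exact: bmeas_integrable..].
Qed.

Lemma integralOZ (a : R) F : bmeas F -> integralO (fun p => a * F p) = a * integralO F.
Proof.
by move=> bF; apply: RintegralZl; [exact: measurable_Omega|exact: bmeas_integrable].
Qed.

Lemma eq_integralO F G : (forall p, Omega p -> F p = G p) -> integralO F = integralO G.
Proof. by move=> FG; apply: eq_Rintegral => p; rewrite inE => /FG. Qed.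

Lemma eq_meas F G : (forall p, Omega p -> F p = G p) -> meas F -> meas G.
Proof. by move=> FG; apply: eq_measurable_fun => p; rewrite inE => /FG. Qed.

Lemma ae_eq_integralO F G : meas F -> meas G ->
  {ae mu2, forall p, Omega p -> F p = G p} -> integralO F = integralO G.
Proof.
move=> mF mG FG; congr fine; apply: ae_eq_integral.
- exact: measurable_Omega.
- exact/measurable_EFinP.
- exact/measurable_EFinP.
- by apply: filterS FG => p FG Op; rewrite FG.
Qed.

Lemma ae_eq_bmeas F G : bmeas F -> meas G ->
  {ae mu2, forall p, Omega p -> F p = G p} -> bmeas G.
Proof.
move=> [mF [M FM]] mG FG; split=> //; exists M.
by apply: filterS2 FM FG => p FM FG Op; rewrite -FG// FM.
Qed.

Lemma integralO_ge0 F : bmeas F -> {ae mu2, forall p, Omega p -> 0 <= F p} ->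
  0 <= integralO F.
Proof.
move=> [mF _] F0; rewrite (@ae_eq_integralO F (fun p => `|F p|))//.
- by apply: Rintegral_ge0 => p _; exact: normr_ge0.
- exact: measurableT_comp.
- by apply: filterS F0 => p F0 Op; rewrite ger0_norm// F0.
Qed.

Lemma ae_le_integralO F G : bmeas F -> bmeas G ->
  {ae mu2, forall p, Omega p -> F p <= G p} -> integralO F <= integralO G.
Proof.
move=> bF bG FG; rewrite -subr_ge0 -integralOB//; apply: integralO_ge0.
  exact: bmeasB.
by apply: filterS FG => p FG Op; rewrite subr_ge0 FG.
Qed.

Lemma cvg_integralO (F_ : nat -> R * R -> R) F M :
  (forall n, meas (F_ n)) -> meas F ->
  {ae mu2, forall p, Omega p -> forall n, `|F_ n p| <= M} ->
  {ae mu2, forall p, Omega p -> F_ ^~ p @ \oo --> F p} ->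
  (fun n => integralO (F_ n)) @ \oo --> integralO F.
Proof.
move=> mF_ mF F_M F_F.
have [iF _ H] : [/\ mu2.-integrable (Omega : set plane) (EFin \o F),
  (fun n => \int[mu2]_(p in Omega) (`|(F_ n p)%:E - (F p)%:E|)%E)%E @ \oo --> 0%E &
  (fun n => \int[mu2]_(p in Omega) (F_ n p)%:E)%E @ \oo --> (\int[mu2]_(p in Omega) (F p)%:E)%E].
  apply: (@dominated_convergence _ _ R mu2 _ _ (fun n p => (F_ n p)%:E) (EFin \o F) (fun=> M%:E)).
  - exact: measurable_Omega.
  - by move=> n; apply/measurable_EFinP; exact: mF_.
  - exact/measurable_EFinP.
  - by apply: filterS F_F => p Fp Op; apply: cvg_EFin_comp; exact: Fp.
  - exact: (@bmeas_integrable (fun=> M) (bmeas_cst M)).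
  - by apply: filterS F_M => p Fp n Op; rewrite lee_fin; exact: Fp.
have E : (\int[mu2]_(p in Omega) (F p)%:E)%E = (integralO F)%:E.
  by rewrite /integralO /Rintegral fineK//; apply: integrable_fin_num; [exact: measurable_Omega|exact: iF].
by rewrite E in H; exact: fine_cvg H.
Qed.

Lemma integralO_cst (a : R) : integralO (fun=> a) = a.
Proof. by rewrite /integralO Rintegral_cst ?leb2_Omega ?mulr1//; exact: measurable_Omega. Qed.

(** A bound at every point of [Omega], unlike one almost everywhere, makes every single slice
    integrable. *)
Definition bounded_meas F := meas F /\ exists M, forall p, Omega p -> `|F p| <= M.

Lemma bounded_measW F : bounded_meas F -> bmeas F.
Proof. by move=> [mF [M FM]]; split => //; exists M; exact: aeW. Qed.

Lemma bounded_measD F G : bounded_meas F -> bounded_meas G -> bounded_meas (fun p => F p + G p).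
Proof.
move=> [mF [M FM]] [mG [N GN]]; split; first exact: measD.
by exists (M + N) => p Op; rewrite (le_trans (ler_normD _ _))// lerD ?FM ?GN.
Qed.

Lemma bounded_measM F G : bounded_meas F -> bounded_meas G -> bounded_meas (fun p => F p * G p).
Proof.
move=> [mF [M FM]] [mG [N GN]]; split; first exact: measM.
by exists (M * N) => p Op; rewrite normrM ler_pM ?FM ?GN.
Qed.

Lemma bounded_meas_cst (a : R) : bounded_meas (fun=> a).
Proof. by split; [exact: meas_cst|exists `|a|]. Qed.

Lemma bounded_measN F : bounded_meas F -> bounded_meas (fun p => - F p).
Proof.
move=> [mF [M FM]]; split; first exact: measN.
by exists M => p Op; rewrite normrN FM.
Qed.

Lemma bounded_measB F G : bounded_meas F -> bounded_meas G -> bounded_meas (fun p => F p - G p).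
Proof. by move=> bF bG; apply: bounded_measD => //; exact: bounded_measN. Qed.

Lemma measurable_patch_Omega F : meas F -> measurable_fun (setT : set plane) (F \_ Omega : plane -> R).
Proof. by move=> mF; apply/(measurable_restrictT _ _).1 => //; exact: measurable_Omega. Qed.

Lemma measurable_xslice F y : meas F -> 0 < y < 1 -> measurable_fun (`]0, 1[ : set R) (fun x => F (x, y)).
Proof.
move=> mF y01; apply: (@eq_measurable_fun _ _ _ _ _ (fun x => (F \_ Omega) (x, y))).
  by move=> x; rewrite inE/= in_itv/= => x01; rewrite /patch mem_set.
apply: measurable_funTS.
exact: (@measurable_fun_pair1 _ _ _ _ _ _ (F \_ Omega) y (measurable_patch_Omega mF)).
Qed.

Lemma measurable_yslice F x : meas F -> 0 < x < 1 -> measurable_fun (`]0, 1[ : set R) (fun y => F (x, y)).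
Proof.
move=> mF x01; apply: (@eq_measurable_fun _ _ _ _ _ (fun y => (F \_ Omega) (x, y))).
  by move=> y; rewrite inE/= in_itv/= => y01; rewrite /patch mem_set.
apply: measurable_funTS.
exact: (@measurable_fun_pair2 _ _ _ _ _ _ (F \_ Omega) x (measurable_patch_Omega mF)).
Qed.

Lemma bounded_integrable01 (g : R -> R) M : measurable_fun (`]0, 1[ : set R) g ->
  (forall x, 0 < x < 1 -> `|g x| <= M) -> mu.-integrable `]0, 1[ (EFin \o g).
Proof.
move=> mg gM; apply: measurable_bounded_integrable => //.
  exact: itv_measure_lty.
exists M; split; first exact: num_real.
by move=> N MN x; rewrite /= in_itv/= => /gM /le_trans; apply; exact: ltW.
Qed.

End TwoDim.

Section Slices.
Context {R : realType}.
Local Notation mu := (@lebesgue_measure R).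
Local Notation mu2 := (@leb2 R).
Implicit Types (F : R * R -> R) (M x y : R).

(** Fubini as a sign test: applied to the difference of two integrands, it reduces an inequality
    between integrals over the square to one on each horizontal line. *)
Lemma integralO_xslice_ge0 F : bounded_meas F ->
  (forall y, 0 < y < 1 -> 0 <= \int[mu]_(x in `]0, 1[) F (x, y)) -> 0 <= integralO F.
Proof.
move=> bF F0; have iF := bmeas_integrable (bounded_measW bF).
have [mF [M FM]] := bF.
have iF' := (@integrable_mkcond _ _ R mu2 Omega (EFin \o F) measurable_Omega).1 iF.
rewrite /integralO /Rintegral integral_mkcond fine_ge0//.
rewrite -(@integral21_prod_meas1 _ _ _ _ R mu mu _ iF').
apply: integral_ge0 => y _; rewrite /fubini_G.
have [y01|y01] := boolP (0 < y < 1); last first.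
  rewrite integral0_eq// => x _; rewrite /patch; case: ifPn => //.
  by rewrite inE => -[_ /= ]; rewrite (negbTE y01).
rewrite (_ : (fun x => _) = (fun x => (F (x, y))%:E) \_ `]0, 1[); last first.
  apply/funext => x; rewrite /patch; congr (if _ then _ else _).
  by apply/idP/idP; rewrite !inE /Omega/= in_itv/=; [case|].
rewrite -integral_mkcond.
have -> : (\int[mu]_(x in `]0%R, 1%R[) (F (x, y))%:E = (\int[mu]_(x in `]0%R, 1%R[) F (x, y))%:E)%E.
  rewrite /Rintegral fineK//; apply: integrable_fin_num => //.
  apply: (@bounded_integrable01 _ _ M); first exact: measurable_xslice.
  by move=> x x01; apply: FM.
by rewrite lee_fin F0.
Qed.

Lemma integralO_yslice_ge0 F : bounded_meas F ->
  (forall x, 0 < x < 1 -> 0 <= \int[mu]_(y in `]0, 1[) F (x, y)) -> 0 <= integralO F.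
Proof.
move=> bF F0; have iF := bmeas_integrable (bounded_measW bF).
have [mF [M FM]] := bF.
have iF' := (@integrable_mkcond _ _ R mu2 Omega (EFin \o F) measurable_Omega).1 iF.
rewrite /integralO /Rintegral integral_mkcond fine_ge0//.
rewrite -(@integral12_prod_meas1 _ _ _ _ R mu mu _ iF').
apply: integral_ge0 => x _; rewrite /fubini_F.
have [x01|x01] := boolP (0 < x < 1); last first.
  rewrite integral0_eq// => y _; rewrite /patch; case: ifPn => //.
  by rewrite inE => -[/= + _]; rewrite (negbTE x01).
rewrite (_ : (fun y => _) = (fun y => (F (x, y))%:E) \_ `]0, 1[); last first.
  apply/funext => y; rewrite /patch; congr (if _ then _ else _).
  by apply/idP/idP; rewrite !inE /Omega/= in_itv/=; [case|].
rewrite -integral_mkcond.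
have -> : (\int[mu]_(y in `]0%R, 1%R[) (F (x, y))%:E = (\int[mu]_(y in `]0%R, 1%R[) F (x, y))%:E)%E.
  rewrite /Rintegral fineK//; apply: integrable_fin_num => //.
  apply: (@bounded_integrable01 _ _ M); first exact: measurable_yslice.
  by move=> y y01; apply: FM.
by rewrite lee_fin F0.
Qed.

Lemma integralON F : bmeas F -> integralO (fun p => - F p) = - integralO F.
Proof.
move=> bF; rewrite -mulN1r -integralOZ//; apply: eq_integralO => p _.
by rewrite mulN1r.
Qed.

Lemma RintegralN01 (g : R -> R) : mu.-integrable `]0, 1[ (EFin \o g) ->
  \int[mu]_(x in `]0, 1[) (- g x) = - \int[mu]_(x in `]0, 1[) g x.
Proof.
move=> ig; rewrite -mulN1r -RintegralZl//.
by apply: eq_Rintegral => x _; rewrite mulN1r.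
Qed.

Lemma integrable_xslice F y : bounded_meas F -> 0 < y < 1 ->
  mu.-integrable `]0, 1[ (EFin \o (fun x => F (x, y))).
Proof.
move=> [mF [M FM]] y01; apply: (@bounded_integrable01 _ _ M).
  exact: measurable_xslice.
by move=> x x01; exact: FM.
Qed.

Lemma integrable_yslice F x : bounded_meas F -> 0 < x < 1 ->
  mu.-integrable `]0, 1[ (EFin \o (fun y => F (x, y))).
Proof.
move=> [mF [M FM]] x01; apply: (@bounded_integrable01 _ _ M).
  exact: measurable_yslice.
by move=> y y01; exact: FM.
Qed.

Lemma integralO_xslice_eq0 F : bounded_meas F ->
  (forall y, 0 < y < 1 -> \int[mu]_(x in `]0, 1[) F (x, y) = 0) -> integralO F = 0.
Proof.
move=> bF F0; have F_ge0 : 0 <= integralO F.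
  by apply: integralO_xslice_ge0 => // y /F0 ->.
have : 0 <= integralO (fun p => - F p).
  apply: integralO_xslice_ge0; first exact: bounded_measN.
  move=> y y01; rewrite RintegralN01 ?F0 ?oppr0//; exact: integrable_xslice.
rewrite integralON ?oppr_ge0; last exact: bounded_measW.
by move=> F_le0; apply/eqP; rewrite eq_le F_ge0 F_le0.
Qed.

Lemma integralO_yslice_eq0 F : bounded_meas F ->
  (forall x, 0 < x < 1 -> \int[mu]_(y in `]0, 1[) F (x, y) = 0) -> integralO F = 0.
Proof.
move=> bF F0; have F_ge0 : 0 <= integralO F.
  by apply: integralO_yslice_ge0 => // x /F0 ->.
have : 0 <= integralO (fun p => - F p).
  apply: integralO_yslice_ge0; first exact: bounded_measN.
  move=> x x01; rewrite RintegralN01 ?F0 ?oppr0//; exact: integrable_yslice.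
rewrite integralON ?oppr_ge0; last exact: bounded_measW.
by move=> F_le0; apply/eqP; rewrite eq_le F_ge0 F_le0.
Qed.

Lemma ae_off_xlines (s : seq R) : {ae mu2, forall p, p.1 \notin s}.
Proof.
have cs : countable [set` s] by exact/finite_set_countable/finite_seq.
have ms : measurable ([set` s] : set (measurableTypeR R)) by exact: countable_measurable.
exists ([set` s] `*` setT); split.
- exact: measurableX.
- transitivity (mu [set` s] * mu setT)%E; first exact: product_measure1E.
  by rewrite (countable_lebesgue_measure0 cs) mul0e.
- by move=> p /= /negP; rewrite negbK.
Qed.

Lemma ae_off_ylines (s : seq R) : {ae mu2, forall p, p.2 \notin s}.
Proof.
have cs : countable [set` s] by exact/finite_set_countable/finite_seq.
have ms : measurable ([set` s] : set (measurableTypeR R)) by exact: countable_measurable.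
exists (setT `*` [set` s]); split.
- exact: measurableX.
- transitivity (mu setT * mu [set` s])%E; first exact: product_measure1E.
  by rewrite (countable_lebesgue_measure0 cs) mule0.
- by move=> p /= /negP; rewrite negbK.
Qed.

End Slices.

(** * Measurability of pointwise derivatives *)

Section Measurability.
Context {R : realType}.
Local Notation plane := (measurableTypeR R * measurableTypeR R)%type.
Implicit Types (F : R * R -> R) (x y d : R) (g : R -> R).

Lemma within_Omega_closedP F : {within Omega_closed, continuous F} <->
  forall p, Omega_closed p -> forall e : R, 0 < e -> exists2 r : R, 0 < r &
    forall q, Omega_closed q -> `|q.1 - p.1| < r -> `|q.2 - p.2| < r -> `|F q - F p| < e.
Proof.
split=> [/subspace_continuousP cF p Op e e0|H].
  have /cvgrPdist_lt/(_ e e0) := cF p Op; rewrite near_withinE => /nbhs_ballP[r/= r0 Hr].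
  exists r => // q Oq q1 q2; rewrite distrC; apply: Hr => //.
  by split; rewrite /ball/= distrC.
apply/subspace_continuousP => p Op; apply/cvgrPdist_lt => e e0.
have [r r0 Hr] := H p Op e e0.
rewrite near_withinE; apply/nbhs_ballP; exists r => //= q [q1 q2] Oq.
by rewrite distrC; apply: Hr => //; rewrite distrC.
Qed.

Lemma within_continuous_xslice F y : {within Omega_closed, continuous F} -> 0 <= y <= 1 ->
  {within `[0, 1], continuous (fun x => F (x, y))}.
Proof.
move=> /within_Omega_closedP cF y01; apply/subspace_continuousP => x /=.
rewrite in_itv/= => x01; apply/cvgrPdist_lt => e e0.
have [r r0 Hr] := cF (x, y) (conj x01 y01) e e0.
rewrite near_withinE; apply/nbhs_ballP; exists r => //= z xz; rewrite in_itv/= => z01.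
by rewrite distrC; apply: Hr => //=; rewrite ?subrr ?normr0// distrC.
Qed.

Lemma within_continuous_yslice F x : {within Omega_closed, continuous F} -> 0 <= x <= 1 ->
  {within `[0, 1], continuous (fun y => F (x, y))}.
Proof.
move=> /within_Omega_closedP cF x01; apply/subspace_continuousP => y /=.
rewrite in_itv/= => y01; apply/cvgrPdist_lt => e e0.
have [r r0 Hr] := cF (x, y) (conj x01 y01) e e0.
rewrite near_withinE; apply/nbhs_ballP; exists r => //= z yz; rewrite in_itv/= => z01.
by rewrite distrC; apply: Hr => //=; rewrite ?subrr ?normr0// distrC.
Qed.

Lemma meas_fst g : measurable_fun (`]0, 1[ : set R) g -> meas (fun p => g p.1).
Proof.
move=> mg; apply: (@eq_meas _ (fun p => (g \_ `]0, 1[) p.1)).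
  by move=> p [p1 _]; rewrite /patch mem_set//= in_itv.
apply: (measurable_funS (E := setT)) => //.
have mg' : measurable_fun (setT : set (measurableTypeR R)) (g \_ `]0, 1[ : measurableTypeR R -> R).
  by apply/(measurable_restrictT _ _).1.
by apply: (measurableT_comp mg'); exact: measurable_fst.
Qed.

Lemma meas_snd g : measurable_fun (`]0, 1[ : set R) g -> meas (fun p => g p.2).
Proof.
move=> mg; apply: (@eq_meas _ (fun p => (g \_ `]0, 1[) p.2)).
  by move=> p [_ p2]; rewrite /patch mem_set//= in_itv.
apply: (measurable_funS (E := setT)) => //.
have mg' : measurable_fun (setT : set (measurableTypeR R)) (g \_ `]0, 1[ : measurableTypeR R -> R).
  by apply/(measurable_restrictT _ _).1.
by apply: (measurableT_comp mg'); exact: measurable_snd.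
Qed.

Lemma within_continuous_measurable01 g : {within `[0, 1], continuous g} ->
  measurable_fun (`]0, 1[ : set R) g.
Proof.
move=> cg; apply: (measurable_funS (E := (`[0, 1] : set R))) => //.
  exact: subset_itv_oo_cc.
exact: subspace_continuous_measurable_fun.
Qed.

(** Measurability refers to the product sigma-algebra. Freezing the first variable at the left ends
    of strips of width 1/(n+1) gives finite sums of products of functions of one variable, which
    converge to [F] by continuity. *)
Lemma meas_within_continuous F : {within Omega_closed, continuous F} -> meas F.
Proof.
move=> cF.
pose I (n k : nat) : set R := [set` `[(k%:R / n.+1%:R : R), (k.+1%:R / n.+1%:R : R)[ ].
pose F_ (n : nat) (p : R * R) : R := \sum_(k < n.+1) \1_(I n k) p.1 * F (k%:R / n.+1%:R, p.2).
apply: (@measurable_fun_cvg _ plane R Omega F_).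
  move=> n; apply: measurable_sum => k; apply: measurable_funM.
    by apply: meas_fst; apply: measurable_indic; exact: measurable_itv.
  apply: (@meas_snd (fun y => F (k%:R / n.+1%:R, y))); apply: within_continuous_measurable01; apply: within_continuous_yslice => //.
  by rewrite divr_ge0//= ler_pdivrMr ?mul1r ?ler_nat ?ltr0n// ltnW.
move=> [x y] [/=/andP[x0 x1] y01]; apply/cvgrPdist_lt => e e0.
have Oxy : Omega_closed (x, y) by split => /=; [rewrite !ltW|move: y01 => /andP[? ?]; rewrite !ltW].
have [r r0 Hr] := (within_Omega_closedP F).1 cF (x, y) Oxy e e0.
apply: filterS (near_inv_succ r0) => n nr.
have n0 : 0 < n.+1%:R :> R by rewrite ltr0n.
have /truncn_itv/andP[kx xk] : 0 <= n.+1%:R * x by rewrite mulr_ge0// ltW.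
set k := Num.truncn _ in kx xk.
have kn : (k < n.+1)%N by rewrite -(ltr_nat R) (le_lt_trans kx)// gtr_pMr.
rewrite distrC /F_ (bigD1 (Ordinal kn))//= big1 ?addr0; last first.
  move=> i; rewrite -val_eqE/= => ik; rewrite indicE memNset ?mul0r//; rewrite /I/= in_itv/=.
  rewrite ler_pdivrMr// ltr_pdivlMr// mulrC => /andP[ix xi].
  move: ik; rewrite neq_ltn => /orP[ik|ki].
    by move: xi; rewrite ltNge (le_trans _ kx)// ler_nat.
  by move: xk; rewrite ltNge (le_trans _ ix)// ler_nat.
rewrite indicE mem_set/= ?mul1r; last first.
  by rewrite /I/= in_itv/= ler_pdivrMr// ltr_pdivlMr// mulrC kx.
have xk' : `|k%:R / n.+1%:R - x| < r.
  apply: lt_trans nr; rewrite distrC ger0_norm; last by rewrite subr_ge0 ler_pdivrMr// mulrC.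
  rewrite [ltRHS](_ : _ = k.+1%:R / n.+1%:R - k%:R / n.+1%:R); last first.
    by rewrite -mulrBl -[k.+1%:R]natr1 addrAC subrr add0r mul1r.
  by rewrite ltrD2r ltr_pdivlMr// mulrC.
apply: Hr => //=; last by rewrite subrr normr0.
split; last by case: Oxy.
by rewrite /= divr_ge0//= ler_pdivrMr ?mul1r ?ler_nat ?ltr0n// ltnW.
Qed.

(** On a mesh line both one-sided derivatives of a finite element function exist, but they may
    differ. *)
Definition right_derive g x d := forall e : R, 0 < e -> exists2 r : R, 0 < r &
  forall t, 0 < t < r -> `|g (x + t) - g x - d * t| <= e * t.
Definition left_derive g x d := forall e : R, 0 < e -> exists2 r : R, 0 < r &
  forall t, 0 < t < r -> `|g (x - t) - g x + d * t| <= e * t.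

Lemma is_derive_sides g x d : is_derive x 1 g d <-> right_derive g x d /\ left_derive g x d.
Proof.
rewrite is_derive_expansion; split=> [H|[Hr Hl] e e0].
  split=> e e0; have [r r0 Hr] := H e e0; exists r => // t /andP[t0 tr].
    by have := Hr t; rewrite gtr0_norm//; apply.
  by have := Hr (- t); rewrite normrN gtr0_norm// mulrN opprK; apply.
have [r r0 {}Hr] := Hr e e0; have [l l0 {}Hl] := Hl e e0.
exists (Num.min r l); first by rewrite lt_min r0.
move=> t; rewrite lt_min => /andP[tr tl].
have [t0|t0|->] := ltgtP t 0; last by rewrite addr0 mulr0 !subrr normr0 mulr0.
  have := Hl (- t); rewrite opprK mulrN; move: tl; rewrite ltr0_norm// => tl; apply.
  by rewrite oppr_gt0 t0.
by have := Hr t; move: tr; rewrite gtr0_norm// => tr; apply; rewrite t0.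
Qed.

Lemma right_derive_cvg g x d : right_derive g x d ->
  (fun n => n.+1%:R * (g (x + n.+1%:R^-1) - g x)) @ \oo --> d.
Proof.
move=> H; apply/cvgrPdist_le => e e0; have [r r0 Hr] := H e e0.
apply: filterS (near_inv_succ r0) => n nr.
have n0 : 0 < (n.+1%:R^-1 : R) by rewrite invr_gt0.
have := Hr n.+1%:R^-1; rewrite n0 nr => /(_ isT).
rewrite -ler_pdivrMr// invrK mulrC -[X in X * _](@ger0_norm _ n.+1%:R)// -normrM distrC.
by congr (`| _ | <= _); field.
Qed.

Lemma left_derive_cvg g x d : left_derive g x d ->
  (fun n => n.+1%:R * (g x - g (x - n.+1%:R^-1))) @ \oo --> d.
Proof.
move=> H; apply/cvgrPdist_le => e e0; have [r r0 Hr] := H e e0.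
apply: filterS (near_inv_succ r0) => n nr.
have n0 : 0 < (n.+1%:R^-1 : R) by rewrite invr_gt0.
have := Hr n.+1%:R^-1; rewrite n0 nr => /(_ isT).
rewrite -ler_pdivrMr// invrK mulrC -[X in X * _](@ger0_norm _ n.+1%:R)// -normrM.
by congr (`| _ | <= _); field.
Qed.

Lemma right_derive_uniq g x d1 d2 : right_derive g x d1 -> right_derive g x d2 -> d1 = d2.
Proof. by move=> /right_derive_cvg H1 /right_derive_cvg H2; exact: (cvg_unique _ H1 H2). Qed.

Lemma left_derive_uniq g x d1 d2 : left_derive g x d1 -> left_derive g x d2 -> d1 = d2.
Proof. by move=> /left_derive_cvg H1 /left_derive_cvg H2; exact: (cvg_unique _ H1 H2). Qed.

(* [point] is the junk value of [derive1] where the derivative does not exist; for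
   a finite element function this happens on mesh lines. *)
Lemma derive1_sides g x dr dl : right_derive g x dr -> left_derive g x dl ->
  derive1 g x = if dr == dl then dr else point.
Proof.
move=> Hr Hl; case: eqP => [E|E].
  have [_ <-] : is_derive x 1 g dr by apply/is_derive_sides; split; rewrite // E.
  by rewrite derive1E.
rewrite derive1E /derive; apply: xgetPN => l Hgl; apply: E.
have /is_derive_sides[Hr' Hl'] : is_derive x 1 g l by split; [exact: cvgP Hgl|exact: cvg_lim Hgl].
by rewrite (right_derive_uniq Hr Hr') (left_derive_uniq Hl Hl').
Qed.

(** One-sided derivatives are limits of measurable difference quotients, and [derive1] is their
    common value, or the default [point] where they differ. The shift [sh], the restriction [line]
    and the coordinate [base] let one proof serve both directions. A shifted point may leave [Omega]
    for small [n], hence the extension by zero. *)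
Lemma meas_directional (sh : R -> R * R -> R * R) (line : R * R -> R -> R) (base : R * R -> R) F :
  (forall t, measurable_fun (setT : set plane) (sh t : plane -> plane)) ->
  (forall p, Omega p -> exists2 r : R, 0 < r & forall t, `|t| < r -> Omega (sh t p)) ->
  (forall t p, line p (base p + t) = F (sh t p)) -> (forall p, sh 0 p = p) ->
  meas F ->
  (forall p, Omega p -> exists dr dl,
     right_derive (line p) (base p) dr /\ left_derive (line p) (base p) dl) ->
  meas (fun p => derive1 (line p) (base p)).
Proof.
move=> msh Osh lineE sh0 mF Fd.
have /choice[D HD] : forall p, exists d : R * R, Omega p ->
    right_derive (line p) (base p) d.1 /\ left_derive (line p) (base p) d.2.
  move=> p; have [Op|Op] := pselect (Omega p); last by exists (0, 0).
  by have [dr [dl H]] := Fd p Op; exists (dr, dl).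
have lineE0 p : line p (base p) = F p by rewrite -[in RHS](sh0 p) -lineE addr0.
have mFsh t : measurable_fun (Omega : set plane) ((F \_ Omega) \o sh t : plane -> R).
  apply: (measurable_funS (E := setT)) => //.
  by apply: (measurableT_comp (measurable_patch_Omega mF)); exact: msh.
have near_sh (t_ : nat -> R) p : Omega p -> t_ @ \oo --> 0 ->
    \forall n \near \oo, (F \_ Omega) (sh (t_ n) p) = line p (base p + t_ n).
  move=> Op t0; have [r r0 Hr] := Osh p Op.
  move/cvgrPdist_lt : t0 => /(_ r r0); apply: filterS => n; rewrite sub0r normrN => tr.
  by rewrite lineE /patch mem_set//; exact: Hr.
have patchE p : Omega p -> (F \_ Omega) (sh 0 p) = line p (base p).
  by move=> Op; rewrite sh0 lineE0 /patch mem_set.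
have cvgN : (fun n => - n.+1%:R^-1 : R) @ \oo --> 0.
  by rewrite -[X in _ --> X]oppr0; apply: cvgN; exact: cvg_inv_succ.
have mR : meas (fun p => (D p).1).
  apply: (@measurable_fun_cvg _ plane R Omega
    (fun n p => n.+1%:R * ((F \_ Omega) (sh n.+1%:R^-1 p) - (F \_ Omega) (sh 0 p)))).
    by move=> n; apply: measurable_funM => //; apply: measurable_funB; exact: mFsh.
  move=> p Op; have [Hr _] := HD p Op.
  apply: cvg_trans (right_derive_cvg Hr); apply: near_eq_cvg.
  by apply: filterS (near_sh _ p Op cvg_inv_succ) => n ->; rewrite patchE.
have mL : meas (fun p => (D p).2).
  apply: (@measurable_fun_cvg _ plane R Omega
    (fun n p => n.+1%:R * ((F \_ Omega) (sh 0 p) - (F \_ Omega) (sh (- n.+1%:R^-1) p)))).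
    by move=> n; apply: measurable_funM => //; apply: measurable_funB; exact: mFsh.
  move=> p Op; have [_ Hl] := HD p Op.
  apply: cvg_trans (left_derive_cvg Hl); apply: near_eq_cvg.
  by apply: filterS (near_sh _ p Op cvgN) => n ->; rewrite patchE.
apply: (@eq_meas _ (fun p => if (D p).1 == (D p).2 then (D p).1 else point)).
  by move=> p Op; have [Hr Hl] := HD p Op; rewrite (derive1_sides Hr Hl).
apply: measurable_fun_if => //.
- exact: measurable_Omega.
- exact: measurable_fun_eqr.
- by apply: measurable_funS mR; [exact: measurable_Omega|exact: subIsetl].
Qed.

Lemma Omega_ball p : Omega p -> exists2 r : R, 0 < r &
  forall q, `|q.1 - p.1| < r -> `|q.2 - p.2| < r -> Omega q.
Proof.
case: p => x y [/=/andP[x0 x1] /andP[y0 y1]].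
exists (Num.min (Num.min x (1 - x)) (Num.min y (1 - y))).
  by rewrite !lt_min x0 y0 !subr_gt0 x1 y1.
move=> [x' y'] /=; rewrite !lt_min => /andP[/andP[h1 h2] _] /andP[_ /andP[h3 h4]].
split => /=.
  by move: h1 h2; rewrite !ltr_norml => /andP[? ?] /andP[? ?]; apply/andP; split; lra.
by move: h3 h4; rewrite !ltr_norml => /andP[? ?] /andP[? ?]; apply/andP; split; lra.
Qed.

Lemma meas_pdx F : meas F ->
  (forall p, Omega p -> exists dr dl,
     right_derive (fun t => F (t, p.2)) p.1 dr /\ left_derive (fun t => F (t, p.2)) p.1 dl) ->
  meas (pdx F).
Proof.
move=> mF H; apply: (@meas_directional (fun t p => (p.1 + t, p.2)) (fun p t => F (t, p.2)) fst F) => //.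
- move=> t; apply: measurable_fun_pair; last exact: measurable_snd.
  by apply: measurable_funD => //; exact: measurable_fst.
- move=> p /Omega_ball[r r0 Hr]; exists r => // t tr.
  by apply: Hr => /=; rewrite ?subrr ?normr0// addrC addKr.
- by move=> -[x y]/=; rewrite addr0.
Qed.

Lemma meas_pdy F : meas F ->
  (forall p, Omega p -> exists dr dl,
     right_derive (fun t => F (p.1, t)) p.2 dr /\ left_derive (fun t => F (p.1, t)) p.2 dl) ->
  meas (pdy F).
Proof.
move=> mF H; apply: (@meas_directional (fun t p => (p.1, p.2 + t)) (fun p t => F (p.1, t)) snd F) => //.
- move=> t; apply: measurable_fun_pair; first exact: measurable_fst.
  by apply: measurable_funD => //; exact: measurable_snd.
- move=> p /Omega_ball[r r0 Hr]; exists r => // t tr.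
  by apply: Hr => /=; rewrite ?subrr ?normr0// addrC addKr.
- by move=> -[x y]/=; rewrite addr0.
Qed.

Lemma meas_pdx_derivable F : meas F -> (forall p, Omega p -> derivable_x F p) -> meas (pdx F).
Proof.
move=> mF dF; apply: meas_pdx => // p Op; exists (pdx F p), (pdx F p).
by apply/is_derive_sides; rewrite /pdx derive1E; exact/derivableP/dF.
Qed.

Lemma meas_pdy_derivable F : meas F -> (forall p, Omega p -> derivable_y F p) -> meas (pdy F).
Proof.
move=> mF dF; apply: meas_pdy => // p Op; exists (pdy F p), (pdy F p).
by apply/is_derive_sides; rewrite /pdy derive1E; exact/derivableP/dF.
Qed.

End Measurability.

(** * Bilinear finite elements *)

Section Ramp.
Context {R : realType}.
Implicit Types (a b x y : R).

(** A clamped affine function. A hat is the difference of two consecutive ramps, so that one formula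
    without cases holds on the whole line. *)
Definition ramp a b x := Num.max 0 (Num.min 1 ((x - a) / (b - a))).
Definition dramp a b x := (b - a)^-1 * \1_([set` `]a, b[ ] : set R) x.

Lemma ramp_left a b x : a < b -> x <= a -> ramp a b x = 0.
Proof.
move=> ab xa; have : (x - a) / (b - a) <= 0 by rewrite ler_pdivrMr ?mul0r subr_cp0.
by move=> h; rewrite /ramp min_r ?max_l// (le_trans h).
Qed.

Lemma ramp_right a b x : a < b -> b <= x -> ramp a b x = 1.
Proof.
move=> ab bx; have : 1 <= (x - a) / (b - a).
  by rewrite ler_pdivlMr ?subr_gt0// mul1r lerD2r.
by move=> h; rewrite /ramp min_l ?max_r// ler01.
Qed.

Lemma ramp_mid a b x : a < b -> a <= x <= b -> ramp a b x = (x - a) / (b - a).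
Proof.
move=> ab /andP[ax xb]; rewrite /ramp min_r ?max_r//.
  by rewrite divr_ge0 ?subr_ge0// ltW.
by rewrite ler_pdivrMr ?subr_gt0// mul1r lerD2r.
Qed.

Lemma ramp_ge0 a b x : 0 <= ramp a b x.
Proof. by rewrite /ramp le_max lexx. Qed.

Lemma ramp_le1 a b x : ramp a b x <= 1.
Proof. by rewrite /ramp ge_max ler01 ge_min lexx. Qed.

Lemma ramp_lipschitz a b x y : x <= y ->
  `|ramp a b y - ramp a b x| <= `|(b - a)^-1| * (y - x).
Proof.
move=> xy; have -> : `|(b - a)^-1| * (y - x) = `|(y - a) / (b - a) - (x - a) / (b - a)|.
  have -> : (y - a) / (b - a) - (x - a) / (b - a) = (b - a)^-1 * (y - x) by ring.
  by rewrite normrM (ger0_norm (x := y - x)) ?subr_ge0.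
rewrite /ramp; set p := (y - a) / _; set q := (x - a) / _.
have : p - q <= `|p - q| by exact: ler_norm.
have : - `|p - q| <= p - q by rewrite lerNl -normrN ler_norm.
set d := `|p - q| => d1 d2.
case: (leP 1 p) => hp; case: (leP 1 q) => hq; rewrite ?(max_r ler01);
  try case: (leP 0 p) => hp'; try case: (leP 0 q) => hq'; rewrite ler_norml; apply/andP; split; lra.
Qed.

Lemma ramp_continuous a b : continuous (ramp a b).
Proof.
apply: (@lipschitz_continuous _ _ `|(b - a)^-1|) => //.
by move=> x y; exact: ramp_lipschitz.
Qed.

Lemma is_derive_near (f g : R -> R) x d r : 0 < r ->
  (forall t, `|t| < r -> f (x + t) = g (x + t)) -> is_derive x 1 g d -> is_derive x 1 f d.
Proof.
move=> r0 fg /is_derive_expansion H; apply/is_derive_expansion => e e0.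
have [l l0 Hl] := H e e0; exists (Num.min r l); first by rewrite lt_min r0.
move=> t; rewrite lt_min => /andP[tr tl].
have := fg 0; rewrite normr0 addr0 => /(_ r0) ->.
by rewrite fg// Hl.
Qed.

Lemma is_derive_ramp a b x : a < b -> x \notin [:: a; b] -> is_derive x 1 (ramp a b) (dramp a b x).
Proof.
move=> ab; rewrite !inE negb_or => /andP[xa xb].
have ba : b - a != 0 by rewrite subr_eq0 gt_eqF.
have [xlta|altx] := ltP x a.
  apply: (@is_derive_near _ (cst 0) _ _ (a - x)); first by rewrite subr_gt0.
    move=> t; rewrite ltr_norml => /andP[_ ta]; rewrite ramp_left// ltW//.
    by rewrite -ltrBrDl.
  rewrite /dramp indicE memNset ?mulr0; first exact: is_derive_cst.
  by rewrite /= in_itv/= => /andP[ax _]; move: xlta; rewrite ltNge ltW.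
have [bltx|xleb] := ltP b x.
  apply: (@is_derive_near _ (cst 1) _ _ (x - b)); first by rewrite subr_gt0.
    move=> t; rewrite ltr_norml => /andP[ta _]; rewrite ramp_right// ltW//.
    by rewrite -ltrBlDl; move: ta; rewrite opprB.
  rewrite /dramp indicE memNset ?mulr0; first exact: is_derive_cst.
  by rewrite /= in_itv/= => /andP[_ bx]; move: bltx; rewrite ltNge ltW.
have ax' : a < x by rewrite lt_neqAle eq_sym xa.
have xb' : x < b by rewrite lt_neqAle xb.
apply: (@is_derive_near _ (fun z => (z - a) / (b - a)) _ _ (Num.min (x - a) (b - x))).
- by rewrite lt_min !subr_gt0 ax'.
- move=> t; rewrite lt_min !ltr_norml => /andP[/andP[h1 h2] /andP[h3 h4]].
  by rewrite ramp_mid//; apply/andP; split; lra.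
rewrite /dramp indicE mem_set ?mulr1; last by rewrite /= in_itv/= ax'.
apply/is_derive_expansion => e e0; exists 1 => // t _.
have -> : (x + t - a) / (b - a) - (x - a) / (b - a) - (b - a)^-1 * t = 0 by field.
by rewrite normr0 mulr_ge0// ltW.
Qed.

Lemma measurable_dramp a b (D : set R) : measurable_fun D (dramp a b).
Proof.
by apply: measurable_funM => //; apply: measurable_indic; exact: measurable_itv.
Qed.

Lemma dramp_bound a b x : `|dramp a b x| <= `|(b - a)^-1|.
Proof.
rewrite /dramp normrM ler_piMr// indicE.
by case: (_ \in _); rewrite ?normr1// normr0.
Qed.

End Ramp.

(** * Grids on the unit interval and piecewise linear interpolation *)

Section Grid.
Context {R : realType}.
Implicit Types (s : seq R) (x : R) (c : nat -> R).

Definition grid s := [/\ (1 < size s)%N, s`_0 = 0, s`_(size s).-1 = 1 &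
  forall i, (i.+1 < size s)%N -> s`_i < s`_i.+1].

Lemma grid_le s i j : grid s -> (i <= j < size s)%N -> s`_i <= s`_j.
Proof.
move=> [_ _ _ slt] /andP[]; elim: j => [|j IHj]; first by rewrite leqn0 => /eqP->.
rewrite leq_eqVlt => /predU1P[->//|]; rewrite ltnS => ij js.
by rewrite (le_trans (IHj ij (ltnW js)))// ltW// slt.
Qed.

Lemma grid_itv s i : grid s -> (i < size s)%N -> 0 <= s`_i <= 1.
Proof.
move=> gs si; have [s1 s0 sn _] := gs.
rewrite -[X in X <= _ <= _]s0 -[X in _ <= _ <= X]sn !grid_le//.
by case: (size s) si => // n; rewrite ltnS /= => ->/=.
Qed.

(** At a node the cell to its right is chosen, so that a cellwise formula holds on a right
    neighbourhood of [x]; [grid_cell_left] is the mirror image. *)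
Lemma grid_cell_right s x : grid s -> 0 <= x < 1 ->
  exists2 i, (i.+1 < size s)%N & s`_i <= x < s`_i.+1.
Proof.
move=> gs /andP[x0 x1]; have [s1 s0 sn _] := gs.
have ex : exists m, (m < size s)%N && (x < s`_m).
  by exists (size s).-1; rewrite sn x1 andbT prednK// ltnW.
case: (ex_minnP ex) => -[|m] /andP[ms xm] min.
  by move: xm; rewrite s0 ltNge x0.
exists m => //; rewrite xm andbT leNgt; apply/negP => xm'.
by have := min m; rewrite xm' (ltnW ms)/= => /(_ isT); rewrite ltnn.
Qed.

Lemma grid_cell_left s x : grid s -> 0 < x <= 1 ->
  exists2 i, (i.+1 < size s)%N & s`_i < x <= s`_i.+1.
Proof.
move=> gs /andP[x0 x1]; have [s1 s0 sn _] := gs.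
have ex : exists m, (m < size s)%N && (x <= s`_m).
  by exists (size s).-1; rewrite sn x1 andbT prednK// ltnW.
case: (ex_minnP ex) => -[|m] /andP[ms xm] min.
  by move: xm; rewrite s0 leNgt x0.
exists m => //; rewrite xm andbT ltNge; apply/negP => xm'.
by have := min m; rewrite xm' (ltnW ms)/= => /(_ isT); rewrite ltnn.
Qed.

Lemma grid_cell s x : grid s -> 0 <= x <= 1 ->
  exists2 i, (i.+1 < size s)%N & s`_i <= x <= s`_i.+1.
Proof.
move=> gs /andP[x0]; rewrite le_eqVlt => /predU1P[->|x1].
  have [|i si /andP[h1 h2]] := @grid_cell_left s 1 gs; first by rewrite ltr01 lexx.
  by exists i; rewrite // h2 ltW.
have [|i si /andP[h1 h2]] := @grid_cell_right s x gs; first by rewrite x0.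
by exists i; rewrite // h1 ltW.
Qed.

Lemma grid_open_cell s x : grid s -> 0 < x < 1 -> x \notin s ->
  exists2 i, (i.+1 < size s)%N & s`_i < x < s`_i.+1.
Proof.
move=> gs /andP[x0 x1] xs; have [|i si /andP[h1 h2]] := @grid_cell_right s x gs.
  by rewrite ltW.
exists i; rewrite // h2 andbT lt_neqAle h1 andbT.
by apply: contraNneq xs => <-; rewrite mem_nth// ltnW.
Qed.

(* As [s`_0.-1 = s`_0] and [s] is padded with zeros, [hat s i] is the usual hat
   function only for [0 < i] and [i.+1 < size s]; the other nodes carry the
   coefficient zero below. *)
Definition hat s (i : nat) x := ramp s`_i.-1 s`_i x - ramp s`_i s`_i.+1 x.
Definition dhat s (i : nat) x := dramp s`_i.-1 s`_i x - dramp s`_i s`_i.+1 x.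

Lemma sum_two (N k : nat) c (a b : R) : (k.+1 < N)%N ->
  \sum_(i < N) c i * ((i == k :> nat)%:R * a + (i == k.+1 :> nat)%:R * b) =
  c k * a + c k.+1 * b.
Proof.
move=> kN.
have delta (l : nat) (d : R) : (l < N)%N -> \sum_(i < N) c i * ((i == l :> nat)%:R * d) = c l * d.
  move=> lN; rewrite (bigD1 (Ordinal lN))//= eqxx mul1r big1 ?addr0// => i.
  by rewrite -val_eqE/= => /negbTE->; rewrite mul0r mulr0.
under eq_bigr do rewrite mulrDr.
by rewrite big_split/= !delta// ltnW.
Qed.

(** [A j] stands for the ramp from node [j] to node [j.+1], or for its derivative, at a fixed point
    of cell [k]: only the hats of the two ends of that cell survive. The end coefficients must
    vanish because the first and the last [hat] are not true hat functions. *)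
Lemma sum_hat_pattern s c (A : nat -> R) (k : nat) (a b : R) :
  grid s -> c 0%N = 0 -> c (size s).-1 = 0 -> (k.+1 < size s)%N ->
  (forall i, (0 < i)%N -> (i.+1 < size s)%N ->
     A i.-1 - A i = (i == k)%:R * a + (i == k.+1)%:R * b) ->
  \sum_(i < size s) c i * (A i.-1 - A i) = c k * a + c k.+1 * b.
Proof.
move=> [s1 _ _ _] c0 cn ks HA; rewrite -(@sum_two (size s) k)//.
apply: eq_bigr => -[[|i] /= si] _; first by rewrite c0 !mul0r.
have [isz|] := ltnP i.+2 (size s); first by rewrite -HA.
move=> si'; have E : size s = i.+2 by apply/eqP; rewrite eqn_leq si' si.
have -> : c i.+1 = 0 by rewrite -cn E.
by rewrite !mul0r.
Qed.

Lemma ramp_cell s j k x : grid s -> (j.+1 < size s)%N -> (k.+1 < size s)%N ->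
  s`_k <= x <= s`_k.+1 ->
  ramp s`_j s`_j.+1 x = (j < k)%:R + (j == k)%:R * ((x - s`_k) / (s`_k.+1 - s`_k)).
Proof.
move=> gs js ks xk; have [_ _ _ slt] := gs; have /andP[kx xk1] := xk.
have [jk|kj|->] := ltngtP j k.
- rewrite mul0r addr0 ramp_right ?slt//.
  by apply: le_trans kx; rewrite grid_le// jk ltnW.
- rewrite mul0r addr0 ramp_left ?slt//.
  by apply: (le_trans xk1); rewrite grid_le// kj ltnW.
- by rewrite add0r mul1r ramp_mid// slt.
Qed.

Definition interp s c x := \sum_(i < size s) c i * hat s i x.
Definition dinterp s c x := \sum_(i < size s) c i * dhat s i x.

Lemma interp_cell s c k x : grid s -> c 0%N = 0 -> c (size s).-1 = 0 ->
  (k.+1 < size s)%N -> s`_k <= x <= s`_k.+1 ->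
  interp s c x = c k * (1 - (x - s`_k) / (s`_k.+1 - s`_k)) +
                 c k.+1 * ((x - s`_k) / (s`_k.+1 - s`_k)).
Proof.
move=> gs c0 cn ks xk; rewrite /interp /hat.
set t := _ / _.
rewrite -(@sum_hat_pattern s c (fun j => ramp s`_j s`_j.+1 x) k (1 - t) t gs c0 cn ks).
  apply: eq_bigr => -[[|i] /= si] _; first by rewrite c0 !mul0r.
  by [].
move=> [//|i] _ si /=; rewrite !(ramp_cell gs _ ks xk)// -/t; last exact: ltnW.
rewrite eqSS; case: (ltngtP i k) => [ik|ki|->].
- by rewrite [(i.+1 < k)%N]ltn_neqAle ik andbT; case: (i.+1 == k) => /=; ring.
- by rewrite ltnNge (leqW (ltnW ki)) (gtn_eqF (leqW ki : k < i.+1)%N)/=; ring.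
- by rewrite ltnNge leqnSn (gtn_eqF (ltnSn k))/=; ring.
Qed.

Lemma dinterp_cell s c k x : grid s -> c 0%N = 0 -> c (size s).-1 = 0 ->
  (k.+1 < size s)%N -> s`_k < x < s`_k.+1 ->
  dinterp s c x = (c k.+1 - c k) / (s`_k.+1 - s`_k).
Proof.
move=> gs c0 cn ks /andP[kx xk]; rewrite /dinterp /dhat.
have -> : (c k.+1 - c k) / (s`_k.+1 - s`_k) =
    c k * (- (s`_k.+1 - s`_k)^-1) + c k.+1 * (s`_k.+1 - s`_k)^-1 by ring.
set t := _^-1.
rewrite -(@sum_hat_pattern s c (fun j => dramp s`_j s`_j.+1 x) k (- t) t gs c0 cn ks).
  apply: eq_bigr => -[[|i] /= si] _; first by rewrite c0 !mul0r.
  by [].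
have dE j : (j.+1 < size s)%N -> dramp s`_j s`_j.+1 x = (j == k)%:R * t.
  move=> js; rewrite /dramp indicE; have [->|jk] := eqVneq j k.
    by rewrite mem_set ?mulr1 ?mul1r//= in_itv/= kx.
  rewrite memNset ?mulr0 ?mul0r//= in_itv/= => /andP[jx xj].
  move: jk; rewrite neq_ltn => /orP[jk|kj].
    move: (lt_trans kx xj); rewrite ltNge grid_le// jk; exact: ltnW.
  by move: (lt_trans jx xk); rewrite ltNge grid_le// kj; exact: ltnW.
move=> [//|i] _ si /=; rewrite !dE//; last exact: ltnW.
by rewrite eqSS; ring.
Qed.

End Grid.

(** * Tensor products of hat functions *)

Section Tensor.
Context {R : realType}.
Implicit Types (s xs ys : seq R) (x y : R) (c : nat -> nat -> R).

Lemma hat_continuous s i : continuous (hat s i).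
Proof. by move=> x; apply: cvgB; exact: ramp_continuous. Qed.

Lemma hat_bound s i x : `|hat s i x| <= 1.
Proof.
rewrite /hat ler_norml; have := ramp_ge0 s`_i.-1 s`_i x; have := ramp_le1 s`_i.-1 s`_i x.
have := ramp_ge0 s`_i s`_i.+1 x; have := ramp_le1 s`_i s`_i.+1 x.
by move=> *; apply/andP; split; lra.
Qed.

Lemma hat_outside s i x : grid s -> (0 < i)%N -> (i.+1 < size s)%N ->
  ~~ (0 < x < 1) -> hat s i x = 0.
Proof.
move=> gs i0 is_ x01; have [_ _ _ slt] := gs.
have lt1 : s`_i.-1 < s`_i by have := slt i.-1; rewrite prednK//; apply; exact: ltnW.
have lt2 := slt _ is_.
have i1s : (i.-1 < size s)%N by rewrite prednK// ltnW// ltnW.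
have /andP[a0 _] := grid_itv gs i1s.
have /andP[_ b1] := grid_itv gs is_.
move: x01; rewrite negb_and -!leNgt => /orP[x0|x1].
  by rewrite /hat !ramp_left ?subrr//; lra.
by rewrite /hat !ramp_right ?subrr//; lra.
Qed.

Lemma is_derive_hat s i x : grid s -> (0 < i)%N -> (i.+1 < size s)%N -> x \notin s ->
  is_derive x 1 (hat s i) (dhat s i x).
Proof.
move=> gs i0 is_ xs; have [_ _ _ slt] := gs.
have lt1 : s`_i.-1 < s`_i by have := slt i.-1; rewrite prednK//; apply; exact: ltnW.
have lt2 := slt _ is_.
have xn j : (j < size s)%N -> x == s`_j = false.
  by move=> js; apply: contraNF xs => /eqP->; rewrite mem_nth.
have i1s : (i.-1 < size s)%N by rewrite prednK// ltnW// ltnW.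
apply: is_deriveB; apply: is_derive_ramp; rewrite // !inE !xn// ltnW//.
Qed.

Lemma measurable_dhat s i (D : set R) : measurable_fun D (dhat s i).
Proof. by apply: measurable_funB; exact: measurable_dramp. Qed.

Lemma dhat_bound s i : exists M : R, forall x, `|dhat s i x| <= M.
Proof.
exists (`|(s`_i - s`_i.-1)^-1| + `|(s`_i.+1 - s`_i)^-1|) => x.
by rewrite (le_trans (ler_normB _ _))// lerD// dramp_bound.
Qed.

Lemma is_derive_interp s (c : nat -> R) x : grid s -> c 0%N = 0 -> c (size s).-1 = 0 ->
  x \notin s -> is_derive x 1 (interp s c) (dinterp s c x).
Proof.
move=> gs c0 cn xs; have [s1 _ _ _] := gs.
have -> : interp s c = \sum_(i < size s) (fun x => c i * hat s i x).
  by apply/funext => z; rewrite fct_sumE.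
apply: is_derive_sum => -[i /= si].
have [i0|i0] := posnP i; first by rewrite i0 c0 mul0r; under eq_fun do rewrite mul0r; exact: is_derive_cst.
have [si'|si'] := ltnP i.+1 (size s).
  by apply: is_deriveZ; exact: is_derive_hat.
have E : size s = i.+1 by apply/eqP; rewrite eqn_leq si' si.
have -> : c i = 0 by rewrite -cn E.
by rewrite mul0r; under eq_fun do rewrite mul0r; exact: is_derive_cst.
Qed.

Lemma interp_continuous s (c : nat -> R) : continuous (interp s c).
Proof.
have -> : interp s c = \sum_(i < size s) (fun x => c i * hat s i x).
  by apply/funext => z; rewrite fct_sumE.
elim/big_ind: _ => [|f g cf cg|i _] x; first exact: cvg_cst.
  by apply: cvgD; [exact: cf|exact: cg].
by apply: cvgM; [exact: cvg_cst|exact: hat_continuous].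
Qed.

(** Finite element functions in the global basis. The formal derivatives [tensor_x] and [tensor_y]
    have values on mesh lines too and are bounded on all of [Omega], as the slice arguments
    require. *)
Definition tensor xs ys c (p : R * R) :=
  \sum_(i < size xs) \sum_(j < size ys) c i j * (hat xs i p.1 * hat ys j p.2).
Definition tensor_x xs ys c (p : R * R) :=
  \sum_(i < size xs) \sum_(j < size ys) c i j * (dhat xs i p.1 * hat ys j p.2).
Definition tensor_y xs ys c (p : R * R) :=
  \sum_(i < size xs) \sum_(j < size ys) c i j * (hat xs i p.1 * dhat ys j p.2).

Lemma tensorE xs ys c p : tensor xs ys c p = interp xs (fun i => interp ys (c i) p.2) p.1.
Proof.
apply: eq_bigr => i _; rewrite mulr_suml; apply: eq_bigr => j _.
by rewrite -mulrA [hat ys _ _ * _]mulrC.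
Qed.

Lemma tensor_xE xs ys c p : tensor_x xs ys c p = dinterp xs (fun i => interp ys (c i) p.2) p.1.
Proof.
apply: eq_bigr => i _; rewrite mulr_suml; apply: eq_bigr => j _.
by rewrite -mulrA [hat ys _ _ * _]mulrC.
Qed.

Lemma tensorE' xs ys c p : tensor xs ys c p = interp ys (fun j => interp xs (c^~ j) p.1) p.2.
Proof.
rewrite /tensor exchange_big; apply: eq_bigr => i _; rewrite mulr_suml; apply: eq_bigr => j _.
by rewrite -mulrA.
Qed.

Lemma tensor_yE xs ys c p : tensor_y xs ys c p = dinterp ys (fun j => interp xs (c^~ j) p.1) p.2.
Proof.
rewrite /tensor_y exchange_big; apply: eq_bigr => i _; rewrite mulr_suml; apply: eq_bigr => j _.
by rewrite -mulrA.
Qed.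

Definition zero_bd xs ys c := forall i j,
  [/\ c 0%N j = 0, c (size xs).-1 j = 0, c i 0%N = 0 & c i (size ys).-1 = 0].

Lemma interp0 s (c : nat -> R) x : (forall i, c i = 0) -> interp s c x = 0.
Proof. by move=> c0; rewrite /interp big1// => i _; rewrite c0 mul0r. Qed.

Lemma is_derive_tensor_x xs ys c x y : grid xs -> zero_bd xs ys c -> x \notin xs ->
  is_derive x 1 (fun t => tensor xs ys c (t, y)) (tensor_x xs ys c (x, y)).
Proof.
move=> gx cz xn; rewrite tensor_xE/=.
rewrite (_ : (fun t => _) = interp xs (fun i => interp ys (c i) y)); last first.
  by apply/funext => t; rewrite tensorE.
by apply: is_derive_interp => //; apply: interp0 => j; have [] := cz 0%N j.
Qed.

Lemma is_derive_tensor_y xs ys c x y : grid ys -> zero_bd xs ys c -> y \notin ys ->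
  is_derive y 1 (fun t => tensor xs ys c (x, t)) (tensor_y xs ys c (x, y)).
Proof.
move=> gy cz yn; rewrite tensor_yE/=.
rewrite (_ : (fun t => _) = interp ys (fun j => interp xs (c^~ j) x)); last first.
  by apply/funext => t; rewrite tensorE'.
by apply: is_derive_interp => //; apply: interp0 => i; have [] := cz i 0%N.
Qed.

Lemma bounded_meas_sum (n : nat) (F : 'I_n -> R * R -> R) :
  (forall i, bounded_meas (F i)) -> bounded_meas (fun p => \sum_(i < n) F i p).
Proof.
move=> bF; rewrite (_ : (fun p => _) = \sum_(i < n) F i); last first.
  by apply/funext => p; rewrite fct_sumE.
elim/big_ind: _ => [|f g bf bg|i _]; [exact: bounded_meas_cst|exact: bounded_measD|exact: bF].
Qed.

Lemma bounded_meas_fst (g : R -> R) (M : R) : measurable_fun (`]0, 1[ : set R) g ->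
  (forall x, `|g x| <= M) -> bounded_meas (fun p => g p.1).
Proof. by move=> mg gM; split; [exact: meas_fst|exists M]. Qed.

Lemma bounded_meas_snd (g : R -> R) (M : R) : measurable_fun (`]0, 1[ : set R) g ->
  (forall x, `|g x| <= M) -> bounded_meas (fun p => g p.2).
Proof. by move=> mg gM; split; [exact: meas_snd|exists M]. Qed.

Lemma measurable_hat s i (D : set R) : measurable_fun D (hat s i).
Proof. by apply: (measurable_funS (E := setT)) => //; exact: continuous_measurable_fun (@hat_continuous s i). Qed.

Lemma bounded_meas_tensor xs ys c : bounded_meas (tensor xs ys c).
Proof.
apply: bounded_meas_sum => i; apply: bounded_meas_sum => j.
apply: bounded_measM; first exact: bounded_meas_cst.
apply: bounded_measM.
- by apply: (@bounded_meas_fst (hat xs i) 1); [exact: measurable_hat|exact: hat_bound].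
- by apply: (@bounded_meas_snd (hat ys j) 1); [exact: measurable_hat|exact: hat_bound].
Qed.

Lemma bounded_meas_tensor_x xs ys c : bounded_meas (tensor_x xs ys c).
Proof.
apply: bounded_meas_sum => i; apply: bounded_meas_sum => j.
apply: bounded_measM; first exact: bounded_meas_cst.
have [M HM] := dhat_bound xs i.
apply: bounded_measM.
- by apply: (@bounded_meas_fst (dhat xs i) M) => //; exact: measurable_dhat.
- by apply: (@bounded_meas_snd (hat ys j) 1); [exact: measurable_hat|exact: hat_bound].
Qed.

Lemma bounded_meas_tensor_y xs ys c : bounded_meas (tensor_y xs ys c).
Proof.
apply: bounded_meas_sum => i; apply: bounded_meas_sum => j.
apply: bounded_measM; first exact: bounded_meas_cst.
have [M HM] := dhat_bound ys j.
apply: bounded_measM.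
- by apply: (@bounded_meas_fst (hat xs i) 1); [exact: measurable_hat|exact: hat_bound].
- by apply: (@bounded_meas_snd (dhat ys j) M) => //; exact: measurable_dhat.
Qed.

End Tensor.

Section FiniteElements.
Context {R : realType}.
Implicit Types (s xs ys : seq R) (x : R) (c : nat -> nat -> R) (v : R * R -> R).

Lemma grid_itv_nth s i : grid s -> 0 <= s`_i <= 1.
Proof.
move=> gs; have [si|si] := ltnP i (size s); first exact: grid_itv.
by rewrite nth_default// lexx ler01.
Qed.

Definition nodal v xs ys : nat -> nat -> R := fun i j => v (xs`_i, ys`_j).

Lemma zero_bd_nodal v xs ys : grid xs -> grid ys -> (forall p, Omega_boundary p -> v p = 0) ->
  zero_bd xs ys (nodal v xs ys).
Proof.
move=> gx gy v0 i j; have [_ x0 xn _] := gx; have [_ y0 yn _] := gy.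
have hx k := @grid_itv_nth xs k gx; have hy k := @grid_itv_nth ys k gy.
split; apply: v0; (split; first by split; [exact: hx|exact: hy]) => -[/=];
  by rewrite ?x0 ?y0 ?xn ?yn ?ltxx ?andbF.
Qed.

Definition bary s k x := (x - s`_k) / (s`_k.+1 - s`_k).

Lemma tensor_cell xs ys c k l p : grid xs -> grid ys -> zero_bd xs ys c ->
  (k.+1 < size xs)%N -> (l.+1 < size ys)%N -> mesh_cell xs ys k l p ->
  tensor xs ys c p =
    (c k l * (1 - bary ys l p.2) + c k l.+1 * bary ys l p.2) * (1 - bary xs k p.1) +
    (c k.+1 l * (1 - bary ys l p.2) + c k.+1 l.+1 * bary ys l p.2) * bary xs k p.1.
Proof.
move=> gx gy cz ks ls [pk pl]; rewrite tensorE (interp_cell gx _ _ ks pk); last 2 first.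
- by apply: interp0 => j; have [] := cz 0%N j.
- by apply: interp0 => j; have [] := cz 0%N j.
by rewrite !(interp_cell gy _ _ ls pl)//; have [] := cz k 0%N; have [] := cz k.+1 0%N.
Qed.

Lemma grid_step s k : grid s -> (k.+1 < size s)%N -> s`_k.+1 - s`_k != 0.
Proof. by move=> [_ _ _ slt] /slt h; rewrite subr_eq0 gt_eqF. Qed.

Lemma Omega_closed_cell xs ys p : grid xs -> grid ys -> Omega_closed p ->
  exists k l, [/\ (k.+1 < size xs)%N, (l.+1 < size ys)%N & mesh_cell xs ys k l p].
Proof.
move=> gx gy [p1 p2]; have [k ks kp] := grid_cell gx p1; have [l ls lp] := grid_cell gy p2.
by exists k, l.
Qed.

(** Both sides are bilinear on each cell and agree at its four corners. *)
Lemma Vh_tensor xs ys v p : grid xs -> grid ys -> Vh xs ys v -> Omega_closed p ->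
  v p = tensor xs ys (nodal v xs ys) p.
Proof.
move=> gx gy [_ vcell v0] Op; have cz := zero_bd_nodal gx gy v0.
have [k [l [ks ls pkl]]] := Omega_closed_cell gx gy Op.
rewrite (tensor_cell gx gy cz ks ls pkl).
have [a0 [a1 [a2 [a3 vE]]]] := vcell k l ks ls.
have [[_ _ _ /(_ k ks)/ltW hk] [_ _ _ /(_ l ls)/ltW hl]] := (gx, gy).
have vcorner a b : a = xs`_k \/ a = xs`_k.+1 -> b = ys`_l \/ b = ys`_l.+1 ->
    v (a, b) = a0 + a1 * a + a2 * b + a3 * (a * b).
  by move=> [->|->] [->|->]; rewrite vE//; split; rewrite /= ?lexx ?hk ?hl.
rewrite vE// /nodal !vcorner; try by [left|right].
rewrite /bary; have := grid_step gx ks; have := grid_step gy ls.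
by move=> h1 h2; field; rewrite h1 h2.
Qed.

Lemma interp_outside s (c : nat -> R) x : grid s -> c 0%N = 0 -> c (size s).-1 = 0 ->
  ~~ (0 < x < 1) -> interp s c x = 0.
Proof.
move=> gs c0 cn x01; rewrite /interp big1// => -[i /= si] _.
have [->|i0] := posnP i; first by rewrite c0 mul0r.
have [si'|si'] := ltnP i.+1 (size s); first by rewrite hat_outside// mulr0.
have E : size s = i.+1 by apply/eqP; rewrite eqn_leq si' si.
have -> : c i = 0 by rewrite -cn E.
by rewrite mul0r.
Qed.

Lemma tensor_continuous xs ys c : continuous (tensor xs ys c).
Proof.
have -> : tensor xs ys c = \sum_(i < size xs) \sum_(j < size ys)
    (fun p => c i j * (hat xs i p.1 * hat ys j p.2)).
  by apply/funext => p; rewrite fct_sumE; apply: eq_bigr => i _; rewrite fct_sumE.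
elim/big_ind: _ => [|f g cf cg|i _]; first by move=> p; exact: cvg_cst.
  by move=> p; apply: cvgD; [exact: cf|exact: cg].
elim/big_ind: _ => [|f g cf cg|j _]; first by move=> p; exact: cvg_cst.
  by move=> p; apply: cvgD; [exact: cf|exact: cg].
move=> p; apply: cvgM; first exact: cvg_cst.
apply: cvgM.
  by apply: (@cvg_comp _ _ _ fst (hat xs i)); [exact: cvg_fst|exact: hat_continuous].
by apply: (@cvg_comp _ _ _ snd (hat ys j)); [exact: cvg_snd|exact: hat_continuous].
Qed.

Lemma tensor_Vh xs ys c : grid xs -> grid ys -> zero_bd xs ys c -> Vh xs ys (tensor xs ys c).
Proof.
move=> gx gy cz; split.
- exact: continuous_subspaceT (@tensor_continuous xs ys c).
- move=> k l ks ls.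
  (* The coefficients come from expanding the bilinear formula of the cell; [m] is the mixed second
     difference of the corner values. *)
  set X := xs`_k; set Y := ys`_l; set X' := (xs`_k.+1 - xs`_k)^-1; set Y' := (ys`_l.+1 - ys`_l)^-1.
  pose d11 := c k l; pose d12 := c k l.+1; pose d21 := c k.+1 l; pose d22 := c k.+1 l.+1.
  pose m := d22 - d21 - d12 + d11.
  exists (d11 - (d21 - d11) * X' * X - (d12 - d11) * Y' * Y + m * X' * Y' * X * Y),
    ((d21 - d11) * X' - m * X' * Y' * Y), ((d12 - d11) * Y' - m * X' * Y' * X), (m * X' * Y').
  move=> p pkl; rewrite (tensor_cell gx gy cz ks ls pkl) /bary -/X -/Y -/X' -/Y' /m -/d11 -/d12 -/d21 -/d22.
  ring.
- move=> p [[p1 p2] Op]; have [p1'|p1'] := boolP (0 < p.1 < 1).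
    have p2' : ~~ (0 < p.2 < 1) by apply/negP => p2'; apply: Op.
    by rewrite tensorE'; apply: interp_outside => //; apply: interp0 => i; have [] := cz i 0%N.
  by rewrite tensorE; apply: interp_outside => //; apply: interp0 => j; have [] := cz 0%N j.
Qed.

Lemma right_derive_affine (g : R -> R) x (A B r : R) : 0 < r ->
  (forall t, 0 <= t < r -> g (x + t) = A + B * (x + t)) -> right_derive g x B.
Proof.
move=> r0 gE e e0; exists r => // t /andP[t0 tr].
rewrite gE; last by rewrite tr ltW.
have := gE 0; rewrite lexx r0 addr0 => ->//.
have -> : A + B * (x + t) - (A + B * x) - B * t = 0 by ring.
by rewrite normr0 mulr_ge0// ltW.
Qed.

Lemma left_derive_affine (g : R -> R) x (A B r : R) : 0 < r ->
  (forall t, 0 <= t < r -> g (x - t) = A + B * (x - t)) -> left_derive g x B.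
Proof.
move=> r0 gE e e0; exists r => // t /andP[t0 tr].
rewrite gE; last by rewrite tr ltW.
have := gE 0; rewrite lexx r0 subr0 => ->//.
have -> : A + B * (x - t) - (A + B * x) + B * t = 0 by ring.
by rewrite normr0 mulr_ge0// ltW.
Qed.

(** On a horizontal line the function is affine on the cell to the right of the point and on the
    cell to its left; the slopes are the one-sided derivatives. *)
Lemma Vh_sides_x xs ys v p : grid xs -> grid ys -> Vh xs ys v -> Omega p ->
  exists dr dl, right_derive (fun t => v (t, p.2)) p.1 dr /\ left_derive (fun t => v (t, p.2)) p.1 dl.
Proof.
move=> gx gy [_ vcell _] [/andP[x0 x1] /andP[y0 y1]].
have [|l ls pl] := @grid_cell _ ys p.2 gy; first by rewrite !ltW.
have [|k ks /andP[kp pk]] := @grid_cell_right _ xs p.1 gx; first by rewrite ltW.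
have [|k' ks' /andP[kp' pk']] := @grid_cell_left _ xs p.1 gx; first by rewrite x0 ltW.
have [a0 [a1 [a2 [a3 vE]]]] := vcell k l ks ls.
have [b0 [b1 [b2 [b3 vE']]]] := vcell k' l ks' ls.
exists (a1 + a3 * p.2), (b1 + b3 * p.2); split.
  apply: (@right_derive_affine _ _ (a0 + a2 * p.2) _ (xs`_k.+1 - p.1)); first by rewrite subr_gt0.
  move=> t /andP[t0 tr]; rewrite vE/=; first by ring.
  by split => //=; apply/andP; split; lra.
apply: (@left_derive_affine _ _ (b0 + b2 * p.2) _ (p.1 - xs`_k')); first by rewrite subr_gt0.
move=> t /andP[t0 tr]; rewrite vE'/=; first by ring.
by split => //=; apply/andP; split; lra.
Qed.

Lemma Vh_sides_y xs ys v p : grid xs -> grid ys -> Vh xs ys v -> Omega p ->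
  exists dr dl, right_derive (fun t => v (p.1, t)) p.2 dr /\ left_derive (fun t => v (p.1, t)) p.2 dl.
Proof.
move=> gx gy [_ vcell _] [/andP[x0 x1] /andP[y0 y1]].
have [|k ks pk] := @grid_cell _ xs p.1 gx; first by rewrite !ltW.
have [|l ls /andP[lp pl]] := @grid_cell_right _ ys p.2 gy; first by rewrite ltW.
have [|l' ls' /andP[lp' pl']] := @grid_cell_left _ ys p.2 gy; first by rewrite y0 ltW.
have [a0 [a1 [a2 [a3 vE]]]] := vcell k l ks ls.
have [b0 [b1 [b2 [b3 vE']]]] := vcell k l' ks ls'.
exists (a2 + a3 * p.1), (b2 + b3 * p.1); split.
  apply: (@right_derive_affine _ _ (a0 + a1 * p.1) _ (ys`_l.+1 - p.2)); first by rewrite subr_gt0.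
  move=> t /andP[t0 tr]; rewrite vE/=; first by ring.
  by split => //=; apply/andP; split; lra.
apply: (@left_derive_affine _ _ (b0 + b1 * p.1) _ (p.2 - ys`_l')); first by rewrite subr_gt0.
move=> t /andP[t0 tr]; rewrite vE'/=; first by ring.
by split => //=; apply/andP; split; lra.
Qed.

Lemma Omega_closedW p : @Omega R p -> Omega_closed p.
Proof. by move=> [/andP[? ?] /andP[? ?]]; split; rewrite !ltW. Qed.

Lemma Vh_meas xs ys v : Vh xs ys v -> meas v.
Proof. by move=> [cv _ _]; exact: meas_within_continuous. Qed.

Lemma Vh_is_derive_x xs ys v p : grid xs -> grid ys -> Vh xs ys v -> Omega p -> p.1 \notin xs ->
  is_derive p.1 1 (fun t => v (t, p.2)) (tensor_x xs ys (nodal v xs ys) p).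
Proof.
move=> gx gy hv Op pn; have [_ _ v0] := hv.
have := is_derive_tensor_x p.2 gx (zero_bd_nodal gx gy v0) pn.
rewrite -surjective_pairing; have [r r0 Hr] := Omega_ball Op.
apply: (is_derive_near r0) => t tr; apply: Vh_tensor => //; apply: Omega_closedW.
by apply: Hr => /=; rewrite ?subrr ?normr0// addrC addKr.
Qed.

Lemma Vh_is_derive_y xs ys v p : grid xs -> grid ys -> Vh xs ys v -> Omega p -> p.2 \notin ys ->
  is_derive p.2 1 (fun t => v (p.1, t)) (tensor_y xs ys (nodal v xs ys) p).
Proof.
move=> gx gy hv Op pn; have [_ _ v0] := hv.
have := is_derive_tensor_y p.1 gy (zero_bd_nodal gx gy v0) pn.
rewrite -surjective_pairing; have [r r0 Hr] := Omega_ball Op.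
apply: (is_derive_near r0) => t tr; apply: Vh_tensor => //; apply: Omega_closedW.
by apply: Hr => /=; rewrite ?subrr ?normr0// addrC addKr.
Qed.

End FiniteElements.

(** * Testing the weak derivative with finite elements *)

Section Mollification.
Context {R : realType}.
Implicit Types (g dg : R -> R) (s : seq R) (x y K r : R).

(** A class that contains the hats and is stable under products: Lipschitz functions vanishing off
    the open unit interval, with finitely many kinks [s]. The one constant [K] bounds the derivative
    and, the interval having length one, also the function. *)
Definition bump g dg s K := [/\ forall x, ~~ (0 < x < 1) -> g x = 0,
  forall x y, x <= y -> `|g y - g x| <= K * (y - x),
  forall x, x \notin s -> is_derive x 1 g (dg x),
  forall x, `|dg x| <= K &
  measurable_fun (`]0, 1[ : set R) dg].

Lemma bump_ge0 g dg s K : bump g dg s K -> 0 <= K.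
Proof.
move=> [_ gK _ _ _]; have := gK 0 1 ler01; rewrite subr0 mulr1.
exact: le_trans.
Qed.

Lemma bump_bound g dg s K x : bump g dg s K -> `|g x| <= K.
Proof.
move=> bg; have K0 := bump_ge0 bg; move: bg => [g0 gK _ _ _].
have [/andP[x0 x1]|x01] := boolP (0 < x < 1); last by rewrite g0 ?normr0.
have := gK 0 x (ltW x0); rewrite (g0 0) ?ltxx// !subr0 => /le_trans; apply.
by rewrite ler_piMr// ltW.
Qed.

Lemma bump_continuous g dg s K : bump g dg s K -> continuous g.
Proof. by move=> bg; have K0 := bump_ge0 bg; case: bg => _ gK _ _ _; exact: lipschitz_continuous gK. Qed.

Lemma bump_lip g dg s K x y : bump g dg s K -> `|g y - g x| <= K * `|y - x|.
Proof.
move=> [_ gK _ _ _]; have [xy|/ltW yx] := leP x y.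
  by rewrite (ger0_norm (x := y - x)) ?subr_ge0// gK.
by rewrite (distrC (g y)) (distrC y) (ger0_norm (x := x - y)) ?subr_ge0// gK.
Qed.

Lemma bumpM g1 dg1 s1 K1 g2 dg2 s2 K2 : bump g1 dg1 s1 K1 -> bump g2 dg2 s2 K2 ->
  bump (fun x => g1 x * g2 x) (fun x => dg1 x * g2 x + g1 x * dg2 x) (s1 ++ s2) (K1 * K2 *+ 2).
Proof.
move=> b1 b2; have B1 x := bump_bound x b1; have B2 x := bump_bound x b2.
have c1 := bump_continuous b1; have c2 := bump_continuous b2.
have [g10 g1K g1d g1b g1m] := b1; have [g20 g2K g2d g2b g2m] := b2.
split.
- by move=> x x01; rewrite g10// mul0r.
- move=> x y xy.
  have -> : g1 y * g2 y - g1 x * g2 x = g1 y * (g2 y - g2 x) + (g1 y - g1 x) * g2 x by ring.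
  rewrite (le_trans (ler_normD _ _))// !normrM.
  have -> : K1 * K2 *+ 2 * (y - x) = K1 * (K2 * (y - x)) + K1 * (y - x) * K2 by rewrite mulr2n; ring.
  by apply: lerD; apply: ler_pM; rewrite ?normr_ge0// ?B1 ?B2 ?g1K ?g2K.
- move=> x; rewrite mem_cat negb_or => /andP[x1 x2].
  have d1 := g1d _ x1; have d2 := g2d _ x2.
  by apply: (is_derive_eq (is_deriveM d1 d2)); rewrite /GRing.scale/=; ring.
- move=> x; rewrite (le_trans (ler_normD _ _))// mulr2n !normrM.
  by apply: lerD; apply: ler_pM.
- apply: measurable_funD; apply: measurable_funM => //;
    by apply: (measurable_funS (E := setT)) => //; exact: continuous_measurable_fun.
Qed.

Lemma is_derive_affine_comp (G : R -> R) (a b d x : R) : is_derive (a * x + b) 1 G d ->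
  is_derive x 1 (fun x => G (a * x + b)) (a * d).
Proof.
move=> /is_derive_expansion H; apply/is_derive_expansion => e e0.
have a1 : 0 < `|a| + 1 by rewrite ltr_wpDl.
have [r r0 Hr] := H (e / (`|a| + 1)) (divr_gt0 e0 a1).
exists (r / (`|a| + 1)); first exact: divr_gt0.
move=> t; rewrite ltr_pdivlMr// => tr.
have at_le : `|a * t| <= `|t| * (`|a| + 1) by rewrite normrM mulrC ler_wpM2l// lerDl.
have := Hr (a * t) (le_lt_trans at_le tr).
have -> : a * (x + t) + b = a * x + b + a * t by ring.
have -> : a * d * t = d * (a * t) by ring.
move=> /le_trans; apply; rewrite -mulrA ler_pM2l// mulrC ler_pdivrMr//.
Qed.

Section Steklov.
Variables (g dg : R -> R) (s : seq R) (K : R).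
Hypothesis bg : bump g dg s K.

Let Gex : exists G, forall x, is_derive x 1 G (g x).
Proof.
apply: ex_antiderivative_support; first exact: bump_continuous bg.
move=> x x01; have [g0 _ _ _ _] := bg; apply: g0.
by apply: contra x01 => /andP[? ?]; rewrite !ltW.
Qed.

Let G := sval (cid Gex).
Let GP : forall x, is_derive x 1 G (g x) := svalP (cid Gex).
Let rad (n : nat) : R := n.+1%:R^-1.
(* The dilation maps a neighbourhood of each endpoint to points farther than
   [rad n] outside [0, 1], so that the averages vanish there. *)
Let dil n x := (1 + 4 * rad n) * x + - (2 * rad n).

Definition steklov n x := (G (dil n x + rad n) - G (dil n x - rad n)) / (2 * rad n).
Definition dsteklov n x := (1 + 4 * rad n) * (g (dil n x + rad n) - g (dil n x - rad n)) / (2 * rad n).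

Let rad_gt0 n : 0 < rad n. Proof. by rewrite invr_gt0. Qed.
Let rad_le1 n : rad n <= 1. Proof. by rewrite invf_le1 ?ltr0n// ler1n. Qed.

Lemma is_derive_steklov n x : is_derive x 1 (steklov n) (dsteklov n x).
Proof.
have r0 := rad_gt0 n.
have d1 : is_derive x 1 (fun x => G (dil n x + rad n)) ((1 + 4 * rad n) * g (dil n x + rad n)).
  rewrite /dil; under eq_fun do rewrite -addrA.
  by rewrite -addrA; apply: is_derive_affine_comp.
have d2 : is_derive x 1 (fun x => G (dil n x - rad n)) ((1 + 4 * rad n) * g (dil n x - rad n)).
  rewrite /dil; under eq_fun do rewrite -addrA.
  by rewrite -addrA; apply: is_derive_affine_comp.
rewrite /steklov; under eq_fun do rewrite mulrC.
have -> : dsteklov n x = (2 * rad n)^-1 * ((1 + 4 * rad n) * g (dil n x + rad n) -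
   (1 + 4 * rad n) * g (dil n x - rad n)) by rewrite /dsteklov; ring.
by apply: is_deriveZ; exact: is_deriveB.
Qed.

Lemma steklov_continuous n : continuous (steklov n).
Proof. by move=> x; exact: is_derive_continuous (is_derive_steklov n x). Qed.

Lemma dsteklov_continuous n : continuous (dsteklov n).
Proof.
have cg := bump_continuous bg.
have H (a : R) : continuous (fun x => g (dil n x + a)).
  move=> x; apply: (@cvg_comp _ _ _ (fun x => dil n x + a) g); last exact: cg.
  apply: cvgD; last exact: cvg_cst.
  by apply: cvgD; [apply: cvgM; [exact: cvg_cst|exact: cvg_id]|exact: cvg_cst].
move=> x; apply: cvgM; last exact: cvg_cst.
by apply: cvgM; [exact: cvg_cst|apply: cvgB; exact: H].
Qed.

(** By the mean value theorem the average is a value of [g] near [dil n x]; bound, support and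
    convergence all follow from this. *)
Lemma steklov_mean n x : exists2 z, `|z - dil n x| <= rad n & steklov n x = g z.
Proof.
have r0 := rad_gt0 n.
have lt : dil n x - rad n < dil n x + rad n by lra.
have [z zI Gz] := @MVT R G g _ _ lt (fun z _ => GP z)
  (continuous_subspaceT (fun z => is_derive_continuous (GP z))).
exists z.
  by move: zI; rewrite in_itv/= => /andP[? ?]; rewrite ler_norml; apply/andP; split; lra.
rewrite /steklov Gz; field; rewrite gt_eqF//.
Qed.

Lemma steklov_bound n x : `|steklov n x| <= K.
Proof. by have [z _ ->] := steklov_mean n x; exact: bump_bound bg. Qed.

Lemma dsteklov_bound n x : `|dsteklov n x| <= 5 * K.
Proof.
have r0 := rad_gt0 n; have r1 := rad_le1 n; have K0 := bump_ge0 bg.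
have := bump_lip (dil n x - rad n) (dil n x + rad n) bg.
have -> : dil n x + rad n - (dil n x - rad n) = 2 * rad n by ring.
rewrite (gtr0_norm (x := 2 * rad n)) ?mulr_gt0// => gK.
rewrite /dsteklov !normrM (ger0_norm (x := 1 + _)); last by lra.
rewrite normfV (gtr0_norm (x := 2 * rad n)) ?mulr_gt0// ler_pdivrMr ?mulr_gt0//.
rewrite -mulrA; apply: ler_pM => //; lra.
Qed.

Lemma steklov_cvg x : 0 < x < 1 -> (fun n => steklov n x) @ \oo --> g x.
Proof.
move=> /andP[x0 x1]; have K0 := bump_ge0 bg; apply/cvgrPdist_lt => e e0.
have K1 : 0 < 3 * K + 1 by lra.
apply: filterS (near_inv_succ (divr_gt0 e0 K1)) => n nr.
have r0 := rad_gt0 n; have [z zd ->] := steklov_mean n x.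
(* [z] is within [rad n] of [dil n x], which is within [2 * rad n] of [x]. *)
apply: (@le_lt_trans _ _ (K * (3 * rad n))).
  rewrite (le_trans (bump_lip _ _ bg))// ler_wpM2l//.
  move: zd; rewrite /dil !ler_norml => /andP[h1 h2]; apply/andP; split; nra.
move: nr; rewrite ltr_pdivlMr// -/(rad n); nra.
Qed.

Lemma dsteklov_cvg x : 0 < x < 1 -> x \notin s -> (fun n => dsteklov n x) @ \oo --> dg x.
Proof.
move=> /andP[x0 x1] xs; have [_ _ gd _ _] := bg.
have /is_derive_expansion H := gd x xs; apply/cvgrPdist_lt => e e0.
(* Two expansion errors of size [e / 30 * (3 * rad n)], amplified by at most [5 / (2 * rad n)], add
   up to e/2; the other half is left for the error made by the dilation factor. *)
have e'0 : 0 < e / 30 by rewrite divr_gt0.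
have [l l0 Hl] := H (e / 30) e'0.
have d1 : 0 < 8 * `|dg x| + 1 by rewrite ltr_wpDl// mulr_ge0.
near=> n.
have r0 := rad_gt0 n; have r1 := rad_le1 n.
have rl : rad n < l / 4 by near: n; apply: near_inv_succ; rewrite divr_gt0.
have re : rad n < e / (8 * `|dg x| + 1) by near: n; apply: near_inv_succ; rewrite divr_gt0.
set t1 := dil n x + rad n - x; set t2 := dil n x - rad n - x.
have t1r : `|t1| <= 3 * rad n by rewrite /t1 /dil ler_norml; apply/andP; split; nra.
have t2r : `|t2| <= 3 * rad n by rewrite /t2 /dil ler_norml; apply/andP; split; nra.
have h1 : `|g (dil n x + rad n) - g x - dg x * t1| <= e / 30 * (3 * rad n).
  have -> : dil n x + rad n = x + t1 by rewrite /t1; ring.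
  apply: (le_trans (Hl t1 _)); first by lra.
  by rewrite ler_pM2l.
have h2 : `|g (dil n x - rad n) - g x - dg x * t2| <= e / 30 * (3 * rad n).
  have -> : dil n x - rad n = x + t2 by rewrite /t2; ring.
  apply: (le_trans (Hl t2 _)); first by lra.
  by rewrite ler_pM2l.
(* As [t1 - t2 = 2 * rad n], the linear parts of the two expansions reproduce [dg x] up to the
   dilation factor. *)
have E : dg x - dsteklov n x = - (4 * rad n * dg x) - (1 + 4 * rad n) *
   ((g (dil n x + rad n) - g x - dg x * t1) - (g (dil n x - rad n) - g x - dg x * t2)) / (2 * rad n).
  by rewrite /dsteklov /t1 /t2; field; rewrite gt_eqF.
rewrite E.
set A := g _ - g x - _ in h1 *; set B := g _ - g x - _ in h2 *.
rewrite (le_lt_trans (ler_normB _ _))// normrN !normrM.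
rewrite (ger0_norm (x := 1 + 4 * rad n)); last by lra.
rewrite [`|(2 * rad n)^-1|]normfV (gtr0_norm (x := 2 * rad n)) ?mulr_gt0//.
rewrite (ger0_norm (x := 4)) // (gtr0_norm r0).
have AB : `|A - B| <= e / 5 * rad n.
  by rewrite (le_trans (ler_normB _ _))//; lra.
have h3 : 4 * rad n * `|dg x| < e / 2.
  move: re; rewrite ltr_pdivlMr//; lra.
have h4 : (1 + 4 * rad n) * `|A - B| / (2 * rad n) <= e / 2.
  rewrite ler_pdivrMr ?mulr_gt0//.
  apply: (@le_trans _ _ (5 * (e / 5 * rad n))); last by lra.
  by apply: ler_pM => //; lra.
lra.
Unshelve. all: by end_near. Qed.

End Steklov.
End Mollification.

(** * Integration by parts against [b] for products of finite element functions *)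

Section WeakProduct.
Context {R : realType}.
Implicit Types (s xs ys : seq R) (x y : R) (b bx : R * R -> R).

Lemma steklov_support g dg s (K : R) (bg : bump g dg s K) (n : nat) :
  exists a b : R, [/\ 0 < a, b < 1 & forall x, ~~ (a <= x <= b) -> steklov bg n x = 0].
Proof.
have r0 : 0 < (n.+1%:R^-1 : R) by rewrite invr_gt0.
set r := n.+1%:R^-1 : R in r0.
have d0 : 0 < 1 + 4 * r by lra.
(* The points that the dilation maps to [- r] and to [1 + r]; beyond them the averaging interval of
   radius [r] misses the open unit interval. *)
exists (r / (1 + 4 * r)), ((1 + 3 * r) / (1 + 4 * r)); split.
- exact: divr_gt0.
- by rewrite ltr_pdivrMr// mul1r; lra.
- move=> x; rewrite ler_pdivrMr// ler_pdivlMr// => xab.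
  have [z zd ->] := steklov_mean bg n x; have [g0 _ _ _ _] := bg; apply: g0.
  apply: contra xab => /andP[z0 z1]; move: zd; rewrite -/r ler_norml => /andP[h1 h2].
  by apply/andP; split; lra.
Qed.

Lemma test_fun_steklov g dg s (K : R) (bg : bump g dg s K) k dk s' (K' : R)
    (bk : bump k dk s' K') (n : nat) :
  let phi := fun p : R * R => steklov bg n p.1 * steklov bk n p.2 in
  test_fun phi /\ (forall p, pdx phi p = dsteklov g n p.1 * steklov bk n p.2).
Proof.
move=> phi.
have dx (p : R * R) : is_derive p.1 1 (fun t => phi (t, p.2)) (dsteklov g n p.1 * steklov bk n p.2).
  rewrite /phi/=; under eq_fun do rewrite mulrC; rewrite mulrC.
  by apply: is_deriveZ; exact: is_derive_steklov.
have dy (p : R * R) : is_derive p.2 1 (fun t => phi (p.1, t)) (steklov bg n p.1 * dsteklov k n p.2).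
  by rewrite /phi/=; apply: is_deriveZ; exact: is_derive_steklov.
have cfst (f : R -> R) : continuous f -> continuous (fun p : R * R => f p.1).
  by move=> cf p; apply: (@cvg_comp _ _ _ fst f); [exact: cvg_fst|exact: cf].
have csnd (f : R -> R) : continuous f -> continuous (fun p : R * R => f p.2).
  by move=> cf p; apply: (@cvg_comp _ _ _ snd f); [exact: cvg_snd|exact: cf].
have pdxE (p : R * R) : pdx phi p = dsteklov g n p.1 * steklov bk n p.2.
  by rewrite /pdx derive1E; have [_ ->] := dx p.
have pdyE (p : R * R) : pdy phi p = steklov bg n p.1 * dsteklov k n p.2.
  by rewrite /pdy derive1E; have [_ ->] := dy p.
split=> //; split.
- by move=> p; split; [have [] := dx p|have [] := dy p].
- rewrite (funext pdxE) => p; apply: cvgM.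
    by apply: cfst; exact: dsteklov_continuous bg n.
  by apply: csnd; exact: steklov_continuous.
- rewrite (funext pdyE) => p; apply: cvgM.
    by apply: cfst; exact: steklov_continuous.
  by apply: csnd; exact: dsteklov_continuous bk n.
- have [a [b [a0 b1 gab]]] := steklov_support bg n.
  have [a' [b' [a'0 b'1 kab]]] := steklov_support bk n.
  exists (`[a, b] `*` `[a', b']).
  + split; first by apply: compact_setX; exact: segment_compact.
    move=> [x y] [/=]; rewrite !in_itv/= => /andP[h1 h2] /andP[h3 h4].
    by split => /=; apply/andP; split; lra.
  + move=> [x y].
    have [xab|xab] := boolP (a <= x <= b); last by rewrite /phi/= gab// mul0r.
    have [yab|yab] := boolP (a' <= y <= b'); last by rewrite /phi/= kab// mulr0.
    by move=> H; exfalso; apply: H; split; rewrite /= in_itv.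
Qed.

Variables (b bx : R * R -> R).
Hypotheses (bb : bmeas b) (bbx : bmeas bx) (wb : weak_dx b bx).

(** Products of Steklov averages are admissible test functions, and bounded convergence removes the
    averaging on both sides. The derivatives converge off the kinks of [g], that is, off finitely
    many vertical lines. *)
Lemma weak_dx_bump g dg s (K : R) k dk s' (K' : R) : bump g dg s K -> bump k dk s' K' ->
  integralO (fun p => b p * (dg p.1 * k p.2)) = - integralO (fun p => bx p * (g p.1 * k p.2)).
Proof.
move=> bg bk; have [mb [M bM]] := bb; have [mbx [M' bM']] := bbx.
have K0 := bump_ge0 bg; have K'0 := bump_ge0 bk; have [_ _ _ _ mdg] := bg.
pose phi n (p : R * R) := steklov bg n p.1 * steklov bk n p.2.
have mC (f : R -> R) : continuous f -> measurable_fun (`]0, 1[ : set R) f.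
  by move=> cf; apply: (measurable_funS (E := setT)) => //; exact: continuous_measurable_fun.
have L1 : (fun n => integralO (fun p => b p * (dsteklov g n p.1 * steklov bk n p.2))) @ \oo -->
    integralO (fun p => b p * (dg p.1 * k p.2)).
  apply: (@cvg_integralO _ _ _ (M * (5 * K * K'))).
  - move=> n; apply: measM => //; apply: measM.
      by apply: meas_fst; apply: mC; exact: dsteklov_continuous bg n.
    by apply: meas_snd; apply: mC; exact: steklov_continuous.
  - apply: measM => //; apply: measM; first by apply: meas_fst; exact: mdg.
    by apply: meas_snd; apply: mC; exact: bump_continuous bk.
  - apply: filterS bM => p bM Op n; rewrite normrM ler_pM// ?bM// normrM ler_pM//.
      exact: dsteklov_bound bg n _.
    exact: steklov_bound.
  - apply: filterS (ae_off_xlines s) => p ps [p1 p2].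
    apply: cvgM; first exact: cvg_cst.
    by apply: cvgM; [exact: dsteklov_cvg bg _ p1 ps|exact: steklov_cvg].
have L2 : (fun n => integralO (fun p => bx p * (steklov bg n p.1 * steklov bk n p.2))) @ \oo -->
    integralO (fun p => bx p * (g p.1 * k p.2)).
  apply: (@cvg_integralO _ _ _ (M' * (K * K'))).
  - move=> n; apply: measM => //; apply: measM.
      by apply: meas_fst; apply: mC; exact: steklov_continuous.
    by apply: meas_snd; apply: mC; exact: steklov_continuous.
  - apply: measM => //; apply: measM.
      by apply: meas_fst; apply: mC; exact: bump_continuous bg.
    by apply: meas_snd; apply: mC; exact: bump_continuous bk.
  - apply: filterS bM' => p bM' Op n; rewrite normrM ler_pM// ?bM'// normrM ler_pM//.
      exact: steklov_bound.
    exact: steklov_bound.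
  - apply: aeW => p [p1 p2].
    apply: cvgM; first exact: cvg_cst.
    by apply: cvgM; exact: steklov_cvg.
have E n : integralO (fun p => b p * (dsteklov g n p.1 * steklov bk n p.2)) =
    - integralO (fun p => bx p * (steklov bg n p.1 * steklov bk n p.2)).
  have [tphi dphi] := test_fun_steklov bg bk n.
  by rewrite -[RHS](wb tphi); apply: eq_integralO => p _; rewrite dphi.
have L3 : (fun n => integralO (fun p => b p * (dsteklov g n p.1 * steklov bk n p.2))) @ \oo -->
    - integralO (fun p => bx p * (g p.1 * k p.2)).
  by under eq_fun do rewrite E; exact: cvgN.
exact: (cvg_unique _ L1 L3).
Qed.

(** A property linear in the pair [F], [Fx], which reduces the integration by parts to products of
    single hats. *)
Definition ibp F Fx := [/\ bounded_meas F, bounded_meas Fx &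
  integralO (fun p => b p * Fx p) = - integralO (fun p => bx p * F p)].

Lemma ibpD F Fx G Gx : ibp F Fx -> ibp G Gx ->
  ibp (fun p => F p + G p) (fun p => Fx p + Gx p).
Proof.
move=> [bF bFx E] [bG bGx E']; split; [exact: bounded_measD..|].
rewrite (@eq_integralO _ _ (fun p => b p * Fx p + b p * Gx p)); last by move=> p _; rewrite mulrDr.
rewrite integralOD; [|exact: bmeasM bb (bounded_measW _)..].
rewrite E E' -opprD -integralOD; [|exact: bmeasM bbx (bounded_measW _)..].
by congr (- _); apply: eq_integralO => p _; rewrite mulrDr.
Qed.

Lemma ibpZ (a : R) F Fx : ibp F Fx -> ibp (fun p => a * F p) (fun p => a * Fx p).
Proof.
move=> [bF bFx E]; split; [exact: bounded_measM (bounded_meas_cst a) _..|].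
rewrite (@eq_integralO _ _ (fun p => a * (b p * Fx p))); last by move=> p _; rewrite mulrCA.
rewrite integralOZ; last exact: bmeasM bb (bounded_measW _).
rewrite E mulrN -integralOZ; last exact: bmeasM bbx (bounded_measW _).
by congr (- _); apply: eq_integralO => p _; rewrite mulrCA.
Qed.

Lemma ibp_cst0 : ibp (fun=> 0) (fun=> 0).
Proof.
split; [exact: bounded_meas_cst..|].
by rewrite !(@eq_integralO _ _ (fun=> 0)) ?integralO_cst ?oppr0// => p _; rewrite mulr0.
Qed.

Lemma ibp_sum (n : nat) (F Fx : 'I_n -> R * R -> R) : (forall i, ibp (F i) (Fx i)) ->
  ibp (fun p => \sum_(i < n) F i p) (fun p => \sum_(i < n) Fx i p).
Proof.
move=> H; rewrite (_ : (fun p => _) = \sum_(i < n) F i); last first.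
  by apply/funext => p; rewrite fct_sumE.
rewrite [X in ibp _ X](_ : _ = \sum_(i < n) Fx i); last first.
  by apply/funext => p; rewrite fct_sumE.
elim/big_ind2: _ => [|f f' g g'|i _]; [exact: ibp_cst0|exact: ibpD|exact: H].
Qed.

Lemma bump_hat s i : grid s -> (0 < i)%N -> (i.+1 < size s)%N ->
  exists K : R, bump (hat s i) (dhat s i) s K.
Proof.
move=> gs i0 si; have [_ _ _ slt] := gs.
have [M HM] := dhat_bound s i.
exists (`|(s`_i - s`_i.-1)^-1| + `|(s`_i.+1 - s`_i)^-1|); split.
- by move=> x; exact: hat_outside.
- move=> x y xy; rewrite /hat.
  rewrite [X in `|X|](_ : _ = (ramp s`_i.-1 s`_i y - ramp s`_i.-1 s`_i x) -
     (ramp s`_i s`_i.+1 y - ramp s`_i s`_i.+1 x)); last by ring.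
  by rewrite (le_trans (ler_normB _ _))// mulrDl lerD// ramp_lipschitz.
- by move=> x; exact: is_derive_hat.
- by move=> x; rewrite (le_trans (ler_normB _ _))// lerD// dramp_bound.
- exact: measurable_dhat.
Qed.

(** Coercivity needs the square of a finite element function in the weak derivative of [b]. In the
    basis, a product of two such functions is a fourfold sum, each term being a product of two hats
    in [x] times a product of two hats in [y], hence of bumps; terms with an index on the boundary
    have coefficient zero. *)
Lemma ibp_tensor xs ys c d : grid xs -> grid ys -> zero_bd xs ys c -> zero_bd xs ys d ->
  ibp (fun p => tensor xs ys c p * tensor xs ys d p)
      (fun p => tensor_x xs ys c p * tensor xs ys d p + tensor xs ys c p * tensor_x xs ys d p).
Proof.
move=> gx gy cz dz.
pose F i j k l (p : R * R) := (c i j * d k l) *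
  ((hat xs i p.1 * hat xs k p.1) * (hat ys j p.2 * hat ys l p.2)).
pose Fx i j k l (p : R * R) := (c i j * d k l) *
  ((dhat xs i p.1 * hat xs k p.1 + hat xs i p.1 * dhat xs k p.1) * (hat ys j p.2 * hat ys l p.2)).
have FE : (fun p => tensor xs ys c p * tensor xs ys d p) =
    (fun p => \sum_(i < size xs) \sum_(j < size ys) \sum_(k < size xs) \sum_(l < size ys) F i j k l p).
  apply/funext => p; rewrite mulr_suml; apply: eq_bigr => i _.
  rewrite mulr_suml; apply: eq_bigr => j _.
  rewrite mulr_sumr; apply: eq_bigr => k _; rewrite mulr_sumr; apply: eq_bigr => l _.
  by rewrite /F; ring.
have FxE : (fun p => tensor_x xs ys c p * tensor xs ys d p + tensor xs ys c p * tensor_x xs ys d p) =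
    (fun p => \sum_(i < size xs) \sum_(j < size ys) \sum_(k < size xs) \sum_(l < size ys) Fx i j k l p).
  apply/funext => p; rewrite !mulr_suml -big_split; apply: eq_bigr => i _ /=.
  rewrite !mulr_suml -big_split; apply: eq_bigr => j _ /=.
  rewrite !mulr_sumr -big_split; apply: eq_bigr => k _ /=.
  rewrite !mulr_sumr -big_split; apply: eq_bigr => l _ /=.
  by rewrite /Fx; ring.
rewrite FE FxE; apply: ibp_sum => i; apply: ibp_sum => j; apply: ibp_sum => k; apply: ibp_sum => l.
have F0 : c i j * d k l = 0 -> ibp (F i j k l) (Fx i j k l).
  move=> E; rewrite /F /Fx E; under eq_fun do rewrite mul0r; under [X in ibp _ X]eq_fun do rewrite mul0r.
  exact: ibp_cst0.
have interior (s : seq R) (q : nat) : (q < size s)%N ->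
    [\/ q = 0%N, q = (size s).-1 | (0 < q)%N /\ (q.+1 < size s)%N].
  move=> sq; have [->|q0] := posnP q; first by constructor 1.
  have [sq'|sq'] := ltnP q.+1 (size s); first by constructor 3.
  constructor 2; have -> : size s = q.+1 by apply/eqP; rewrite eqn_leq sq' sq.
  by [].
have [c1 c2 c3 c4] := cz i j; have [d1 d2 d3 d4] := dz k l.
case: (interior xs i (ltn_ord i)) => [E|E|[i0 i1]]; try by apply: F0; rewrite E ?c1 ?c2 mul0r.
case: (interior ys j (ltn_ord j)) => [E|E|[j0 j1]]; try by apply: F0; rewrite E ?c3 ?c4 mul0r.
case: (interior xs k (ltn_ord k)) => [E|E|[k0 k1]]; try by apply: F0; rewrite E ?d1 ?d2 mulr0.
case: (interior ys l (ltn_ord l)) => [E|E|[l0 l1]]; try by apply: F0; rewrite E ?d3 ?d4 mulr0.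
have [Ki bi] := bump_hat gx i0 i1; have [Kj bj] := bump_hat gy j0 j1.
have [Kk bk] := bump_hat gx k0 k1; have [Kl bl] := bump_hat gy l0 l1.
have b1 := bumpM bi bk; have b2 := bumpM bj bl.
apply: ibpZ; split.
- apply: bounded_measM.
    apply: (@bounded_meas_fst _ (fun x => hat xs i x * hat xs k x) (Ki * Kk *+ 2)); last by move=> x; exact: bump_bound b1.
    by apply: measurable_funM; exact: measurable_hat.
  apply: (@bounded_meas_snd _ (fun x => hat ys j x * hat ys l x) (Kj * Kl *+ 2)); last by move=> x; exact: bump_bound b2.
  by apply: measurable_funM; exact: measurable_hat.
- apply: bounded_measM.
    by apply: (@bounded_meas_fst _ (fun x => dhat xs i x * hat xs k x + hat xs i x * dhat xs k x) (Ki * Kk *+ 2)); case: b1.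
  apply: (@bounded_meas_snd _ (fun x => hat ys j x * hat ys l x) (Kj * Kl *+ 2)); last by move=> x; exact: bump_bound b2.
  by apply: measurable_funM; exact: measurable_hat.
- exact: (weak_dx_bump b1 b2).
Qed.

End WeakProduct.

(** * Coercivity and Galerkin orthogonality *)

Section Form.
Context {R : realType}.
Local Notation mu := (@lebesgue_measure R).
Local Notation mu2 := (@leb2 R).
Local Notation plane := (measurableTypeR R * measurableTypeR R)%type.
Implicit Types (s xs ys : seq R) (x M : R) (f w wx wy v vx vy : R * R -> R) (d : nat -> nat -> R).

Lemma in_Loo_bmeas f : in_Lp +oo%E f -> bmeas f.
Proof.
rewrite /in_Lp => /andP[mf Nf].
have mfO : meas f.
  by apply/(measurable_restrictT _ _).2; [exact: measurable_Omega|exact: (set_mem mf)].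
split=> //; move: Nf; rewrite inE/= /finite_norm unlock.
(* The positive total mass selects the essential supremum in the norm of exponent infinity. *)
have -> : (0 < mu2 setT)%E.
  apply: (@lt_le_trans _ _ (mu2 Omega)); first by rewrite leb2_Omega.
  by apply: le_measure => //; rewrite inE//; exact: measurable_Omega.
have := ess_sup_ge mu2 (abse \o (EFin \o (f \_ Omega : plane -> R))).
case: ess_sup => [M| |] // fM _.
  exists M; apply: filterS fM => p /= fM Op.
  by move: fM; rewrite lee_fin /patch mem_set.
by exists 0; apply: filterS fM.
Qed.

Lemma in_L2_meas f : in_Lp 2%:E f -> meas f.
Proof.
rewrite /in_Lp => /andP[mf _].
by apply/(measurable_restrictT _ _).2; [exact: measurable_Omega|exact: (set_mem mf)].
Qed.

Variables (eps gamma : R) (b bx c : R * R -> R).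
Hypotheses (eps0 : 0 < eps) (bb : bmeas b) (bbx : bmeas bx) (bc : bmeas c) (wb : weak_dx b bx).
Hypothesis (cb : {ae mu2, forall p, Omega p -> gamma <= c p + 2^-1 * bx p}).

(** The integrand of the bilinear form with derivatives as separate arguments, so that it also
    accepts the formal derivatives of finite element functions and their differences with those of
    [u]. *)
Definition density w wx wy v vx vy (p : R * R) :=
  eps * (wx p * vx p + wy p * vy p) + (- b p * wx p + c p * w p) * v p.

Lemma bmeas_density w wx wy v vx vy : bounded_meas w -> bounded_meas wx -> bounded_meas wy ->
  bounded_meas v -> bounded_meas vx -> bounded_meas vy -> bmeas (density w wx wy v vx vy).
Proof.
move=> /bounded_measW bw /bounded_measW bwx /bounded_measW bwy
  /bounded_measW bv /bounded_measW bvx /bounded_measW bvy.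
apply: bmeasD; first by apply: bmeasZ; apply: bmeasD; exact: bmeasM.
apply: bmeasM => //; apply: bmeasD; last exact: bmeasM.
by apply: bmeasM => //; exact: bmeasN.
Qed.

Lemma coercivity xs ys d : grid xs -> grid ys -> zero_bd xs ys d ->
  integralO (fun p => eps * (tensor_x xs ys d p ^+ 2 + tensor_y xs ys d p ^+ 2) +
    gamma * tensor xs ys d p ^+ 2) <=
  integralO (density (tensor xs ys d) (tensor_x xs ys d) (tensor_y xs ys d)
    (tensor xs ys d) (tensor_x xs ys d) (tensor_y xs ys d)).
Proof.
move=> gx gy dz.
set S := tensor xs ys d; set Sx := tensor_x xs ys d; set Sy := tensor_y xs ys d.
have bS : bounded_meas S := bounded_meas_tensor xs ys d.
have bSx : bounded_meas Sx := bounded_meas_tensor_x xs ys d.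
have bSy : bounded_meas Sy := bounded_meas_tensor_y xs ys d.
have [/bounded_measW bF /bounded_measW bFx E] := ibp_tensor bb bbx wb gx gy dz dz.
have b1 : bmeas (fun p => b p * (Sx p * S p + S p * Sx p)) by exact: bmeasM.
have b2 : bmeas (fun p => bx p * (S p * S p)) by exact: bmeasM.
have b3 : bmeas (density S Sx Sy S Sx Sy) by exact: bmeas_density.
(* The added integral is zero by integration by parts with [S * S]. It cancels the convective term
   and leaves half of [bx] times the square of [S]. *)
have -> : integralO (density S Sx Sy S Sx Sy) = integralO (fun p => density S Sx Sy S Sx Sy p +
    2^-1 * (b p * (Sx p * S p + S p * Sx p) + bx p * (S p * S p))).
  rewrite [RHS](integralOD b3); last by apply: bmeasZ; exact: bmeasD.
  rewrite integralOZ; last exact: bmeasD.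
  by rewrite (integralOD b1 b2) E addNr mulr0 addr0.
have sq F : bounded_meas F -> bmeas (fun p => F p ^+ 2).
  by move=> /bounded_measW bF'; exact: (bmeasM bF' bF').
apply: ae_le_integralO.
- apply: bmeasD; last by apply: bmeasZ; exact: sq.
  by apply: bmeasZ; apply: bmeasD; exact: sq.
- by apply: (bmeasD b3); apply: bmeasZ; exact: bmeasD.
apply: filterS cb => p cb' Op; have := cb' Op => {}cb'.
have -> : density S Sx Sy S Sx Sy p + 2^-1 * (b p * (Sx p * S p + S p * Sx p) + bx p * (S p * S p)) =
    eps * (Sx p ^+ 2 + Sy p ^+ 2) + (c p + 2^-1 * bx p) * S p ^+ 2.
  by rewrite /density; field.
by rewrite lerD2l ler_wpM2r// sqr_ge0.
Qed.

(** The factor [a] is controlled only inside (0, 1) and may have no limits at the ends. As it is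
    bounded and [g] vanishes there, the product extended by zero is continuous on the closed
    interval. *)
Lemma integral_mul_derive (a da g dg : R -> R) s M :
  (forall x, 0 < x < 1 -> [/\ is_derive x 1 a (da x), `|a x| <= M & `|da x| <= M]) ->
  continuous g -> g 0 = 0 -> g 1 = 0 ->
  (forall x, 0 < x < 1 -> x \notin s -> is_derive x 1 g (dg x)) ->
  (forall x, `|g x| <= M) -> (forall x, 0 < x < 1 -> `|dg x| <= M) ->
  measurable_fun (`]0, 1[ : set R) (fun x => da x * g x + a x * dg x) ->
  \int[mu]_(x in `]0, 1[) (da x * g x + a x * dg x) = 0.
Proof.
move=> aM cg g0 g1 gd gM dgM mF.
have M0 : 0 <= M by apply: le_trans (gM 0).
pose G x := if 0 < x < 1 then a x * g x else 0.
have GE x : 0 < x < 1 -> G x = a x * g x by rewrite /G => ->.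
have G_le x : `|G x| <= M * `|g x|.
  rewrite /G; case: ifPn => x01; last by rewrite normr0 mulr_ge0.
  by rewrite normrM ler_wpM2r//; have [_] := aM x x01.
have Gend x : g x = 0 -> {for x, continuous G}.
  move=> gx0; apply/cvgrPdist_le => e e0.
  have M1 : 0 < M + 1 by rewrite ltr_wpDl.
  have /cvgrPdist_le/(_ (e / (M + 1)) (divr_gt0 e0 M1)) := cg x.
  apply: filterS => z; rewrite gx0 sub0r normrN ler_pdivlMr// => gz.
  have Gx0 : G x = 0 by apply/eqP; rewrite -normr_le0 (le_trans (G_le x))// gx0 normr0 mulr0.
  rewrite Gx0 sub0r normrN (le_trans (G_le z))// (le_trans _ gz)// mulrC ler_wpM2l// lerDl//.
have near01 x : 0 < x < 1 -> exists2 r : R, 0 < r & forall t, `|t| < r -> 0 < x + t < 1.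
  move=> /andP[x0 x1]; exists (Num.min x (1 - x)); first by rewrite lt_min x0 subr_gt0.
  by move=> t; rewrite lt_min !ltr_norml => /andP[/andP[? ?] /andP[? ?]]; apply/andP; split; lra.
have cG x : 0 <= x <= 1 -> {for x, continuous G}.
  move=> /andP[]; rewrite le_eqVlt => /predU1P[<- _|x0]; first exact: Gend.
  rewrite le_eqVlt => /predU1P[->|x1]; first exact: Gend.
  have x01 : 0 < x < 1 by rewrite x0.
  have [r r0 Hr] := near01 x x01; have [da_x _ _] := aM x x01.
  have cag : {for x, continuous (fun z => a z * g z)}.
    by apply: cvgM; [exact: is_derive_continuous da_x|exact: cg].
  change (G @ x --> G x); rewrite (GE x x01); apply: cvg_trans cag; apply: near_eq_cvg.
  apply/nbhs_ballP; exists r => //= z; rewrite /ball/= distrC => zx.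
  by rewrite GE//; have := Hr _ zx; rewrite addrC subrK.
have G0 : G 0 = 0 by rewrite /G ltxx.
have G1 : G 1 = 0 by rewrite /G ltxx andbF.
transitivity (G 1 - G 0); last by rewrite G0 G1 subrr.
apply: (@integral_derive _ G _ s (M * M + M * M)) => //.
- apply: continuous_in_subspaceT => x; rewrite inE/= in_itv/= => x01; exact: cG.
- move=> x x01 xs; have [da_x a_x da_M] := aM x x01; split; last first.
    by rewrite (le_trans (ler_normD _ _))// !normrM lerD// ler_pM// ?gM ?dgM.
  have [r r0 Hr] := near01 x x01.
  apply: (@is_derive_near _ _ (fun z => a z * g z) _ _ r) => //.
    by move=> t /Hr; exact: GE.
  have gd_x := gd x x01 xs.
  by apply: (is_derive_eq (is_deriveM da_x gd_x)); rewrite /GRing.scale/=; ring.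
Qed.

End Form.

(** * The exact solution: derivative bounds and integration by parts *)

Section Solution.
Context {R : realType}.
Implicit Types (xs ys : seq R) (x y M : R) (f u : R * R -> R) (d : nat -> nat -> R).

Lemma layerE_le2 (delta eps y : R) : 0 < delta -> 0 <= y <= 1 -> 0 <= layerE delta eps y <= 2.
Proof.
move=> d0 /andP[y0 y1]; have H z : 0 <= z -> 0 <= expR (- (z * delta / Num.sqrt eps)) <= 1.
  move=> z0; rewrite expR_ge0/= -expR0 ler_expR oppr_le0.
  by rewrite divr_ge0 ?sqrtr_ge0// mulr_ge0// ltW.
have /andP[h1 h2] := H _ y0; have /andP[h3 h4] : 0 <= expR (- ((1 - y) * delta / Num.sqrt eps)) <= 1.
  by apply: H; rewrite subr_ge0.
by rewrite /layerE; apply/andP; split; lra.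
Qed.

Lemma expR_layer_le1 (beta eps x : R) : 0 < beta -> 0 < eps -> 0 <= x ->
  0 <= expR (- (beta * x / eps)) <= 1.
Proof.
move=> b0 e0 x0; rewrite expR_ge0/= -expR0 ler_expR oppr_le0.
by rewrite divr_ge0 ?(ltW e0)// mulr_ge0// ltW.
Qed.

(** The four terms of the assumed bound factor into a part in [x] and a part in [y], which the two
    families of mesh widths treat separately. The sign of [C'] being free, its absolute value
    appears. *)
Lemma partial_bound (C' beta delta eps : R) u : 0 < eps -> 0 < delta ->
  derivative_bounds C' beta delta eps u ->
  forall i j : nat, (i + j <= 2)%N -> forall p, Omega p ->
  `|partial i j u p| <= `|C'| * ((1 + eps^-1 ^+ i * expR (- (beta * p.1 / eps))) *
                               (1 + (Num.sqrt eps)^-1 ^+ j * layerE delta eps p.2)).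
Proof.
move=> e0 d0 db i j ij p Op; have e_neq0 : eps != 0 by rewrite gt_eqF.
have E1 : eps `^ (- i%:R) = eps^-1 ^+ i by rewrite powRN powR_mulrn ?(ltW e0)// exprVn.
have E2 : eps `^ (- (j%:R / 2)) = (Num.sqrt eps)^-1 ^+ j.
  by rewrite powRN mulrC powRrM powR_mulrn ?powR_ge0// powR12_sqrt ?(ltW e0)// exprVn.
have E3 : eps `^ (- (i%:R + j%:R / 2)) = eps^-1 ^+ i * (Num.sqrt eps)^-1 ^+ j.
  by rewrite opprD powRD ?E1 ?E2// e_neq0 implybT.
have := db i j ij p Op; rewrite E1 E2 E3 => /le_trans; apply.
have l0 : 0 <= layerE delta eps p.2.
  have [_ /andP[y0 y1]] := Op.
  by have /andP[] : 0 <= layerE delta eps p.2 <= 2 by apply: layerE_le2; rewrite ?ltW.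
apply: (@le_trans _ _ (`|C'| * (1 + eps^-1 ^+ i * expR (- (beta * p.1 / eps)) +
   (Num.sqrt eps)^-1 ^+ j * layerE delta eps p.2 +
   eps^-1 ^+ i * (Num.sqrt eps)^-1 ^+ j * expR (- (beta * p.1 / eps)) * layerE delta eps p.2))).
  apply: ler_wpM2r; last exact: ler_norm.
  have h1 : 0 <= eps^-1 ^+ i by rewrite exprn_ge0// invr_ge0 ltW.
  have h2 : 0 <= (Num.sqrt eps)^-1 ^+ j by rewrite exprn_ge0// invr_ge0 sqrtr_ge0.
  by rewrite !addr_ge0// ?mulr_ge0// expR_ge0.
by rewrite le_eqVlt; apply/orP; left; apply/eqP; ring.
Qed.

(** The bound [M] may depend on [eps]: it only serves integrability and never enters a constant of
    the final estimate. *)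
Definition regular u := [/\ has_partials2 u, {within Omega_closed, continuous u},
  forall p, Omega_boundary p -> u p = 0 &
  exists M, forall i j : nat, (i + j <= 2)%N -> forall p, Omega p -> `|partial i j u p| <= M].

Lemma derivative_bounds_regular (C' beta delta eps : R) (b c f u : R * R -> R) :
  0 < eps -> 0 < delta -> 0 < beta ->
  solves eps b c f u -> derivative_bounds C' beta delta eps u -> regular u.
Proof.
move=> e0 d0 b0 [pu _ cu u0] db; split=> //.
have sq0 : 0 <= (Num.sqrt eps)^-1 by rewrite invr_ge0 sqrtr_ge0.
have ei0 : 0 <= eps^-1 by rewrite invr_ge0 ltW.
exists (`|C'| * ((1 + (1 + eps^-1 + eps^-1 ^+ 2)) * (1 + (1 + (Num.sqrt eps)^-1 + (Num.sqrt eps)^-1 ^+ 2) * 2))).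
move=> i j ij p Op; apply: (le_trans (partial_bound e0 d0 db ij Op)).
have [/andP[x0 x1] /andP[y0 y1]] := Op.
have /andP[l0 l2] : 0 <= layerE delta eps p.2 <= 2 by apply: layerE_le2; rewrite ?ltW.
have /andP[ex0 ex1] := expR_layer_le1 b0 e0 (ltW x0).
have pow (a : R) (k : nat) : 0 <= a -> (k <= 2)%N -> 0 <= a ^+ k <= 1 + a + a ^+ 2.
  move=> a0; have := sqr_ge0 a; case: k => [|[|[|//]]] _ _; rewrite ?expr0 ?expr1; apply/andP; split; nra.
have /andP[p1 p2] := pow _ i ei0 (leq_trans (leq_addr _ _) ij).
have /andP[p3 p4] := pow _ j sq0 (leq_trans (leq_addl _ _) ij).
apply: ler_wpM2l => //; apply: ler_pM.
- by rewrite addr_ge0// mulr_ge0.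
- by rewrite addr_ge0// mulr_ge0.
- by rewrite lerD2l -[leRHS]mulr1 ler_pM.
- by rewrite lerD2l ler_pM.
Qed.

Section Regular.
Variable u : R * R -> R.
Hypothesis ru : regular u.

Let pu : has_partials2 u. Proof. by have [] := ru. Qed.

Lemma regular_bounded_meas :
  [/\ bounded_meas u, bounded_meas (pdx u), bounded_meas (pdy u),
      bounded_meas (pdx (pdx u)) & bounded_meas (pdy (pdy u))].
Proof.
have [_ cu _ [M uM]] := ru.
have mu0 := meas_within_continuous cu.
have mux : meas (pdx u) by apply: meas_pdx_derivable => // p /pu[].
have muy : meas (pdy u) by apply: meas_pdy_derivable => // p /pu[].
have muxx : meas (pdx (pdx u)) by apply: meas_pdx_derivable => // p /pu[].
have muyy : meas (pdy (pdy u)) by apply: meas_pdy_derivable => // p /pu[].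
split; split=> //; exists M.
- exact: (uM 0%N 0%N isT).
- exact: (uM 1%N 0%N isT).
- exact: (uM 0%N 1%N isT).
- exact: (uM 2%N 0%N isT).
- exact: (uM 0%N 2%N isT).
Qed.

Lemma ibp_solution_x xs ys d : grid xs -> grid ys -> zero_bd xs ys d ->
  integralO (fun p => pdx (pdx u) p * tensor xs ys d p + pdx u p * tensor_x xs ys d p) = 0.
Proof.
move=> gx gy dz.
have [bu bux buy buxx buyy] := regular_bounded_meas; have [_ _ _ [M uM]] := ru.
have bT := bounded_meas_tensor xs ys d; have bTx := bounded_meas_tensor_x xs ys d.
have bF : bounded_meas (fun p => pdx (pdx u) p * tensor xs ys d p + pdx u p * tensor_x xs ys d p).
  by apply: bounded_measD; exact: bounded_measM.
have [_ [N TN]] := bT; have [_ [N' TN']] := bTx.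
apply: (integralO_xslice_eq0 bF) => y y01.
have Oy x : 0 < x < 1 -> Omega (x, y) by [].
have dz0 i : interp xs (fun k => interp ys (d k) y) i = tensor xs ys d (i, y) by rewrite tensorE.
have d0 : interp ys (d 0%N) y = 0 by apply: interp0 => j; have [] := dz 0%N j.
have dn : interp ys (d (size xs).-1) y = 0 by apply: interp0 => j; have [] := dz 0%N j.
have out x : ~~ (0 < x < 1) -> tensor xs ys d (x, y) = 0.
  by move=> x01; rewrite -dz0; exact: interp_outside.
have MNN : M <= `|M| + `|N| + `|N'| /\ N <= `|M| + `|N| + `|N'| /\ N' <= `|M| + `|N| + `|N'|.
  have := ler_norm M; have := ler_norm N; have := ler_norm N'.
  by have := normr_ge0 M; have := normr_ge0 N; have := normr_ge0 N'; do ?split; lra.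
have [MN [NN N'N]] := MNN; have Nn0 : 0 <= `|M| + `|N| + `|N'| by rewrite !addr_ge0.
apply: (@integral_mul_derive _ (fun x => pdx u (x, y)) (fun x => pdx (pdx u) (x, y))
   (fun x => tensor xs ys d (x, y)) (fun x => tensor_x xs ys d (x, y)) xs (`|M| + `|N| + `|N'|)).
- move=> x x01; split.
  + have [_ _ dxx _ _] := pu (Oy x x01).
    by rewrite {2}/pdx derive1E; exact/derivableP.
  + by apply: le_trans MN; exact: (uM 1%N 0%N isT _ (Oy x x01)).
  + by apply: le_trans MN; exact: (uM 2%N 0%N isT _ (Oy x x01)).
- by under eq_fun do rewrite -dz0; exact: interp_continuous.
- by apply: out; rewrite ltxx.
- by apply: out; rewrite ltxx andbF.
- by move=> x x01 xn; exact: is_derive_tensor_x.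
- move=> x; have [x01|x01] := boolP (0 < x < 1); last by rewrite out ?normr0.
  by apply: le_trans NN; exact: TN.
- by move=> x x01; apply: le_trans N'N; exact: TN'.
- by have [mF _] := bF; exact: (measurable_xslice mF y01).
Qed.

Lemma ibp_solution_y xs ys d : grid xs -> grid ys -> zero_bd xs ys d ->
  integralO (fun p => pdy (pdy u) p * tensor xs ys d p + pdy u p * tensor_y xs ys d p) = 0.
Proof.
move=> gx gy dz.
have [bu bux buy buxx buyy] := regular_bounded_meas; have [_ _ _ [M uM]] := ru.
have bT := bounded_meas_tensor xs ys d; have bTy := bounded_meas_tensor_y xs ys d.
have bF : bounded_meas (fun p => pdy (pdy u) p * tensor xs ys d p + pdy u p * tensor_y xs ys d p).
  by apply: bounded_measD; exact: bounded_measM.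
have [_ [N TN]] := bT; have [_ [N' TN']] := bTy.
apply: (integralO_yslice_eq0 bF) => x x01.
have Ox y : 0 < y < 1 -> Omega (x, y) by [].
have dz0 i : interp ys (fun k => interp xs (d^~ k) x) i = tensor xs ys d (x, i) by rewrite tensorE'.
have d0 : interp xs (d^~ 0%N) x = 0 by apply: interp0 => j; have [] := dz j 0%N.
have dn : interp xs (d^~ (size ys).-1) x = 0 by apply: interp0 => j; have [] := dz j 0%N.
have out y : ~~ (0 < y < 1) -> tensor xs ys d (x, y) = 0.
  by move=> y01; rewrite -dz0; exact: interp_outside.
have MNN : M <= `|M| + `|N| + `|N'| /\ N <= `|M| + `|N| + `|N'| /\ N' <= `|M| + `|N| + `|N'|.
  have := ler_norm M; have := ler_norm N; have := ler_norm N'.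
  by have := normr_ge0 M; have := normr_ge0 N; have := normr_ge0 N'; do ?split; lra.
have [MN [NN N'N]] := MNN; have Nn0 : 0 <= `|M| + `|N| + `|N'| by rewrite !addr_ge0.
apply: (@integral_mul_derive _ (fun y => pdy u (x, y)) (fun y => pdy (pdy u) (x, y))
   (fun y => tensor xs ys d (x, y)) (fun y => tensor_y xs ys d (x, y)) ys (`|M| + `|N| + `|N'|)).
- move=> y y01; split.
  + have [_ _ _ _ dyy] := pu (Ox y y01).
    by rewrite {2}/pdy derive1E; exact/derivableP.
  + by apply: le_trans MN; exact: (uM 0%N 1%N isT _ (Ox y y01)).
  + by apply: le_trans MN; exact: (uM 0%N 2%N isT _ (Ox y y01)).
- by under eq_fun do rewrite -dz0; exact: interp_continuous.
- by apply: out; rewrite ltxx.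
- by apply: out; rewrite ltxx andbF.
- by move=> y y01 yn; exact: is_derive_tensor_y.
- move=> y; have [y01|y01] := boolP (0 < y < 1); last by rewrite out ?normr0.
  by apply: le_trans NN; exact: TN.
- by move=> y y01; apply: le_trans N'N; exact: TN'.
- by have [mF _] := bF; exact: (measurable_yslice mF x01).
Qed.

End Regular.

End Solution.

(** * Galerkin orthogonality and the equation for the discrete error *)

Section Orthogonality.
Context {R : realType}.
Local Notation mu2 := (@leb2 R).
Implicit Types (xs ys : seq R) (x y : R) (f u uh : R * R -> R) (d : nat -> nat -> R).

Lemma Vh_pdx xs ys v : grid xs -> grid ys -> Vh xs ys v ->
  {ae mu2, forall p, Omega p -> pdx v p = tensor_x xs ys (nodal v xs ys) p}.
Proof.
move=> gx gy hv; apply: filterS (ae_off_xlines xs) => p pn Op.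
by rewrite /pdx derive1E; have [_ ->] := Vh_is_derive_x gx gy hv Op pn.
Qed.

Lemma Vh_pdy xs ys v : grid xs -> grid ys -> Vh xs ys v ->
  {ae mu2, forall p, Omega p -> pdy v p = tensor_y xs ys (nodal v xs ys) p}.
Proof.
move=> gx gy hv; apply: filterS (ae_off_ylines ys) => p pn Op.
by rewrite /pdy derive1E; have [_ ->] := Vh_is_derive_y gx gy hv Op pn.
Qed.

Lemma tensor_pdx xs ys d : grid xs -> zero_bd xs ys d ->
  {ae mu2, forall p, Omega p -> pdx (tensor xs ys d) p = tensor_x xs ys d p}.
Proof.
move=> gx dz; apply: filterS (ae_off_xlines xs) => -[x y] pn Op.
by rewrite /pdx derive1E; have [_ ->] := is_derive_tensor_x y gx dz pn.
Qed.

Lemma tensor_pdy xs ys d : grid ys -> zero_bd xs ys d ->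
  {ae mu2, forall p, Omega p -> pdy (tensor xs ys d) p = tensor_y xs ys d p}.
Proof.
move=> gy dz; apply: filterS (ae_off_ylines ys) => -[x y] pn Op.
by rewrite /pdy derive1E; have [_ ->] := is_derive_tensor_y x gy dz pn.
Qed.

Lemma Vh_meas_pd xs ys v : grid xs -> grid ys -> Vh xs ys v -> meas (pdx v) /\ meas (pdy v).
Proof.
move=> gx gy hv; split.
  by apply: meas_pdx; [exact: Vh_meas hv|move=> p; exact: (Vh_sides_x gx gy hv)].
by apply: meas_pdy; [exact: Vh_meas hv|move=> p; exact: (Vh_sides_y gx gy hv)].
Qed.

Variables (eps : R) (b c : R * R -> R).
Hypotheses (eps0 : 0 < eps) (bb : bmeas b) (bc : bmeas c).

(** Under the integral the pointwise derivatives may be replaced by the formal ones, which agree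
    with them off the mesh lines. *)
Lemma galerkin_form_density xs ys v d : grid xs -> grid ys -> Vh xs ys v -> zero_bd xs ys d ->
  galerkin_form eps b c v (tensor xs ys d) =
  integralO (density eps b c (tensor xs ys (nodal v xs ys)) (tensor_x xs ys (nodal v xs ys))
    (tensor_y xs ys (nodal v xs ys)) (tensor xs ys d) (tensor_x xs ys d) (tensor_y xs ys d)).
Proof.
move=> gx gy hv dz; set e := nodal v xs ys.
have [mvx mvy] := Vh_meas_pd gx gy hv.
have [mSx mSy] := Vh_meas_pd gx gy (tensor_Vh gx gy dz).
have mv := Vh_meas hv.
have [bS bSx bSy] : [/\ bounded_meas (tensor xs ys d), bounded_meas (tensor_x xs ys d) & bounded_meas (tensor_y xs ys d)].
  by split; [exact: bounded_meas_tensor|exact: bounded_meas_tensor_x|exact: bounded_meas_tensor_y].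
have [bT bTx bTy] : [/\ bounded_meas (tensor xs ys e), bounded_meas (tensor_x xs ys e) & bounded_meas (tensor_y xs ys e)].
  by split; [exact: bounded_meas_tensor|exact: bounded_meas_tensor_x|exact: bounded_meas_tensor_y].
have [mS mSx' mSy'] : [/\ meas (tensor xs ys d), meas (tensor_x xs ys d) & meas (tensor_y xs ys d)].
  by split; [exact: (proj1 bS)|exact: (proj1 bSx)|exact: (proj1 bSy)].
have [mT mTx mTy] : [/\ meas (tensor xs ys e), meas (tensor_x xs ys e) & meas (tensor_y xs ys e)].
  by split; [exact: (proj1 bT)|exact: (proj1 bTx)|exact: (proj1 bTy)].
have [mb _] := bb; have [mc _] := bc.
have bxx : bmeas (fun p => tensor_x xs ys e p * tensor_x xs ys d p).
  by apply: bounded_measW; exact: bounded_measM.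
have byy : bmeas (fun p => tensor_y xs ys e p * tensor_y xs ys d p).
  by apply: bounded_measW; exact: bounded_measM.
have Ex : L2ip (pdx v) (pdx (tensor xs ys d)) = integralO (fun p => tensor_x xs ys e p * tensor_x xs ys d p).
  apply: ae_eq_integralO; [exact: measM|exact: measM|].
  by apply: filterS2 (Vh_pdx gx gy hv) (tensor_pdx gx dz) => p h1 h2 Op; rewrite h1// h2.
have Ey : L2ip (pdy v) (pdy (tensor xs ys d)) = integralO (fun p => tensor_y xs ys e p * tensor_y xs ys d p).
  apply: ae_eq_integralO; [exact: measM|exact: measM|].
  by apply: filterS2 (Vh_pdy gx gy hv) (tensor_pdy gy dz) => p h1 h2 Op; rewrite h1// h2.
have E0 : L2ip (fun p => - b p * pdx v p + c p * v p) (tensor xs ys d) =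
    integralO (fun p => (- b p * tensor_x xs ys e p + c p * tensor xs ys e p) * tensor xs ys d p).
  apply: ae_eq_integralO.
  - apply: measM => //; apply: measD; last exact: measM.
    by apply: measM => //; exact: measN.
  - apply: measM => //; apply: measD; last exact: measM.
    by apply: measM => //; exact: measN.
  - apply: filterS (Vh_pdx gx gy hv) => p h1 Op; rewrite h1//.
    by rewrite [in LHS](Vh_tensor gx gy hv (Omega_closedW Op)).
rewrite /galerkin_form Ex Ey E0 -integralOD// -integralOZ; last exact: bmeasD.
rewrite -integralOD//; first by apply: bmeasZ; exact: bmeasD.
apply: bmeasM; last exact: bounded_measW.
apply: bmeasD; first by apply: bmeasM; [exact: bmeasN|exact: bounded_measW].
by apply: bmeasM => //; exact: bounded_measW.
Qed.

Lemma solution_density xs ys f u d : grid xs -> grid ys -> zero_bd xs ys d ->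
  meas f -> regular u ->
  {ae mu2, forall p, Omega p -> - eps * (partial 2 0 u p + partial 0 2 u p)
     - b p * partial 1 0 u p + c p * u p = f p} ->
  L2ip f (tensor xs ys d) =
  integralO (density eps b c u (pdx u) (pdy u) (tensor xs ys d) (tensor_x xs ys d) (tensor_y xs ys d)).
Proof.
move=> gx gy dz mf ru pde.
have [bu bux buy buxx buyy] := regular_bounded_meas ru.
have [bS bSx bSy] : [/\ bounded_meas (tensor xs ys d), bounded_meas (tensor_x xs ys d) & bounded_meas (tensor_y xs ys d)].
  by split; [exact: bounded_meas_tensor|exact: bounded_meas_tensor_x|exact: bounded_meas_tensor_y].
have E1 := ibp_solution_x ru gx gy dz; have E2 := ibp_solution_y ru gx gy dz.
have b1 : bmeas (fun p => pdx (pdx u) p * tensor xs ys d p + pdx u p * tensor_x xs ys d p).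
  by apply: bounded_measW; apply: bounded_measD; exact: bounded_measM.
have b2 : bmeas (fun p => pdy (pdy u) p * tensor xs ys d p + pdy u p * tensor_y xs ys d p).
  by apply: bounded_measW; apply: bounded_measD; exact: bounded_measM.
have bd : bmeas (density eps b c u (pdx u) (pdy u) (tensor xs ys d) (tensor_x xs ys d) (tensor_y xs ys d)).
  exact: bmeas_density.
(* The two vanishing integrals, multiplied by [eps], exchange the gradient term for the Laplacian,
   after which the equation applies pointwise. *)
rewrite -[RHS]subr0 -[X in _ - X](mulr0 eps) -[X in _ - eps * X](addr0 0).
rewrite -{1}E1 -{1}E2 -integralOD// -integralOZ; last exact: bmeasD.
rewrite -(integralOB bd); last by apply: bmeasZ; exact: bmeasD.
have [mS _] := bS.
apply: ae_eq_integralO; first exact: measM.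
  by apply: measB; [exact: (proj1 bd)|exact: (proj1 (bmeasZ eps (bmeasD b1 b2)))].
by apply: filterS pde => p pde Op; rewrite -pde// /density /partial/=; ring.
Qed.

Lemma galerkin_orthogonality xs ys f u uh d : grid xs -> grid ys -> zero_bd xs ys d ->
  meas f -> regular u ->
  {ae mu2, forall p, Omega p -> - eps * (partial 2 0 u p + partial 0 2 u p)
     - b p * partial 1 0 u p + c p * u p = f p} ->
  galerkin_solution eps b c f xs ys uh ->
  integralO (density eps b c (fun p => u p - tensor xs ys (nodal uh xs ys) p)
    (fun p => pdx u p - tensor_x xs ys (nodal uh xs ys) p)
    (fun p => pdy u p - tensor_y xs ys (nodal uh xs ys) p)
    (tensor xs ys d) (tensor_x xs ys d) (tensor_y xs ys d)) = 0.
Proof.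
move=> gx gy dz mf ru pde [huh gal].
have := gal _ (tensor_Vh gx gy dz).
rewrite (galerkin_form_density gx gy huh dz) (solution_density gx gy dz mf ru pde) => E.
have [bu bux buy _ _] := regular_bounded_meas ru.
have [bS bSx bSy] : [/\ bounded_meas (tensor xs ys d), bounded_meas (tensor_x xs ys d) & bounded_meas (tensor_y xs ys d)].
  by split; [exact: bounded_meas_tensor|exact: bounded_meas_tensor_x|exact: bounded_meas_tensor_y].
transitivity (integralO (density eps b c u (pdx u) (pdy u) (tensor xs ys d) (tensor_x xs ys d) (tensor_y xs ys d)) -
  integralO (density eps b c (tensor xs ys (nodal uh xs ys)) (tensor_x xs ys (nodal uh xs ys))
    (tensor_y xs ys (nodal uh xs ys)) (tensor xs ys d) (tensor_x xs ys d) (tensor_y xs ys d))); last first.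
  by rewrite E subrr.
rewrite -integralOB; [|exact: bmeas_density| ].
  by apply: eq_integralO => p _; rewrite /density; ring.
by apply: bmeas_density => //; [exact: bounded_meas_tensor|exact: bounded_meas_tensor_x|exact: bounded_meas_tensor_y].
Qed.

Definition diff_nodal u uh xs ys : nat -> nat -> R := fun i j => nodal u xs ys i j - nodal uh xs ys i j.

Lemma zero_bd_diff xs ys d e : zero_bd xs ys d -> zero_bd xs ys e -> zero_bd xs ys (fun i j => d i j - e i j).
Proof.
move=> dz ez i j; have [d1 d2 d3 d4] := dz i j; have [e1 e2 e3 e4] := ez i j.
by rewrite d1 d2 d3 d4 e1 e2 e3 e4 !subrr.
Qed.

Lemma tensorB xs ys d e p : tensor xs ys (fun i j => d i j - e i j) p = tensor xs ys d p - tensor xs ys e p.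
Proof. by rewrite /tensor -sumrB; apply: eq_bigr => i _; rewrite -sumrB; apply: eq_bigr => j _; rewrite mulrBl. Qed.

Lemma tensor_xB xs ys d e p : tensor_x xs ys (fun i j => d i j - e i j) p = tensor_x xs ys d p - tensor_x xs ys e p.
Proof. by rewrite /tensor_x -sumrB; apply: eq_bigr => i _; rewrite -sumrB; apply: eq_bigr => j _; rewrite mulrBl. Qed.

Lemma tensor_yB xs ys d e p : tensor_y xs ys (fun i j => d i j - e i j) p = tensor_y xs ys d p - tensor_y xs ys e p.
Proof. by rewrite /tensor_y -sumrB; apply: eq_bigr => i _; rewrite -sumrB; apply: eq_bigr => j _; rewrite mulrBl. Qed.

Lemma discrete_error xs ys f u uh (bx : R * R -> R) (gamma : R) :
  grid xs -> grid ys -> bmeas bx -> weak_dx b bx ->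
  {ae mu2, forall p, Omega p -> gamma <= c p + 2^-1 * bx p} ->
  meas f -> regular u ->
  {ae mu2, forall p, Omega p -> - eps * (partial 2 0 u p + partial 0 2 u p)
     - b p * partial 1 0 u p + c p * u p = f p} ->
  galerkin_solution eps b c f xs ys uh ->
  let n := nodal u xs ys in let d := diff_nodal u uh xs ys in
  (integralO (fun p => eps * (tensor_x xs ys d p ^+ 2 + tensor_y xs ys d p ^+ 2) + gamma * tensor xs ys d p ^+ 2) <=
  integralO (density eps b c (fun p => tensor xs ys n p - u p)
    (fun p => tensor_x xs ys n p - pdx u p) (fun p => tensor_y xs ys n p - pdy u p)
    (tensor xs ys d) (tensor_x xs ys d) (tensor_y xs ys d))) : Prop.
Proof.
move=> gx gy bbx wb cb mf ru pde gal n d.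
have [[_ _ uh0] _] := gal; have [_ _ u0 _] := ru.
have dz : zero_bd xs ys d by apply: zero_bd_diff; exact: zero_bd_nodal.
apply: (le_trans (coercivity eps bb bbx bc wb cb gx gy dz)).
have orth := galerkin_orthogonality gx gy dz mf ru pde gal.
have [bu bux buy _ _] := regular_bounded_meas ru.
have bT e := bounded_meas_tensor xs ys e; have bTx e := bounded_meas_tensor_x xs ys e.
have bTy e := bounded_meas_tensor_y xs ys e.
(* The function with coefficients [d] is the sum of u^I - u and u - u^h; the form at the second
   summand is zero by orthogonality and may be added. *)
rewrite -[leRHS]addr0 -[X in _ <= _ + X]orth -integralOD; last 2 first.
- by apply: bmeas_density => //; exact: bounded_measB.
- by apply: bmeas_density => //; exact: bounded_measB.
rewrite le_eqVlt; apply/orP; left; apply/eqP; apply: eq_integralO => p _.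
rewrite /density; set S := tensor xs ys d p; set Sx := tensor_x xs ys d p; set Sy := tensor_y xs ys d p.
have -> : - b p * Sx + c p * S = - b p * (tensor_x xs ys n p - tensor_x xs ys (nodal uh xs ys) p) +
   c p * (tensor xs ys n p - tensor xs ys (nodal uh xs ys) p) by rewrite -tensorB -tensor_xB.
have -> : Sx * Sx + Sy * Sy = (tensor_x xs ys n p - tensor_x xs ys (nodal uh xs ys) p) * Sx +
   (tensor_y xs ys n p - tensor_y xs ys (nodal uh xs ys) p) * Sy by rewrite -tensor_yB -tensor_xB.
ring.
Qed.

End Orthogonality.

(** * The energy error in terms of the interpolation error *)

Section LayerWeight.
Context {R : realType}.
Local Notation mu := (@lebesgue_measure R).
Implicit Types (s xs ys : seq R) (x y a M : R) (g dg : R -> R) (d : nat -> nat -> R).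

Lemma is_derive_expN a x : is_derive x 1 (fun x => expR (- (a * x))) (- a * expR (- (a * x))).
Proof.
have H : is_derive (- a * x + 0) 1 (@expR R) (expR (- a * x + 0)) by exact: is_derive_expR.
have -> : (fun x => expR (- (a * x))) = (fun x => expR (- a * x + 0)).
  by apply/funext => z; rewrite addr0 mulNr.
have -> : - (a * x) = - a * x + 0 by rewrite addr0 mulNr.
exact: is_derive_affine_comp.
Qed.

Lemma expN_continuous a : continuous (fun x => expR (- (a * x))).
Proof. by move=> x; exact: is_derive_continuous (is_derive_expN a x). Qed.

Lemma measurable_expN a (D : set R) : measurable_fun D (fun x => expR (- (a * x))).
Proof.
by apply: (measurable_funS (E := setT)) => //; exact: continuous_measurable_fun (@expN_continuous a).
Qed.

Lemma expN_le1 a x : 0 < a -> 0 < x -> 0 <= expR (- (a * x)) <= 1.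
Proof. by move=> a0 x0; rewrite expR_ge0/= -expR0 ler_expR oppr_le0 mulr_ge0// ltW. Qed.

Lemma integral_expN a : 0 < a -> \int[mu]_(x in `]0, 1[) expR (- (a * x)) <= a^-1.
Proof.
move=> a0; pose G x := - a^-1 * expR (- (a * x)).
have dG x : is_derive x 1 G (expR (- (a * x))).
  apply: (is_derive_eq (is_deriveZ _ (is_derive_expN a x))).
  by rewrite /GRing.scale/=; field; rewrite gt_eqF.
rewrite (@integral_derive _ G _ [::] 1) ?ltr01//.
- by rewrite /G mulr0 oppr0 expR0 !mulr1 opprK gerDr mulNr oppr_le0 mulr_ge0 ?expR_ge0// invr_ge0 ltW.
- by apply: continuous_subspaceT => x; exact: is_derive_continuous (dG x).
- move=> x /andP[x0 x1] _; split; first exact: dG.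
  by have /andP[h1 h2] := expN_le1 a0 x0; rewrite ger0_norm.
- exact: measurable_expN.
Qed.

Lemma trace_sqr g dg s M x : continuous g -> g 0 = 0 ->
  (forall z, 0 < z < 1 -> z \notin s -> is_derive z 1 g (dg z)) ->
  (forall z, 0 < z < 1 -> `|dg z| <= M) -> measurable_fun (`]0, 1[ : set R) dg ->
  0 < x < 1 -> g x ^+ 2 <= x * \int[mu]_(z in `]0, 1[) dg z ^+ 2.
Proof.
move=> cg g0 gd dgM mdg /andP[x0 x1].
have sub : (`]0, x[ : set R) `<=` `]0, 1[.
  by move=> z /=; rewrite !in_itv/= => /andP[-> /lt_trans]; apply.
have mx : measurable_fun (`]0, x[ : set R) dg by exact: measurable_funS sub mdg.
have intx (f : R -> R) (N : R) : measurable_fun (`]0, x[ : set R) f ->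
    (forall z, 0 < z < x -> `|f z| <= N) -> mu.-integrable `]0, x[ (EFin \o f).
  move=> mf fN; apply: measurable_bounded_integrable => //; first exact: itv_measure_lty.
  exists N; split; first exact: num_real.
  by move=> N' NN' z; rewrite /= in_itv/= => /fN /le_trans; apply; exact: ltW.
have sqM z : 0 < z < 1 -> `|dg z ^+ 2| <= M ^+ 2.
  by move=> /dgM h; rewrite normrX lerXn2r// ?nnegrE ?(le_trans (normr_ge0 (dg z))).
have zx z : 0 < z < x -> 0 < z < 1 by move=> /andP[-> /lt_trans]; apply.
have int_dg : \int[mu]_(z in `]0, x[) dg z = g x.
  rewrite (@integral_derive _ g _ s M) ?g0 ?subr0//; first exact: continuous_subspaceT.
  by move=> z /zx z01 zs; split; [exact: gd|exact: dgM].
(* [m] is the mean of [dg] over (0, x). The nonnegative integral of [(dg z - m) ^+ 2] then yields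
   the Cauchy-Schwarz inequality for [dg] and 1. *)
pose m := g x / x.
have i1 : mu.-integrable `]0, x[ (EFin \o (fun z => dg z ^+ 2)).
  apply: (intx _ (M ^+ 2)); first exact: measurable_funX.
  by move=> z /zx; exact: sqM.
have i2 : mu.-integrable `]0, x[ (EFin \o (fun z => m * 2 * dg z)).
  apply: (intx _ (`|m * 2| * M)); first exact: measurable_funM.
  by move=> z /zx /dgM h; rewrite normrM ler_wpM2l.
have i0 : mu.-integrable `]0, x[ (EFin \o dg).
  by apply: (intx _ M) => // z /zx; exact: dgM.
have i3 : mu.-integrable `]0, x[ (EFin \o (fun z => m ^+ 2)).
  by apply: (intx _ `|m ^+ 2|).
have lenx : fine (mu `]0, x[) = x.
  by rewrite lebesgue_measure_itv/= lte_fin x0 sube0.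
have : 0 <= \int[mu]_(z in `]0, x[) (dg z - m) ^+ 2.
  by apply: Rintegral_ge0 => z _; exact: sqr_ge0.
have -> : \int[mu]_(z in `]0, x[) (dg z - m) ^+ 2 =
    \int[mu]_(z in `]0, x[) ((dg z ^+ 2 - m * 2 * dg z) + m ^+ 2).
  by apply: eq_Rintegral => z _; ring.
have i4 : mu.-integrable `]0, x[ (EFin \o (fun z => dg z ^+ 2 - m * 2 * dg z)).
  apply: (intx _ (M ^+ 2 + `|m * 2| * M)).
    by apply: measurable_funB; [exact: measurable_funX|exact: measurable_funM].
  move=> z /zx z01; rewrite (le_trans (ler_normB _ _))// lerD ?sqM//.
  by rewrite normrM ler_wpM2l ?dgM.
rewrite RintegralD// RintegralB// RintegralZl// int_dg Rintegral_cst// lenx => H.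
have le01 : \int[mu]_(z in `]0, x[) dg z ^+ 2 <= \int[mu]_(z in `]0, 1[) dg z ^+ 2.
  rewrite /Rintegral fine_le//.
  - exact: integrable_fin_num.
  - apply: integrable_fin_num => //; apply: (@bounded_integrable01 _ _ (M ^+ 2)) => //.
    exact: measurable_funX.
  - apply: ge0_subset_integral => //.
      by apply/measurable_EFinP; exact: measurable_funX.
    by move=> z _; rewrite lee_fin sqr_ge0.
have xE : g x ^+ 2 = x * (m * 2 * g x - m ^+ 2 * x).
  by rewrite /m; field; rewrite gt_eqF.
rewrite xE ler_wpM2l ?(ltW x0)//; apply: le_trans le01; lra.
Qed.

Definition weight (kap eps : R) (p : R * R) := eps^-1 * expR (- (kap / eps * p.1)).

Lemma weight_ge0 kap eps p : 0 < eps -> 0 <= weight kap eps p.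
Proof. by move=> e0; rewrite mulr_ge0 ?expR_ge0// invr_ge0 ltW. Qed.

Lemma bounded_meas_weight kap eps : 0 < kap -> 0 < eps -> bounded_meas (weight kap eps).
Proof.
move=> k0 e0; apply: bounded_measM; first exact: bounded_meas_cst.
split; first by apply: (@meas_fst _ (fun x => expR (- (kap / eps * x)))); exact: measurable_expN.
exists 1 => p [/andP[x0 x1] _].
by have /andP[h1 h2] := @expN_le1 (kap / eps) p.1 (divr_gt0 k0 e0) x0; rewrite ger0_norm.
Qed.

Lemma integralO_weight kap eps : 0 < kap -> 0 < eps -> integralO (weight kap eps) <= kap^-1.
Proof.
move=> k0 e0; have bw := bounded_meas_weight k0 e0.
rewrite -subr_ge0 -[X in X - _](@integralO_cst R) -integralOB; last 2 first.
- exact: bmeas_cst.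
- exact: bounded_measW.
apply: integralO_xslice_ge0; first by apply: bounded_measB => //; exact: bounded_meas_cst.
move=> y y01; rewrite RintegralB//; last 2 first.
- exact: (integrable_xslice (bounded_meas_cst kap^-1) y01).
- exact: (integrable_xslice bw y01).
have len1 : fine (mu `]0, 1[) = 1 by rewrite lebesgue_measure_itv/= lte_fin ltr01 sube0.
rewrite Rintegral_cst// len1 mulr1 subr_ge0 /weight/=.
have i0 : mu.-integrable `]0, 1[ (EFin \o (fun x : R => expR (- (kap / eps * x)))).
  apply: (@bounded_integrable01 _ _ 1); first exact: measurable_expN.
  by move=> x /andP[x0 x1]; have /andP[h1 h2] := expN_le1 (divr_gt0 k0 e0) x0; rewrite ger0_norm.
rewrite RintegralZl//.
apply: (@le_trans _ _ (eps^-1 * (kap / eps)^-1)).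
  by apply: ler_wpM2l; [rewrite invr_ge0 ltW|exact: (integral_expN (divr_gt0 k0 e0))].
by rewrite le_eqVlt; apply/orP; left; apply/eqP; field; rewrite !gt_eqF.
Qed.

(** Half of the exponent pays for the factor [a], which is at most its exponential. *)
Lemma mul_expN_le (a : R) : 0 <= a -> a * expR (- (2 * a)) <= expR (- a).
Proof.
move=> a0; have -> : - (2 * a) = - a + - a by ring.
rewrite expRD mulrA ler_piMl ?expR_ge0// expRN ler_pdivrMr ?expR_gt0// mul1r.
by rewrite (le_trans _ (expR_ge1Dx a))// lerDr.
Qed.

Lemma integralO_weight_tensor kap eps xs ys d : 0 < kap -> 0 < eps ->
  grid xs -> grid ys -> zero_bd xs ys d ->
  integralO (fun p => weight kap eps p * tensor xs ys d p ^+ 2) <=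
  4 / kap ^+ 2 * (eps * integralO (fun p => tensor_x xs ys d p ^+ 2)).
Proof.
move=> k0 e0 gx gy dz; have bw := bounded_meas_weight k0 e0.
have bT := bounded_meas_tensor xs ys d; have bTx := bounded_meas_tensor_x xs ys d.
have bF : bounded_meas (fun p => weight kap eps p * tensor xs ys d p ^+ 2).
  by apply: bounded_measM => //; exact: bounded_measM.
have bX : bounded_meas (fun p => tensor_x xs ys d p ^+ 2) by exact: bounded_measM.
have bG : bounded_meas (fun p => 4 / kap ^+ 2 * eps * tensor_x xs ys d p ^+ 2).
  by apply: bounded_measM => //; exact: bounded_meas_cst.
rewrite mulrA -integralOZ; last exact: bounded_measW.
rewrite -subr_ge0 -integralOB; [|exact: bounded_measW..].
apply: integralO_xslice_ge0; first exact: bounded_measB.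
move=> y y01.
rewrite RintegralB//; last 2 first.
- exact: (integrable_xslice bG y01).
- exact: (integrable_xslice bF y01).
rewrite RintegralZl//; last exact: (integrable_xslice bX y01).
rewrite subr_ge0; set N := \int[mu]_(x in `]0, 1[) tensor_x xs ys d (x, y) ^+ 2.
have N0 : 0 <= N by apply: Rintegral_ge0 => x _; exact: sqr_ge0.
have [_ [M TxM]] := bTx.
have dz0 i : interp xs (fun k => interp ys (d k) y) i = tensor xs ys d (i, y) by rewrite tensorE.
have tr x : 0 < x < 1 -> tensor xs ys d (x, y) ^+ 2 <= x * N.
  move=> x01; apply: (@trace_sqr (fun x => tensor xs ys d (x, y)) (fun x => tensor_x xs ys d (x, y)) xs M) => //.
  - by under eq_fun do rewrite -dz0; exact: interp_continuous.
  - rewrite -dz0; apply: interp_outside => //; last by rewrite ltxx.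
      by apply: interp0 => j; have [] := dz 0%N j.
    by apply: interp0 => j; have [] := dz 0%N j.
  - by move=> z z01 zs; exact: is_derive_tensor_x.
  - by move=> z z01; exact: TxM.
  - exact: (measurable_xslice (proj1 bTx) y01).
(* Half of the rate [kap / eps] absorbs the factor [x] of the trace inequality at the price
   [2 / kap]; the other half integrates to at most [a^-1 = 2 * eps / kap]. The product is
   [4 / kap ^+ 2] times [eps]. *)
pose a := kap / (2 * eps); have a0 : 0 < a by rewrite divr_gt0// mulr_gt0.
have ia : mu.-integrable `]0, 1[ (EFin \o (fun x : R => expR (- (a * x)))).
  apply: (@bounded_integrable01 _ _ 1); first exact: measurable_expN.
  by move=> x /andP[x0 x1]; have /andP[h1 h2] := expN_le1 a0 x0; rewrite ger0_norm.
apply: (@le_trans _ _ (\int[mu]_(x in `]0, 1[) ((2 / kap * N) * expR (- (a * x))))).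
  apply: le_Rintegral => //.
  - exact: (integrable_xslice bF y01).
  - apply: (@bounded_integrable01 _ _ (2 / kap * N)).
      by apply: measurable_funM => //; exact: measurable_expN.
    move=> x /andP[x0 x1]; have /andP[h1 h2] := expN_le1 a0 x0.
    rewrite ger0_norm ?mulr_ge0// ?invr_ge0 ?(ltW k0)//.
    by rewrite -[leRHS]mulr1 ler_wpM2l// mulr_ge0// divr_ge0// ltW.
  - move=> x /=; rewrite in_itv/= => x01; have /andP[x0 x1] := x01.
    apply: (@le_trans _ _ (weight kap eps (x, y) * (x * N))).
      by rewrite ler_wpM2l ?tr//; exact: weight_ge0.
    rewrite /weight/=.
    have -> : - (kap / eps * x) = - (2 * (a * x)) by rewrite /a; field; rewrite gt_eqF.
    have -> : eps^-1 * expR (- (2 * (a * x))) * (x * N) =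
        2 / kap * N * ((a * x) * expR (- (2 * (a * x)))).
      by rewrite /a; field; rewrite !gt_eqF.
    apply: ler_wpM2l; first by rewrite mulr_ge0// divr_ge0// ltW.
    by apply: mul_expN_le; rewrite mulr_ge0// ltW.
rewrite RintegralZl//.
apply: (@le_trans _ _ (2 / kap * N * a^-1)).
  by apply: ler_wpM2l; [rewrite mulr_ge0// divr_ge0// ltW|exact: integral_expN].
by rewrite le_eqVlt; apply/orP; left; apply/eqP; rewrite /a; field; rewrite !gt_eqF.
Qed.

End LayerWeight.

(** * Absorption of the error terms and the energy estimate *)

Section AbstractError.
Context {R : realType}.
Local Notation mu2 := (@leb2 R).
Implicit Types (xs ys : seq R) (f u uh : R * R -> R).

Lemma sqr_normr (x : R) : `|x| ^+ 2 = x ^+ 2.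
Proof. by rewrite real_normK ?num_real. Qed.

Lemma sqrB_le (x y : R) : (x - y) ^+ 2 <= 2 * x ^+ 2 + 2 * y ^+ 2.
Proof. by have := sqr_ge0 (x + y); rewrite sqrrD sqrrB !mulr2n; lra. Qed.

Lemma young (s x y : R) : 0 < s -> x * y <= s * x ^+ 2 + y ^+ 2 / (4 * s).
Proof.
move=> s0; rewrite -subr_ge0.
have -> : s * x ^+ 2 + y ^+ 2 / (4 * s) - x * y = (2 * s * x - y) ^+ 2 / (4 * s).
  by field; rewrite gt_eqF.
by rewrite divr_ge0 ?sqr_ge0// mulr_ge0// ltW.
Qed.

Variables (gamma kap C1 Mb Mc : R).
Hypotheses (g0 : 0 < gamma) (k0 : 0 < kap) (C10 : 0 <= C1) (Mc0 : 0 <= Mc).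

(** [al] is the coercivity constant in the energy norm and [K3] the constant of the weighted
    estimate. The Young parameter [s'] is such that [s' * (1 + K3) = al / 8], so that both the plain
    and the weighted part of the convective term can be absorbed. The 6 in [C2] is 4 from the [x]
    derivative, where [eps * (1 + B) ^+ 2 <= 2 * (1 + B)] costs a factor 2, plus 2 from the [y]
    derivative. *)
Let al := Num.min 1 gamma.
Let K3 := 4 / kap ^+ 2.
Let s' := al / (8 * (1 + K3)).
Let C2 := 6 / al * C1 ^+ 2 + (Mb * C1) ^+ 2 / (4 * s') + 2 / al * (Mc * C1) ^+ 2.

Let al0 : 0 < al. Proof. by rewrite lt_min ltr01. Qed.
Let al1 : al <= 1. Proof. by rewrite /al ge_min lexx. Qed.
Let alg : al <= gamma. Proof. by rewrite /al ge_min lexx orbT. Qed.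
Let K30 : 0 <= K3. Proof. by rewrite divr_ge0// sqr_ge0. Qed.
Let s'0 : 0 < s'. Proof. by rewrite divr_gt0// mulr_gt0// ltr_wpDr. Qed.

Let s'_le : s' <= al / 8 /\ s' * K3 <= al / 8.
Proof.
have e : s' * (1 + K3) = al / 8 by rewrite /s'; field; rewrite gt_eqF// ltr_wpDr.
by rewrite -e; split; [rewrite ler_peMr ?(ltW s'0)// lerDl|rewrite ler_wpM2l ?(ltW s'0)// lerDr].
Qed.

Lemma density_young (eps h b c B w wx wy v vx vy : R) :
  0 < eps <= 1 -> 0 <= h -> 0 <= B -> eps * B <= 1 -> `|b| <= Mb -> `|c| <= Mc ->
  `|w| <= C1 * h -> `|wx| <= C1 * h * (1 + B) -> eps * wy ^+ 2 <= (C1 * h) ^+ 2 ->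
  eps * (wx * vx + wy * vy) + (- b * wx + c * w) * v <=
  al / 8 * (eps * (vx ^+ 2 + vy ^+ 2)) + (al / 8 + s') * v ^+ 2 + s' * (B * v ^+ 2) +
  C2 * h ^+ 2 * (1 + B) /\ eps * wx ^+ 2 <= 2 * (C1 * h) ^+ 2 * (1 + B).
Proof.
move=> /andP[e0 e1] h0 B0 eB bM cM wC wxC wyC.
have Ch0 : 0 <= C1 * h by rewrite mulr_ge0.
have a8 : 0 < al / 8 by rewrite divr_gt0.
have a8E z : z / (4 * (al / 8)) = 2 / al * z by field; rewrite gt_eqF.
have wx2 : eps * wx ^+ 2 <= 2 * (C1 * h) ^+ 2 * (1 + B).
  have h1 : wx ^+ 2 <= (C1 * h) ^+ 2 * (1 + B) ^+ 2.
    rewrite -exprMn -(sqr_normr wx) lerXn2r ?nnegrE// mulr_ge0// addr_ge0//.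
  apply: (@le_trans _ _ ((C1 * h) ^+ 2 * (eps * (1 + B) ^+ 2))).
    have -> : (C1 * h) ^+ 2 * (eps * (1 + B) ^+ 2) = eps * ((C1 * h) ^+ 2 * (1 + B) ^+ 2) by ring.
    by apply: ler_wpM2l => //; exact: ltW.
  have -> : 2 * (C1 * h) ^+ 2 * (1 + B) = (C1 * h) ^+ 2 * (2 * (1 + B)) by ring.
  apply: ler_wpM2l; first exact: sqr_ge0.
  have q : eps * B ^+ 2 <= B by rewrite expr2 mulrA -[leRHS]mul1r ler_wpM2r.
  have q2 : eps * B <= B by rewrite ler_piMl.
  have -> : eps * (1 + B) ^+ 2 = eps + 2 * (eps * B) + eps * B ^+ 2 by ring.
  lra.
have t1 : eps * (wx * vx) <= al / 8 * (eps * vx ^+ 2) + 2 / al * (2 * (C1 * h) ^+ 2 * (1 + B)).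
  apply: (@le_trans _ _ (eps * (al / 8 * vx ^+ 2 + wx ^+ 2 / (4 * (al / 8))))).
    by rewrite ler_pM2l// mulrC; exact: young.
  by rewrite a8E mulrDr (mulrCA eps) (mulrCA eps (2 / al)) lerD2l ler_wpM2l// divr_ge0// ltW.
have t2 : eps * (wy * vy) <= al / 8 * (eps * vy ^+ 2) + 2 / al * (C1 * h) ^+ 2.
  apply: (@le_trans _ _ (eps * (al / 8 * vy ^+ 2 + wy ^+ 2 / (4 * (al / 8))))).
    by rewrite ler_pM2l// mulrC; exact: young.
  by rewrite a8E mulrDr (mulrCA eps) (mulrCA eps (2 / al)) lerD2l ler_wpM2l// divr_ge0// ltW.
have v2 : `|v| ^+ 2 = v ^+ 2 by rewrite sqr_normr.
(* Young's inequality is applied inside the factor [1 + B], so that the weight stays to the first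
   power on [v ^+ 2] and on the constant; both have controlled integrals. *)
have t3 : - b * wx * v <= (1 + B) * (s' * v ^+ 2 + (Mb * (C1 * h)) ^+ 2 / (4 * s')).
  rewrite (le_trans (ler_norm _))// !normrM normrN.
  apply: (@le_trans _ _ ((1 + B) * (`|v| * (Mb * (C1 * h))))).
    have -> : (1 + B) * (`|v| * (Mb * (C1 * h))) = Mb * (C1 * h * (1 + B)) * `|v| by ring.
    by apply: ler_wpM2r => //; exact: ler_pM.
  by rewrite -v2; apply: ler_wpM2l; [rewrite addr_ge0|exact: young].
have t4 : c * w * v <= al / 8 * v ^+ 2 + 2 / al * (Mc * (C1 * h)) ^+ 2.
  rewrite (le_trans (ler_norm _))// !normrM -a8E -v2.
  apply: (@le_trans _ _ (`|v| * (Mc * (C1 * h)))); last exact: young.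
  by rewrite mulrC; apply: ler_wpM2l => //; exact: ler_pM.
(* Slack: in the final bound the terms without weight are also multiplied by [1 + B]. *)
have p1 : 0 <= 2 / al * (C1 * h) ^+ 2 * B by rewrite !mulr_ge0 ?sqr_ge0 ?invr_ge0// ltW.
have p2 : 0 <= 2 / al * (Mc * (C1 * h)) ^+ 2 * B by rewrite !mulr_ge0 ?sqr_ge0 ?invr_ge0// ltW.
split=> //.
have -> : eps * (wx * vx + wy * vy) + (- b * wx + c * w) * v =
  eps * (wx * vx) + eps * (wy * vy) + - b * wx * v + c * w * v by ring.
apply: (@le_trans _ _ ((al / 8 * (eps * vx ^+ 2) + 2 / al * (2 * (C1 * h) ^+ 2 * (1 + B))) +
  (al / 8 * (eps * vy ^+ 2) + 2 / al * (C1 * h) ^+ 2) +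
  (1 + B) * (s' * v ^+ 2 + (Mb * (C1 * h)) ^+ 2 / (4 * s')) +
  (al / 8 * v ^+ 2 + 2 / al * (Mc * (C1 * h)) ^+ 2))); first lra.
rewrite -subr_ge0 /C2.
set q := (4 * s')^-1; set r := al^-1.
have -> : al / 8 * (eps * (vx ^+ 2 + vy ^+ 2)) + (al / 8 + s') * v ^+ 2 + s' * (B * v ^+ 2) +
   (6 * r * C1 ^+ 2 + (Mb * C1) ^+ 2 * q + 2 * r * (Mc * C1) ^+ 2) * h ^+ 2 * (1 + B) -
   (al / 8 * (eps * vx ^+ 2) + 2 * r * (2 * (C1 * h) ^+ 2 * (1 + B)) +
    (al / 8 * (eps * vy ^+ 2) + 2 * r * (C1 * h) ^+ 2) +
    (1 + B) * (s' * v ^+ 2 + (Mb * (C1 * h)) ^+ 2 * q) +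
    (al / 8 * v ^+ 2 + 2 * r * (Mc * (C1 * h)) ^+ 2)) =
   2 * r * (C1 * h) ^+ 2 * B + 2 * r * (Mc * (C1 * h)) ^+ 2 * B by ring.
exact: addr_ge0.
Qed.

(** The first summand is twice the bound for the discrete error; the second is twice the
    interpolation error, whose three squares contribute 2 + 1 + 1. The factor [1 + kap^-1] bounds
    the integral of one plus the weight. *)
Definition error_constant := 4 * C2 * (1 + kap^-1) / al + 8 * C1 ^+ 2 * (1 + kap^-1).

Lemma energy_error (eps h : R) (b bx c : R * R -> R) xs ys f u uh :
  0 < eps <= 1 -> 0 <= h ->
  bmeas b -> bmeas bx -> bmeas c -> weak_dx b bx ->
  {ae mu2, forall p, Omega p -> `|b p| <= Mb} -> {ae mu2, forall p, Omega p -> `|c p| <= Mc} ->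
  {ae mu2, forall p, Omega p -> gamma <= c p + 2^-1 * bx p} ->
  grid xs -> grid ys -> meas f -> regular u ->
  {ae mu2, forall p, Omega p -> - eps * (partial 2 0 u p + partial 0 2 u p)
     - b p * partial 1 0 u p + c p * u p = f p} ->
  galerkin_solution eps b c f xs ys uh ->
  (forall p, Omega p -> p.1 \notin xs -> p.2 \notin ys ->
    [/\ `|tensor xs ys (nodal u xs ys) p - u p| <= C1 * h,
        `|tensor_x xs ys (nodal u xs ys) p - pdx u p| <= C1 * h * (1 + weight kap eps p) &
        eps * (tensor_y xs ys (nodal u xs ys) p - pdy u p) ^+ 2 <= (C1 * h) ^+ 2]) ->
  let e := nodal uh xs ys in
  (integralO (fun p => eps * ((pdx u p - tensor_x xs ys e p) ^+ 2 + (pdy u p - tensor_y xs ys e p) ^+ 2)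
     + (u p - tensor xs ys e p) ^+ 2) <= error_constant * h ^+ 2) : Prop.
Proof.
move=> he h0 bb bbx bc wb bM cM cb gx gy mf ru pde gal Hint e; have /andP[e0 e1] := he.
have := discrete_error bb bc gx gy bbx wb cb mf ru pde gal.
set n := nodal u xs ys; set d := diff_nodal u uh xs ys => /= DE.
have [[_ _ uh0] _] := gal; have [_ _ u0 _] := ru.
have dz : zero_bd xs ys d by apply: zero_bd_diff; exact: zero_bd_nodal.
have [bu bux buy _ _] := regular_bounded_meas ru.
have bT a := bounded_meas_tensor xs ys a; have bTx a := bounded_meas_tensor_x xs ys a.
have bTy a := bounded_meas_tensor_y xs ys a.
have bw := bounded_meas_weight k0 e0.
have sq F : bounded_meas F -> bounded_meas (fun p => F p ^+ 2) by move=> bF; exact: bounded_measM.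
have bZ (a : R) F : bounded_meas F -> bounded_meas (fun p => a * F p).
  by move=> bF; apply: bounded_measM => //; exact: bounded_meas_cst.
pose X := integralO (fun p => tensor_x xs ys d p ^+ 2).
pose Y := integralO (fun p => tensor_y xs ys d p ^+ 2).
pose Z := integralO (fun p => tensor xs ys d p ^+ 2).
pose W := integralO (fun p => weight kap eps p * tensor xs ys d p ^+ 2).
pose I := integralO (weight kap eps).
have X0 : 0 <= X by apply: integralO_ge0; [exact/bounded_measW/sq|apply: aeW => p _; exact: sqr_ge0].
have Y0 : 0 <= Y by apply: integralO_ge0; [exact/bounded_measW/sq|apply: aeW => p _; exact: sqr_ge0].
have Z0 : 0 <= Z by apply: integralO_ge0; [exact/bounded_measW/sq|apply: aeW => p _; exact: sqr_ge0].
have WX : W <= K3 * (eps * X) by exact: integralO_weight_tensor.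
have Ik : I <= kap^-1 by exact: integralO_weight.
have bXY : bounded_meas (fun p => eps * (tensor_x xs ys d p ^+ 2 + tensor_y xs ys d p ^+ 2)).
  by apply: bZ; apply: bounded_measD; exact: sq.
have bWd : bounded_meas (fun p => weight kap eps p * tensor xs ys d p ^+ 2).
  by apply: bounded_measM => //; exact: sq.
have bT2 : bounded_meas (fun p => tensor xs ys d p ^+ 2) by exact: sq.
have bw1 : bounded_meas (fun p => 1 + weight kap eps p).
  by apply: bounded_measD => //; exact: bounded_meas_cst.
have EXY : integralO (fun p => eps * (tensor_x xs ys d p ^+ 2 + tensor_y xs ys d p ^+ 2)) = eps * (X + Y).
  rewrite integralOZ ?integralOD//; try exact/bounded_measW/sq.
  by apply/bounded_measW/bounded_measD; exact: sq.
have E1w : integralO (fun p => 1 + weight kap eps p) = 1 + I.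
  by rewrite integralOD ?integralO_cst//; [exact: bmeas_cst|exact: bounded_measW].
have ae_int : {ae mu2, forall p, Omega p -> p.1 \notin xs /\ p.2 \notin ys}.
  by apply: filterS2 (ae_off_xlines xs) (ae_off_ylines ys) => p p1 p2 _.
have eB p : Omega p -> eps * weight kap eps p <= 1.
  move=> [/andP[p0 p1] _]; rewrite /weight mulrA divff ?gt_eqF// mul1r.
  by have /andP[] := expN_le1 (divr_gt0 k0 e0) p0.
have LE : integralO (fun p => eps * (tensor_x xs ys d p ^+ 2 + tensor_y xs ys d p ^+ 2) + gamma * tensor xs ys d p ^+ 2)
    = eps * (X + Y) + gamma * Z.
  rewrite integralOD; [|exact: bounded_measW|exact/bounded_measW/bZ/sq].
  by rewrite EXY integralOZ//; exact/bounded_measW/sq.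
have bR : bounded_meas (fun p => al / 8 * (eps * (tensor_x xs ys d p ^+ 2 + tensor_y xs ys d p ^+ 2))
     + (al / 8 + s') * tensor xs ys d p ^+ 2 + s' * (weight kap eps p * tensor xs ys d p ^+ 2)
     + C2 * h ^+ 2 * (1 + weight kap eps p)).
  apply: bounded_measD; last exact: bZ.
  apply: bounded_measD; last exact: bZ.
  by apply: bounded_measD; apply: bZ => //; exact: sq.
have RE : integralO (density eps b c (fun p => tensor xs ys n p - u p)
    (fun p => tensor_x xs ys n p - pdx u p) (fun p => tensor_y xs ys n p - pdy u p)
    (tensor xs ys d) (tensor_x xs ys d) (tensor_y xs ys d)) <=
    al / 8 * (eps * (X + Y)) + (al / 8 + s') * Z + s' * W + C2 * h ^+ 2 * (1 + I).
  apply: (@le_trans _ _ (integralO (fun p => al / 8 * (eps * (tensor_x xs ys d p ^+ 2 + tensor_y xs ys d p ^+ 2))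
     + (al / 8 + s') * tensor xs ys d p ^+ 2 + s' * (weight kap eps p * tensor xs ys d p ^+ 2)
     + C2 * h ^+ 2 * (1 + weight kap eps p)))).
    apply: ae_le_integralO.
    - by apply: bmeas_density => //; exact: bounded_measB.
    - exact: bounded_measW.
    - apply: filterS3 bM cM ae_int => p bM cM ae_int Op; have [p1 p2] := ae_int Op.
      have [H1 H2 H3] := Hint p Op p1 p2.
      by have [] := density_young (tensor xs ys d p) (tensor_x xs ys d p) (tensor_y xs ys d p) he h0 (weight_ge0 kap p e0) (eB p Op) (bM Op) (cM Op) H1 H2 H3.
  rewrite integralOD; [|apply: bounded_measW; apply: bounded_measD; last exact: bZ|exact/bounded_measW/bZ]; last first.
    by apply: bounded_measD; apply: bZ => //; exact: sq.
  rewrite integralOD; [|apply: bounded_measW; apply: bounded_measD; apply: bZ => //; exact: sq|exact/bounded_measW/bZ].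
  rewrite integralOD; [|exact/bounded_measW/bZ|exact/bounded_measW/bZ/sq].
  rewrite (integralOZ (al / 8) (bounded_measW bXY)) (integralOZ _ (bounded_measW (bT2))).
  by rewrite (integralOZ _ (bounded_measW bWd)) (integralOZ _ (bounded_measW bw1)) EXY E1w.
(* The right-hand side returns at most [al / 4] times the energy of the discrete error: [al / 8]
   from each plain Young inequality, and [al / 8] more on [eps * X] through [W] and on [Z] through
   [s']. *)
have E0 : eps * (X + Y) + Z <= 2 * (C2 * h ^+ 2 * (1 + kap^-1)) / al.
  have [s1 s2] := s'_le.
  have C20 : 0 <= C2.
    have h1 (a : R) : 0 <= a -> 0 <= a / al by move=> a0; rewrite divr_ge0// ltW.
    have h2 : 0 <= 4 * s' by rewrite mulr_ge0// ltW.
    apply: addr_ge0; last by apply: mulr_ge0; [exact: h1|exact: sqr_ge0].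
    apply: addr_ge0; last by apply: divr_ge0 => //; exact: sqr_ge0.
    by apply: mulr_ge0; [exact: h1|exact: sqr_ge0].
  have H1 := le_trans DE RE; rewrite LE in H1.
  have H2 : s' * W <= al / 8 * (eps * X).
    apply: (@le_trans _ _ (s' * (K3 * (eps * X)))); first by rewrite ler_wpM2l// ltW.
    by rewrite mulrA ler_wpM2r// mulr_ge0// ltW.
  have H3 : C2 * h ^+ 2 * (1 + I) <= C2 * h ^+ 2 * (1 + kap^-1).
    by rewrite ler_wpM2l ?lerD2l// mulr_ge0// sqr_ge0.
  have H4 : s' * Z <= al / 8 * Z by rewrite ler_wpM2r.
  have H5 : al * Z <= gamma * Z by rewrite ler_wpM2r.
  have eXY0 : 0 <= eps * (X + Y) by rewrite mulr_ge0 ?addr_ge0// ltW.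
  have H6 : al * (eps * (X + Y)) <= eps * (X + Y) by rewrite ler_piMl.
  have H7 : 0 <= al * (eps * Y) by rewrite !mulr_ge0// ltW.
  have H8 : 0 <= al * (eps * X) by rewrite !mulr_ge0// ltW.
  have H9 : 0 <= al * Z by rewrite !mulr_ge0// ltW.
  rewrite ler_pdivlMr//.
  set Q := C2 * h ^+ 2 * (1 + kap^-1) in H3 *; set P := C2 * h ^+ 2 * (1 + I) in H1 H3.
  move: H1 H2 H3 H4 H5 H6 H7 H8 H9; rewrite !mulrDr !mulrDl.
  set a1 := eps * X; set a2 := eps * Y; lra.
have bE : bounded_meas (fun p => 2 * (eps * (tensor_x xs ys d p ^+ 2 + tensor_y xs ys d p ^+ 2)) +
     2 * tensor xs ys d p ^+ 2 + 8 * (C1 * h) ^+ 2 * (1 + weight kap eps p)).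
  apply: bounded_measD; last exact: bZ.
  by apply: bounded_measD; apply: bZ => //; exact: sq.
apply: (@le_trans _ _ (integralO (fun p => 2 * (eps * (tensor_x xs ys d p ^+ 2 + tensor_y xs ys d p ^+ 2)) +
     2 * tensor xs ys d p ^+ 2 + 8 * (C1 * h) ^+ 2 * (1 + weight kap eps p)))).
  apply: ae_le_integralO.
  - apply: bounded_measW; apply: bounded_measD; last by apply: sq; exact: bounded_measB.
    by apply: bZ; apply: bounded_measD; apply: sq; exact: bounded_measB.
  - exact: bounded_measW.
  - apply: filterS3 bM cM ae_int => p bM cM ae_int Op; have [p1 p2] := ae_int Op.
    have [H1 H2 H3] := Hint p Op p1 p2.
    have B0 := weight_ge0 kap p e0.
    have [_ H4] := density_young (tensor xs ys d p) (tensor_x xs ys d p) (tensor_y xs ys d p) he h0 B0 (eB p Op) (bM Op) (cM Op) H1 H2 H3.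
    have H5 : (tensor xs ys n p - u p) ^+ 2 <= (C1 * h) ^+ 2.
      by rewrite -(sqr_normr (_ - _)) lerXn2r ?nnegrE// mulr_ge0.
    have -> : u p - tensor xs ys e p = tensor xs ys d p - (tensor xs ys n p - u p) by rewrite tensorB; ring.
    have -> : pdx u p - tensor_x xs ys e p = tensor_x xs ys d p - (tensor_x xs ys n p - pdx u p) by rewrite tensor_xB; ring.
    have -> : pdy u p - tensor_y xs ys e p = tensor_y xs ys d p - (tensor_y xs ys n p - pdy u p) by rewrite tensor_yB; ring.
    have S1 := sqrB_le (tensor xs ys d p) (tensor xs ys n p - u p).
    have S2 := ler_wpM2l (ltW e0) (sqrB_le (tensor_x xs ys d p) (tensor_x xs ys n p - pdx u p)).
    have S3 := ler_wpM2l (ltW e0) (sqrB_le (tensor_y xs ys d p) (tensor_y xs ys n p - pdy u p)).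
    have CB : 0 <= (C1 * h) ^+ 2 * weight kap eps p by rewrite mulr_ge0// sqr_ge0.
    move: H3 H4 H5 S1 S2 S3 CB; move: (weight kap eps p) ((C1 * h) ^+ 2) => B q.
    move: (tensor xs ys d p) (tensor_x xs ys d p) (tensor_y xs ys d p) => T Tx Ty.
    move: (tensor xs ys n p - u p) (tensor_x xs ys n p - pdx u p) (tensor_y xs ys n p - pdy u p).
    by move=> w wx wy H3 H4 H5 S1 S2 S3 CB; lra.
rewrite integralOD; [|apply: bounded_measW; apply: bounded_measD; apply: bZ => //; exact: sq|exact/bounded_measW/bZ].
rewrite integralOD; [|exact/bounded_measW/bZ|exact/bounded_measW/bZ/sq].
rewrite (integralOZ 2 (bounded_measW bXY)) (integralOZ _ (bounded_measW (bT2))).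
rewrite (integralOZ _ (bounded_measW bw1)) EXY E1w.
have -> : error_constant * h ^+ 2 = 2 * (2 * (C2 * h ^+ 2 * (1 + kap^-1)) / al) + 8 * (C1 * h) ^+ 2 * (1 + kap^-1).
  by rewrite /error_constant; ring.
have H : 8 * (C1 * h) ^+ 2 * (1 + I) <= 8 * (C1 * h) ^+ 2 * (1 + kap^-1).
  by rewrite ler_wpM2l ?lerD2l// mulr_ge0// sqr_ge0.
rewrite -mulrDr; apply: lerD => //; exact: ler_wpM2l.
Qed.

End AbstractError.

(** * Interpolation on layer-adapted meshes *)

Section CellInterpolation.
Context {R : realType}.
Implicit Types (x y e t m : R).

Variable u : R * R -> R.
Hypotheses (pu : has_partials2 u) (cu : {within Omega_closed, continuous u}).
Variables (x0 x1 y0 y1 : R).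
Hypotheses (x0_ge0 : 0 <= x0) (x1_le1 : x1 <= 1) (x01 : x0 < x1).
Hypotheses (y0_ge0 : 0 <= y0) (y1_le1 : y1 <= 1) (y01 : y0 < y1).

Local Ltac cell_bounds :=
  move: (x0_ge0) (x1_le1) (x01) (y0_ge0) (y1_le1) (y01) => ? ? ? ? ? ?.

Let open_cell x y : x0 < x < x1 -> y0 < y < y1 -> Omega (x, y).
Proof. by cell_bounds; move=> /andP[? ?] /andP[? ?]; split=> /=; apply/andP; split; lra. Qed.

Let closed_cell x y : x0 <= x <= x1 -> y0 <= y <= y1 -> Omega_closed (x, y).
Proof. by cell_bounds; move=> /andP[? ?] /andP[? ?]; split=> /=; apply/andP; split; lra. Qed.

Let ctr m t x := m + t * (x - m).
Let mx := (x0 + x1) / 2.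
Let my := (y0 + y1) / 2.

Let ctr_in (a b t z : R) : a < b -> 0 < t < 1 -> a <= z <= b -> a < ctr ((a + b) / 2) t z < b.
Proof.
move=> ab /andP[t0 t1] /andP[az zb].
have h1 : 0 < (1 - t) * (b - a) by rewrite mulr_gt0// subr_gt0.
have h2 : 0 <= t * (z - a) by rewrite mulr_ge0 ?subr_ge0// ltW.
have h3 : 0 <= t * (b - z) by rewrite mulr_ge0 ?subr_ge0// ltW.
have E1 : ctr ((a + b) / 2) t z - a = (1 - t) * (b - a) / 2 + t * (z - a) by rewrite /ctr; field.
have E2 : b - ctr ((a + b) / 2) t z = (1 - t) * (b - a) / 2 + t * (b - z) by rewrite /ctr; field.
by rewrite -subr_gt0 E1 -(subr_gt0 _ b) E2; apply/andP; split; lra.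
Qed.

Let ctr_near (a b t z r : R) : a < b -> 0 <= a -> b <= 1 -> 1 - r < t -> t < 1 -> a <= z <= b ->
  `|ctr ((a + b) / 2) t z - z| < r.
Proof.
move=> ab a0 b1 tr t1 /andP[az zb]; have t1' : 0 < 1 - t by rewrite subr_gt0.
have h1 : 0 <= (1 - t) * (z - a) by rewrite mulr_ge0 ?subr_ge0// ltW.
have h2 : 0 <= (1 - t) * (b - z) by rewrite mulr_ge0 ?subr_ge0// ltW.
have h3 : (1 - t) * (b - a) <= 1 - t by rewrite ger_pMr//; lra.
have -> : ctr ((a + b) / 2) t z - z = ((1 - t) * (b - z) - (1 - t) * (z - a)) / 2 by rewrite /ctr; field.
have E : (1 - t) * (b - a) = (1 - t) * (b - z) + (1 - t) * (z - a) by ring.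
by rewrite ltr_norml; apply/andP; split; lra.
Qed.

Let ctr_x t x : 0 < t < 1 -> x0 <= x <= x1 -> x0 < ctr mx t x < x1.
Proof. exact: ctr_in. Qed.

Let ctr_y t y : 0 < t < 1 -> y0 <= y <= y1 -> y0 < ctr my t y < y1.
Proof. exact: ctr_in. Qed.

(* Contracting the cell towards its centre moves the points of its boundary,
   where u is merely continuous, into its interior. *)
Let contract_cvg x y e : x0 <= x <= x1 -> y0 <= y <= y1 -> 0 < e ->
  exists2 t0 : R, t0 < 1 & forall t, t0 < t -> 0 < t < 1 -> `|u (ctr mx t x, ctr my t y) - u (x, y)| < e.
Proof.
move=> xI yI e0; have [r r0 Hr] := (within_Omega_closedP u).1 cu _ (closed_cell xI yI) e e0.
exists (1 - r); first by lra.
move=> t t0 t01; apply: Hr => /=.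
- have /andP[h1 h2] := ctr_x t01 xI; have /andP[h3 h4] := ctr_y t01 yI.
  by apply: closed_cell; rewrite !ltW.
- by have /andP[_ t1] := t01; exact: ctr_near.
- by have /andP[_ t1] := t01; exact: ctr_near.
Qed.

Section Bounds.
Variables (Sx Sy Sxx Sxy Syy : R).
Hypothesis HSx : forall x y, x0 < x < x1 -> y0 < y < y1 -> `|pdx u (x, y)| <= Sx.
Hypothesis HSy : forall x y, x0 < x < x1 -> y0 < y < y1 -> `|pdy u (x, y)| <= Sy.
Hypothesis HSxx : forall x y, x0 < x < x1 -> y0 < y < y1 -> `|pdx (pdx u) (x, y)| <= Sxx.
Hypothesis HSxy : forall x y, x0 < x < x1 -> y0 < y < y1 -> `|pdx (pdy u) (x, y)| <= Sxy.
Hypothesis HSyy : forall x y, x0 < x < x1 -> y0 < y < y1 -> `|pdy (pdy u) (x, y)| <= Syy.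

Let x_lip (F : R * R -> R) K : (forall x y, x0 < x < x1 -> y0 < y < y1 -> derivable_x F (x, y)) ->
  (forall x y, x0 < x < x1 -> y0 < y < y1 -> `|pdx F (x, y)| <= K) ->
  forall x x' y, x0 < x < x1 -> x0 < x' < x1 -> y0 < y < y1 ->
  `|F (x', y) - F (x, y)| <= K * `|x' - x|.
Proof.
cell_bounds.
move=> dF FK x x' y.
wlog xx' : x x' / x <= x'.
  move=> H xI xI' yI; have [/H|/ltW/H] := leP x x'; first exact.
  by rewrite distrC (distrC x'); exact.
move=> /andP[a1 a2] /andP[b1 b2] yI.
have d z : x0 < z < x1 -> is_derive z 1 (fun t => F (t, y)) (pdx F (z, y)).
  by move=> zI; rewrite /pdx derive1E; exact/derivableP/dF.
have zI z : x <= z <= x' -> x0 < z < x1 by move=> /andP[? ?]; apply/andP; split; lra.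
rewrite (ger0_norm (x := x' - x)) ?subr_ge0//.
apply: (@bounded_derive_le _ (fun t => F (t, y)) (fun t => pdx F (t, y)) [::]) => //.
  apply: continuous_in_subspaceT => z; rewrite inE/= in_itv/= => /zI /d; exact: is_derive_continuous.
move=> z /andP[z1 z2] _; have zI' : x0 < z < x1 by apply: zI; rewrite !ltW.
by split; [exact: d|exact: FK].
Qed.

Let y_lip (F : R * R -> R) K : (forall x y, x0 < x < x1 -> y0 < y < y1 -> derivable_y F (x, y)) ->
  (forall x y, x0 < x < x1 -> y0 < y < y1 -> `|pdy F (x, y)| <= K) ->
  forall x y y', x0 < x < x1 -> y0 < y < y1 -> y0 < y' < y1 ->
  `|F (x, y') - F (x, y)| <= K * `|y' - y|.
Proof.
cell_bounds.
move=> dF FK x y y'.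
wlog yy' : y y' / y <= y'.
  move=> H xI yI yI'; have [/H|/ltW/H] := leP y y'; first exact.
  by rewrite distrC (distrC y'); exact.
move=> xI /andP[a1 a2] /andP[b1 b2].
have d z : y0 < z < y1 -> is_derive z 1 (fun t => F (x, t)) (pdy F (x, z)).
  by move=> zI; rewrite /pdy derive1E; exact/derivableP/dF.
have zI z : y <= z <= y' -> y0 < z < y1 by move=> /andP[? ?]; apply/andP; split; lra.
rewrite (ger0_norm (x := y' - y)) ?subr_ge0//.
apply: (@bounded_derive_le _ (fun t => F (x, t)) (fun t => pdy F (x, t)) [::]) => //.
  apply: continuous_in_subspaceT => z; rewrite inE/= in_itv/= => /zI /d; exact: is_derive_continuous.
move=> z /andP[z1 z2] _; have zI' : y0 < z < y1 by apply: zI; rewrite !ltW.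
by split; [exact: d|exact: FK].
Qed.

Let Sxy_ge0 : 0 <= Sxy.
Proof.
cell_bounds.
have hx : x0 < mx < x1 by rewrite /mx; apply/andP; split; lra.
have hy : y0 < my < y1 by rewrite /my; apply/andP; split; lra.
by apply: le_trans (HSxy hx hy).
Qed.

(** The mixed derivative at hand is [pdx (pdy u)], in this order. So the difference of [u] in [x] is
    differentiated in [y], and the result, a difference of values of [pdy u], is bounded by the mean
    value inequality in [x]. *)
Let double_diff_open x x' y y' : x0 < x < x1 -> x0 < x' < x1 -> y0 < y < y1 -> y0 < y' < y1 ->
  `|(u (x', y') - u (x, y')) - (u (x', y) - u (x, y))| <= Sxy * `|x' - x| * `|y' - y|.
Proof.
cell_bounds.
move=> xI xI'.
have d1 z w : x0 < z < x1 -> y0 < w < y1 -> derivable_x (pdy u) (z, w).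
  by move=> zI wI; have [_ _ _ h _] := pu (open_cell zI wI).
have H z : y0 < z < y1 -> `|pdy u (x', z) - pdy u (x, z)| <= Sxy * `|x' - x|.
  by move=> zI; exact: (x_lip d1 HSxy xI xI' zI).
wlog yy' : y y' / y <= y'.
  move=> G yI yI'; have [/G|/ltW/G] := leP y y'; first exact.
  by rewrite distrC (distrC y'); exact.
move=> /andP[a1 a2] /andP[b1 b2].
have d z : y0 < z < y1 -> is_derive z 1 (fun t => u (x', t) - u (x, t)) (pdy u (x', z) - pdy u (x, z)).
  move=> zI; apply: is_deriveB; rewrite /pdy derive1E; apply/derivableP.
    by have [_ h _ _ _] := pu (open_cell xI' zI).
  by have [_ h _ _ _] := pu (open_cell xI zI).
have zI z : y <= z <= y' -> y0 < z < y1 by move=> /andP[? ?]; apply/andP; split; lra.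
rewrite (ger0_norm (x := y' - y)) ?subr_ge0//.
apply: (@bounded_derive_le _ (fun t => u (x', t) - u (x, t)) (fun t => pdy u (x', t) - pdy u (x, t)) [::]) => //.
  apply: continuous_in_subspaceT => z; rewrite inE/= in_itv/= => /zI /d; exact: is_derive_continuous.
move=> z /andP[z1 z2] _; have zI' : y0 < z < y1 by apply: zI; rewrite !ltW.
by split; [exact: d|exact: H].
Qed.

(** The nodes lie on the boundary of the cell, possibly on that of the square, where no derivative
    is controlled; continuity of [u] carries the estimate there. *)
Lemma double_diff x x' y y' : x0 <= x <= x1 -> x0 <= x' <= x1 -> y0 <= y <= y1 -> y0 <= y' <= y1 ->
  `|(u (x', y') - u (x, y')) - (u (x', y) - u (x, y))| <= Sxy * `|x' - x| * `|y' - y|.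
Proof.
move=> xI xI' yI yI'; apply/ler_addgt0Pr => e e0.
have e4 : 0 < e / 4 by rewrite divr_gt0.
have [t1 t11 H1] := contract_cvg xI' yI' e4; have [t2 t21 H2] := contract_cvg xI yI' e4.
have [t3 t31 H3] := contract_cvg xI' yI e4; have [t4 t41 H4] := contract_cvg xI yI e4.
pose tm := Num.max (Num.max (Num.max t1 t2) (Num.max t3 t4)) 0.
have tm1 : tm < 1 by rewrite /tm !gt_max t11 t21 t31 t41 ltr01.
(* One contraction factor close enough to 1 for all four points, each of which costs at most e/4. *)
pose t := (tm + 1) / 2.
have [T1 T2 T3 T4 T0] : [/\ t1 <= tm, t2 <= tm, t3 <= tm, t4 <= tm & 0 <= tm].
  by split; rewrite /tm !le_max lexx ?orbT.
have t01 : 0 < t < 1 by rewrite /t; apply/andP; split; lra.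
have [L1 L2 L3 L4] : [/\ t1 < t, t2 < t, t3 < t & t4 < t] by rewrite /t; split; lra.
have {}H1 := H1 t L1 t01; have {}H2 := H2 t L2 t01; have {}H3 := H3 t L3 t01; have {}H4 := H4 t L4 t01.
clearbody t.
have D := double_diff_open (ctr_x t01 xI) (ctr_x t01 xI') (ctr_y t01 yI) (ctr_y t01 yI').
have /andP[t0 tle] := t01.
have D2 : Sxy * `|ctr mx t x' - ctr mx t x| * `|ctr my t y' - ctr my t y| <= Sxy * `|x' - x| * `|y' - y|.
  have -> : ctr mx t x' - ctr mx t x = t * (x' - x) by rewrite /ctr; ring.
  have -> : ctr my t y' - ctr my t y = t * (y' - y) by rewrite /ctr; ring.
  rewrite !normrM (gtr0_norm t0); apply: ler_pM; rewrite ?mulr_ge0 ?(ltW t0)//.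
    by apply: ler_wpM2l => //; rewrite ler_piMl// ltW.
  by rewrite ler_piMl// ltW.
move: H1 H2 H3 H4 D; rewrite !ltr_norml !ler_norml.
set A1 := u (ctr _ _ x', ctr _ _ y'); set A2 := u (ctr _ _ x, ctr _ _ y').
set A3 := u (ctr _ _ x', ctr _ _ y); set A4 := u (ctr _ _ x, ctr _ _ y).
set N := Sxy * _ * `|y' - y| in D2 *; set N' := Sxy * _ * _ in D2 *.
move=> /andP[? ?] /andP[? ?] /andP[? ?] /andP[? ?] /andP[? ?]; apply/andP; split; lra.
Qed.

Lemma value_diff x y x' y' : x0 < x < x1 -> y0 < y < y1 -> x0 <= x' <= x1 -> y0 <= y' <= y1 ->
  `|u (x', y') - u (x, y)| <= (x1 - x0) * Sx + (y1 - y0) * Sy.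
Proof.
cell_bounds.
move=> xI yI xI' yI'; apply/ler_addgt0Pr => e e0.
have [t1 t11 H1] := contract_cvg xI' yI' e0.
pose t := (Num.max t1 0 + 1) / 2.
have m1 : Num.max t1 0 < 1 by rewrite gt_max t11 ltr01.
have m2 : t1 <= Num.max t1 0 by rewrite le_max lexx.
have m3 : 0 <= Num.max t1 0 by rewrite le_max lexx orbT.
have t01 : 0 < t < 1 by rewrite /t; apply/andP; split; lra.
have {}H1 : `|u (ctr mx t x', ctr my t y') - u (x', y')| < e by apply: H1 => //; rewrite /t; lra.
have cx := ctr_x t01 xI'; have cy := ctr_y t01 yI'.
have d1 z w : x0 < z < x1 -> y0 < w < y1 -> derivable_x u (z, w).
  by move=> zI wI; have [h _ _ _ _] := pu (open_cell zI wI).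
have d2 z w : x0 < z < x1 -> y0 < w < y1 -> derivable_y u (z, w).
  by move=> zI wI; have [_ h _ _ _] := pu (open_cell zI wI).
have D1 := x_lip d1 HSx xI cx cy.
have D2 := y_lip d2 HSy xI yI cy.
have Sx0 : 0 <= Sx by apply: le_trans (HSx xI yI).
have Sy0 : 0 <= Sy by apply: le_trans (HSy xI yI).
have D1' : Sx * `|ctr mx t x' - x| <= (x1 - x0) * Sx.
  rewrite mulrC; apply: ler_wpM2r => //; move: cx xI => /andP[? ?] /andP[? ?].
  by rewrite ler_norml; apply/andP; split; lra.
have D2' : Sy * `|ctr my t y' - y| <= (y1 - y0) * Sy.
  rewrite mulrC; apply: ler_wpM2r => //; move: cy yI => /andP[? ?] /andP[? ?].
  by rewrite ler_norml; apply/andP; split; lra.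
have := le_trans D1 D1'; have := le_trans D2 D2'; move: H1.
set P := (x1 - x0) * Sx; set Q := (y1 - y0) * Sy.
set A := u (ctr _ _ x', ctr _ _ y'); set A' := u (x, ctr _ _ y').
rewrite !ltr_norml !ler_norml.
move=> /andP[? ?] /andP[? ?] /andP[? ?]; apply/andP; split; lra.
Qed.

Lemma x_diff x y : x0 < x < x1 -> y0 < y < y1 ->
  `|u (x1, y) - u (x0, y) - (x1 - x0) * pdx u (x, y)| <= (x1 - x0) * ((x1 - x0) * Sxx).
Proof.
cell_bounds.
move=> xI yI.
have d z : z \in `]x0, x1[ -> is_derive z 1 (fun t => u (t, y)) (pdx u (z, y)).
  rewrite in_itv/= => zI; rewrite /pdx derive1E; apply/derivableP.
  by have [h _ _ _ _] := pu (open_cell zI yI).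
have c : {within `[x0, x1], continuous (fun t => u (t, y))}.
  have y01' : 0 <= y <= 1 by move: yI => /andP[? ?]; apply/andP; split; lra.
  apply: continuous_subspaceW (within_continuous_xslice cu y01') => z /=.
  by rewrite !in_itv/= => /andP[? ?]; apply/andP; split; lra.
have [z zI ->] := MVT x01 d c; rewrite in_itv/= in zI.
have dd v w : x0 < v < x1 -> y0 < w < y1 -> derivable_x (pdx u) (v, w).
  by move=> vI wI; have [_ _ h _ _] := pu (open_cell vI wI).
have H := x_lip dd HSxx xI zI yI.
have Sxx0 : 0 <= Sxx by apply: le_trans (HSxx xI yI).
have -> : pdx u (z, y) * (x1 - x0) - (x1 - x0) * pdx u (x, y) = (x1 - x0) * (pdx u (z, y) - pdx u (x, y)) by ring.
have k0 : 0 < x1 - x0 by rewrite subr_gt0.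
rewrite normrM (gtr0_norm k0) ler_pM2l// (le_trans H)// mulrC ler_wpM2r//.
by move: xI zI => /andP[? ?] /andP[? ?]; rewrite ler_norml; apply/andP; split; lra.
Qed.

Lemma y_diff x y : x0 < x < x1 -> y0 < y < y1 ->
  `|u (x, y1) - u (x, y0) - (y1 - y0) * pdy u (x, y)| <= (y1 - y0) * ((y1 - y0) * Syy).
Proof.
cell_bounds.
move=> xI yI.
have d z : z \in `]y0, y1[ -> is_derive z 1 (fun t => u (x, t)) (pdy u (x, z)).
  rewrite in_itv/= => zI; rewrite /pdy derive1E; apply/derivableP.
  by have [_ h _ _ _] := pu (open_cell xI zI).
have c : {within `[y0, y1], continuous (fun t => u (x, t))}.
  have x01' : 0 <= x <= 1 by move: xI => /andP[? ?]; apply/andP; split; lra.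
  apply: continuous_subspaceW (within_continuous_yslice cu x01') => z /=.
  by rewrite !in_itv/= => /andP[? ?]; apply/andP; split; lra.
have [z zI ->] := MVT y01 d c; rewrite in_itv/= in zI.
have dd v w : x0 < v < x1 -> y0 < w < y1 -> derivable_y (pdy u) (v, w).
  by move=> vI wI; have [_ _ _ _ h] := pu (open_cell vI wI).
have H := y_lip dd HSyy xI yI zI.
have Syy0 : 0 <= Syy by apply: le_trans (HSyy xI yI).
have -> : pdy u (x, z) * (y1 - y0) - (y1 - y0) * pdy u (x, y) = (y1 - y0) * (pdy u (x, z) - pdy u (x, y)) by ring.
have k0 : 0 < y1 - y0 by rewrite subr_gt0.
rewrite normrM (gtr0_norm k0) ler_pM2l// (le_trans H)// mulrC ler_wpM2r//.
by move: yI zI => /andP[? ?] /andP[? ?]; rewrite ler_norml; apply/andP; split; lra.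
Qed.

Lemma convex_le (r a b B : R) : 0 <= r <= 1 -> `|a| <= B -> `|b| <= B -> `|(1 - r) * a + r * b| <= B.
Proof.
move=> /andP[r0 r1] aB bB; have -> : B = (1 - r) * B + r * B by ring.
rewrite (le_trans (ler_normD _ _))// !normrM (ger0_norm r0) ger0_norm ?subr_ge0//.
by rewrite lerD// ler_wpM2l// subr_ge0.
Qed.

Lemma cell_interp_value x y r q : x0 < x < x1 -> y0 < y < y1 -> 0 <= r <= 1 -> 0 <= q <= 1 ->
  `|(u (x0, y0) * (1 - q) + u (x0, y1) * q) * (1 - r) + (u (x1, y0) * (1 - q) + u (x1, y1) * q) * r
    - u (x, y)| <= (x1 - x0) * Sx + (y1 - y0) * Sy.
Proof.
move=> xI yI rI qI.
have -> : (u (x0, y0) * (1 - q) + u (x0, y1) * q) * (1 - r) + (u (x1, y0) * (1 - q) + u (x1, y1) * q) * r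
    - u (x, y) = (1 - r) * ((1 - q) * (u (x0, y0) - u (x, y)) + q * (u (x0, y1) - u (x, y))) +
      r * ((1 - q) * (u (x1, y0) - u (x, y)) + q * (u (x1, y1) - u (x, y))) by ring.
by do ?apply: convex_le => //; apply: value_diff; rewrite // ?lexx ?(ltW x01) ?(ltW y01).
Qed.

(** The [x] derivative of the interpolant is a convex combination of the difference quotients along
    the two horizontal edges. Comparing these with the quotient on the line through [y] costs the
    mixed derivative times the height of the cell, and comparing that quotient with [pdx u] costs
    the second derivative times the width. On anisotropic cells the two lengths must be kept
    apart. *)
Lemma cell_interp_dx x y q : x0 < x < x1 -> y0 < y < y1 -> 0 <= q <= 1 ->
  `|((u (x1, y0) * (1 - q) + u (x1, y1) * q) - (u (x0, y0) * (1 - q) + u (x0, y1) * q)) / (x1 - x0)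
    - pdx u (x, y)| <= (x1 - x0) * Sxx + (y1 - y0) * Sxy.
Proof.
cell_bounds.
move=> xI yI qI; have k0 : 0 < x1 - x0 by rewrite subr_gt0.
have D := x_diff xI yI.
have yc : y0 <= y <= y1 by move: yI => /andP[? ?]; rewrite !ltW.
have E w : y0 <= w <= y1 -> `|(u (x1, w) - u (x0, w)) - (u (x1, y) - u (x0, y))| <= (x1 - x0) * ((y1 - y0) * Sxy).
  move=> wI; have := @double_diff x0 x1 y w; rewrite !lexx (ltW x01)/= => /(_ isT isT yc wI) /le_trans; apply.
  rewrite (gtr0_norm k0).
  have -> : Sxy * (x1 - x0) * `|w - y| = (x1 - x0) * (`|w - y| * Sxy) by ring.
  rewrite ler_pM2l// ler_wpM2r ?Sxy_ge0//.
  by move: wI yI => /andP[? ?] /andP[? ?]; rewrite ler_norml; apply/andP; split; lra.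
have C : `|(1 - q) * ((u (x1, y0) - u (x0, y0)) - (u (x1, y) - u (x0, y))) +
   q * ((u (x1, y1) - u (x0, y1)) - (u (x1, y) - u (x0, y)))| <= (x1 - x0) * ((y1 - y0) * Sxy).
  by apply: convex_le => //; apply: E; rewrite lexx ltW.
have k_neq0 : x1 - x0 != 0 by rewrite gt_eqF.
rewrite -(ler_pM2l k0) -[X in X * `|_|](gtr0_norm k0) -normrM.
have -> : (x1 - x0) * (((u (x1, y0) * (1 - q) + u (x1, y1) * q) - (u (x0, y0) * (1 - q) + u (x0, y1) * q)) / (x1 - x0)
    - pdx u (x, y)) = (u (x1, y) - u (x0, y) - (x1 - x0) * pdx u (x, y)) +
    ((1 - q) * ((u (x1, y0) - u (x0, y0)) - (u (x1, y) - u (x0, y))) +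
   q * ((u (x1, y1) - u (x0, y1)) - (u (x1, y) - u (x0, y)))) by field.
by rewrite (le_trans (ler_normD _ _))// [leRHS]mulrDr lerD.
Qed.

Lemma cell_interp_dy x y r : x0 < x < x1 -> y0 < y < y1 -> 0 <= r <= 1 ->
  `|((u (x0, y1) * (1 - r) + u (x1, y1) * r) - (u (x0, y0) * (1 - r) + u (x1, y0) * r)) / (y1 - y0)
    - pdy u (x, y)| <= (x1 - x0) * Sxy + (y1 - y0) * Syy.
Proof.
cell_bounds.
move=> xI yI rI; have k0 : 0 < y1 - y0 by rewrite subr_gt0.
have D := y_diff xI yI.
have xc : x0 <= x <= x1 by move: xI => /andP[? ?]; rewrite !ltW.
have E w : x0 <= w <= x1 -> `|(u (w, y1) - u (w, y0)) - (u (x, y1) - u (x, y0))| <= (y1 - y0) * ((x1 - x0) * Sxy).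
  move=> wI; have := @double_diff x w y0 y1; rewrite !lexx (ltW y01)/= => /(_ xc wI isT isT).
  have -> : u (w, y1) - u (x, y1) - (u (w, y0) - u (x, y0)) = u (w, y1) - u (w, y0) - (u (x, y1) - u (x, y0)) by ring.
  move=> /le_trans; apply; rewrite (gtr0_norm k0) mulrC ler_pM2l// mulrC ler_wpM2r ?Sxy_ge0//.
  by move: wI xI => /andP[? ?] /andP[? ?]; rewrite ler_norml; apply/andP; split; lra.
have C : `|(1 - r) * ((u (x0, y1) - u (x0, y0)) - (u (x, y1) - u (x, y0))) +
   r * ((u (x1, y1) - u (x1, y0)) - (u (x, y1) - u (x, y0)))| <= (y1 - y0) * ((x1 - x0) * Sxy).
  by apply: convex_le => //; apply: E; rewrite lexx ltW.
have k_neq0 : y1 - y0 != 0 by rewrite gt_eqF.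
rewrite -(ler_pM2l k0) -[X in X * `|_|](gtr0_norm k0) -normrM.
have -> : (y1 - y0) * (((u (x0, y1) * (1 - r) + u (x1, y1) * r) - (u (x0, y0) * (1 - r) + u (x1, y0) * r)) / (y1 - y0)
    - pdy u (x, y)) = (u (x, y1) - u (x, y0) - (y1 - y0) * pdy u (x, y)) +
    ((1 - r) * ((u (x0, y1) - u (x0, y0)) - (u (x, y1) - u (x, y0))) +
   r * ((u (x1, y1) - u (x1, y0)) - (u (x, y1) - u (x, y0)))) by field.
by rewrite (le_trans (ler_normD _ _))// [leRHS]mulrDr addrC lerD.
Qed.

End Bounds.
End CellInterpolation.

(** * Mesh widths against layer functions *)

Section LayerGrid.
Context {R : realType}.
Implicit Types (xs ys : seq R) (x y : R).

(** A width proportional to max(eps, x) is eps times max(1, t) with t = x/eps; a fixed fraction of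
    the decay keeps the product bounded uniformly in eps. *)
Lemma max1_expN (a t : R) : 0 < a -> 0 <= t -> Num.max 1 t * expR (- (a * t)) <= 1 + a^-1.
Proof.
move=> a0 t0; have at0 : 0 <= a * t by rewrite mulr_ge0// ltW.
have e1 : expR (- (a * t)) <= 1 by rewrite -expR0 ler_expR oppr_le0.
have e0 := expR_ge0 (- (a * t)).
have te : t * expR (- (a * t)) <= a^-1.
  rewrite expRN ler_pdivrMr ?expR_gt0// -ler_pdivrMl ?invr_gt0// invrK.
  by rewrite (le_trans _ (expR_ge1Dx _))// lerDr.
have a'0 : 0 <= a^-1 by rewrite invr_ge0 ltW.
by case: (leP 1 t) => _; lra.
Qed.

Definition xlayer (K h eps : R) xs := grid xs /\
  forall i, (i.+1 < size xs)%N -> xs`_i.+1 - xs`_i <= K * h * Num.max eps xs`_i.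

Definition ylayer (K h sig : R) ys := grid ys /\
  forall j, (j.+1 < size ys)%N -> ys`_j.+1 - ys`_j <= K * h * Num.max sig (Num.min ys`_j (1 - ys`_j.+1)).

Section Constants.
Variables (C' beta delta K : R).
Hypotheses (b0 : 0 < beta) (d0 : 0 < delta) (K0 : 0 < K).

(** [A], [A'] and [A2] are the bounds of [max1_expN] for the rates [beta], [delta] and [beta / 2];
    [G] is the price for moving the exponential from the left end of a cell to another of its
    points. [I1] serves the value and the [y] derivative, [I2] the [x] derivative. *)
Let D := `|C'|.
Let A := 1 + beta^-1.
Let A' := 1 + delta^-1.
Let A2 := 1 + (beta / 2)^-1.
Let G := expR (beta / 2).

Definition layer_rate := beta / (2 * (1 + K)).
Let I1 := 3 * (1 + A) + 2 * (1 + 2 * A').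
Let I2 := 3 * (1 + A2 * G) + (1 + 2 * A') * (1 + G).
Definition interp_constant := D * K * (I1 + I2).

Let DK0 : 0 <= D * K. Proof. by rewrite /D mulr_ge0 ?normr_ge0// ltW. Qed.
Let A0 : 0 <= A. Proof. by rewrite addr_ge0// invr_ge0 ltW. Qed.
Let A'0 : 0 <= A'. Proof. by rewrite addr_ge0// invr_ge0 ltW. Qed.
Let A20 : 0 <= A2. Proof. by rewrite addr_ge0// invr_ge0 ltW// divr_gt0. Qed.
Let G0 : 0 <= G. Proof. exact: expR_ge0. Qed.

Let I10 : 0 <= I1. Proof. by rewrite addr_ge0// mulr_ge0// addr_ge0// mulr_ge0. Qed.
Let I20 : 0 <= I2.
Proof. by rewrite addr_ge0//; [rewrite mulr_ge0// addr_ge0// mulr_ge0|rewrite mulr_ge0// addr_ge0// mulr_ge0]. Qed.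

Lemma interp_constant_ge0 : 0 <= interp_constant.
Proof. by rewrite mulr_ge0// addr_ge0. Qed.

Variables (eps h : R).
Hypotheses (e0 : 0 < eps) (e1 : eps <= 1) (h0 : 0 < h) (h1 : h <= 1).
Let sig := Num.sqrt eps.
Let sig0 : 0 < sig. Proof. by rewrite sqrtr_gt0. Qed.
Let sig1 : sig <= 1. Proof. by rewrite -[leRHS]sqrtr1 ler_sqrt. Qed.

Section XCell.
Variables (x0 x1 : R).
Hypotheses (x00 : 0 <= x0) (x01 : x0 < x1) (x11 : x1 <= 1) (xh : x1 - x0 <= K * h * Num.max eps x0).
Let m := Num.max eps x0.
Let E1 := expR (- (beta * x0 / eps)).

Let m0 : 0 <= m. Proof. by rewrite /m le_max x00 orbT. Qed.
Let m1 : m <= 1. Proof. by rewrite /m ge_max e1 (le_trans (ltW x01)). Qed.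
Let mE : m = eps * Num.max 1 (x0 / eps).
Proof. by rewrite maxr_pMr ?ltW// mulr1 mulrC divfK ?gt_eqF. Qed.

Let m_E1 : m * (eps^-1 * E1) <= A.
Proof.
have -> : m * (eps^-1 * E1) = Num.max 1 (x0 / eps) * expR (- (beta * (x0 / eps))).
  by rewrite mE /E1 mulrA; field; rewrite gt_eqF.
by apply: max1_expN => //; rewrite divr_ge0// ltW.
Qed.

(** With half of the exponent the width pays for one of the two powers of [eps^-1]. The other power
    keeps the other half, and this becomes the layer weight. *)
Let m_E2 : m * (eps^-1 ^+ 2 * E1) <= eps^-1 * (A2 * expR (- (beta / 2 * (x0 / eps)))).
Proof.
have e2 : E1 = expR (- (beta / 2 * (x0 / eps))) * expR (- (beta / 2 * (x0 / eps))).
  by rewrite -expRD; congr expR; field; rewrite gt_eqF.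
have -> : m * (eps^-1 ^+ 2 * E1) = eps^-1 * (Num.max 1 (x0 / eps) * expR (- (beta / 2 * (x0 / eps))) *
    expR (- (beta / 2 * (x0 / eps)))).
  by rewrite mE e2; field; rewrite gt_eqF.
apply: ler_wpM2l; first by rewrite invr_ge0 ltW.
apply: ler_wpM2r; first exact: expR_ge0.
by apply: max1_expN; rewrite ?divr_gt0// divr_ge0// ltW.
Qed.

(** As [h <= 1], a point of the cell satisfies [x <= (1 + K) * x0 + K * eps]. Dividing by [1 + K]
    gives the rate [layer_rate], and the term in [eps] costs at most the factor [G]. *)
Let half_layer x : x0 < x < x1 ->
  expR (- (beta / 2 * (x0 / eps))) <= G * expR (- (layer_rate / eps * x)).
Proof.
move=> /andP[x0x xx1]; rewrite -expRD ler_expR.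
have K1 : 0 < 1 + K by rewrite addr_gt0.
have xle : x <= (1 + K) * x0 + K * eps.
  have Km : K * h * m <= K * (eps + x0).
    rewrite -mulrA ler_pM2l//; apply: (@le_trans _ _ m); first by rewrite ler_piMl.
    by rewrite /m ge_max lerDl x00 lerDr ltW.
  have := le_trans xh Km; move: xx1; lra.
rewrite -subr_ge0 /layer_rate.
have -> : beta / 2 - beta / (2 * (1 + K)) / eps * x - - (beta / 2 * (x0 / eps)) =
    beta / (2 * (1 + K) * eps) * ((1 + K) * (x0 + eps) - x) by field; rewrite !gt_eqF.
apply: mulr_ge0; first by rewrite divr_ge0 ?ltW// !mulr_gt0.
by move: xle; have := e0; lra.
Qed.

Lemma xcell_bounds x w : x0 < x < x1 -> w = eps^-1 * expR (- (layer_rate / eps * x)) ->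
  [/\ (x1 - x0) * (1 + eps^-1 * E1) <= K * h * (1 + A),
      (x1 - x0) * (1 + eps^-1 ^+ 2 * E1) <= K * h * ((1 + A2 * G) * (1 + w)) &
      eps^-1 * E1 <= G * w].
Proof.
move=> xI ->; set v := expR (- (_ * x)).
have v0 : 0 <= v by exact: expR_ge0.
have Kh0 : 0 <= K * h by rewrite mulr_ge0// ltW.
have ei0 : 0 <= eps^-1 by rewrite invr_ge0 ltW.
have E10 : 0 <= E1 by exact: expR_ge0.
have hl := half_layer xI; rewrite -/v in hl.
split.
- apply: (@le_trans _ _ (K * h * m * (1 + eps^-1 * E1))).
    by apply: ler_wpM2r => //; rewrite addr_ge0// mulr_ge0.
  by rewrite -mulrA; apply: ler_wpM2l => //; rewrite mulrDr mulr1 lerD.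
- apply: (@le_trans _ _ (K * h * m * (1 + eps^-1 ^+ 2 * E1))).
    by apply: ler_wpM2r => //; rewrite addr_ge0// mulr_ge0// sqr_ge0.
  rewrite -mulrA; apply: ler_wpM2l => //; rewrite mulrDr mulr1.
  apply: (@le_trans _ _ (1 + A2 * G * (eps^-1 * v))).
    apply: lerD => //; apply: (le_trans m_E2).
    have -> : A2 * G * (eps^-1 * v) = eps^-1 * (A2 * (G * v)) by ring.
    by do 2 apply: ler_wpM2l => //.
  have p1 : 0 <= A2 * G by rewrite mulr_ge0.
  have p2 : 0 <= eps^-1 * v by rewrite mulr_ge0.
  rewrite -subr_ge0.
  have -> : (1 + A2 * G) * (1 + eps^-1 * v) - (1 + A2 * G * (eps^-1 * v)) = A2 * G + eps^-1 * v by ring.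
  exact: addr_ge0.
- rewrite mulrCA; apply: ler_wpM2l => //; apply: le_trans hl.
  rewrite ler_expR lerN2; have -> : beta * x0 / eps = beta * (x0 / eps) by ring.
  apply: ler_wpM2r; first by rewrite divr_ge0// ltW.
  by have := b0; lra.
Qed.

End XCell.

Section YCell.
Variables (y0 y1 : R).
Hypotheses (y00 : 0 <= y0) (y01 : y0 < y1) (y11 : y1 <= 1).
Hypothesis (yh : y1 - y0 <= K * h * Num.max sig (Num.min y0 (1 - y1))).
Let d := Num.min y0 (1 - y1).
Let n := Num.max sig d.
Let E2 := expR (- (delta * (d / sig))).

Let d_ge0 : 0 <= d. Proof. by rewrite le_min y00 subr_ge0. Qed.
Let n0 : 0 <= n. Proof. by rewrite /n le_max d_ge0 orbT. Qed.
Let n1 : n <= 1. Proof. by rewrite /n ge_max sig1 ge_min (le_trans (ltW y01)). Qed.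
Let nE : n = sig * Num.max 1 (d / sig).
Proof. by rewrite maxr_pMr ?ltW// mulr1 mulrC divfK ?gt_eqF. Qed.

Let n_E2 : n * (sig^-1 * E2) <= A'.
Proof.
have -> : n * (sig^-1 * E2) = Num.max 1 (d / sig) * E2 by rewrite nE mulrA; field; rewrite gt_eqF.
by apply: max1_expN => //; rewrite divr_ge0// ltW.
Qed.

Lemma layerE_cell y : y0 < y < y1 -> layerE delta eps y <= 2 * E2.
Proof.
move=> /andP[h2 h3]; rewrite /layerE -/sig.
have H z : d <= z -> expR (- (z * delta / sig)) <= E2.
  move=> dz; rewrite ler_expR lerN2 mulrA [delta * d]mulrC.
  by apply: ler_wpM2r; [rewrite invr_ge0 ltW|apply: ler_wpM2r => //; exact: ltW].
have H1 : d <= y by rewrite /d ge_min (ltW h2).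
have H2 : d <= 1 - y by rewrite /d ge_min lerD2l lerN2 (ltW h3) orbT.
by have := H _ H1; have := H _ H2; lra.
Qed.

(** In [y] the height also pays for one power of [sig^-1]; the power left over is compensated by the
    factor [eps] that the squared energy norm puts on the [y] derivative, so no weight arises. *)
Lemma ycell_bounds :
  [/\ (y1 - y0) * (1 + sig^-1 * (2 * E2)) <= K * h * (1 + 2 * A'),
      (y1 - y0) * (1 + sig^-1 ^+ 2 * (2 * E2)) <= K * h * ((1 + 2 * A') * sig^-1) &
      1 + sig^-1 * (2 * E2) <= 3 * sig^-1].
Proof.
have Kh0 : 0 <= K * h by rewrite mulr_ge0// ltW.
have si0 : 0 <= sig^-1 by rewrite invr_ge0 ltW.
have si1 : 1 <= sig^-1 by rewrite -[leLHS]invr1 lef_pV2 ?posrE.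
have E20 : 0 <= E2 by exact: expR_ge0.
have E21 : E2 <= 1 by rewrite -expR0 ler_expR oppr_le0 mulr_ge0 ?divr_ge0// ltW.
have nE2 := n_E2.
split.
- apply: (@le_trans _ _ (K * h * n * (1 + sig^-1 * (2 * E2)))).
    by apply: ler_wpM2r => //; rewrite addr_ge0// !mulr_ge0.
  rewrite -mulrA; apply: ler_wpM2l => //.
  have -> : n * (1 + sig^-1 * (2 * E2)) = n + 2 * (n * (sig^-1 * E2)) by ring.
  by apply: lerD => //; rewrite ler_pM2l.
- apply: (@le_trans _ _ (K * h * n * (1 + sig^-1 ^+ 2 * (2 * E2)))).
    by apply: ler_wpM2r => //; rewrite addr_ge0// !mulr_ge0// sqr_ge0.
  rewrite -mulrA; apply: ler_wpM2l => //.
  have -> : n * (1 + sig^-1 ^+ 2 * (2 * E2)) = n + 2 * (n * (sig^-1 * E2)) * sig^-1 by ring.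
  rewrite [leRHS]mulrDl mul1r; apply: lerD; first exact: le_trans si1.
  by apply: ler_wpM2r => //; rewrite ler_pM2l.
- have : sig^-1 * (2 * E2) <= sig^-1 * 2 by rewrite ler_wpM2l//; lra.
  lra.
Qed.

End YCell.

Lemma layer_interpolation xs ys (u : R * R -> R) : xlayer K h eps xs -> ylayer K h sig ys ->
  regular u -> derivative_bounds C' beta delta eps u ->
  forall p, Omega p -> p.1 \notin xs -> p.2 \notin ys ->
    [/\ `|tensor xs ys (nodal u xs ys) p - u p| <= interp_constant * h,
        `|tensor_x xs ys (nodal u xs ys) p - pdx u p| <= interp_constant * h * (1 + weight layer_rate eps p) &
        eps * (tensor_y xs ys (nodal u xs ys) p - pdy u p) ^+ 2 <= (interp_constant * h) ^+ 2].
Proof.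
move=> [gx hx] [gy hy] ru db [x y] Oxy xn yn; have [/= xI yI] := Oxy.
have [pu cu u0 _] := ru; have nz := zero_bd_nodal gx gy u0.
have [k ks kx] := grid_open_cell gx xI xn; have [l ls ly] := grid_open_cell gy yI yn.
have [kx0 kx1] := andP kx; have [ly0 ly1] := andP ly.
have /andP[X0 _] := grid_itv_nth k gx; have /andP[_ X1] := grid_itv_nth k.+1 gx.
have /andP[Y0 _] := grid_itv_nth l gy; have /andP[_ Y1] := grid_itv_nth l.+1 gy.
have [_ _ _ /(_ k ks) X01] := gx; have [_ _ _ /(_ l ls) Y01] := gy.
have hk := hx k ks; have hl := hy l ls.
have pkl : mesh_cell xs ys k l (x, y) by split; rewrite /= !ltW.
set x0 := xs`_k in kx kx0 X0 X01 hk; set x1 := xs`_k.+1 in kx kx1 X1 X01 hk.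
set y0 := ys`_l in ly ly0 Y0 Y01 hl; set y1 := ys`_l.+1 in ly ly1 Y1 Y01 hl.
set w := weight layer_rate eps (x, y).
have [B1 B2 B3] := xcell_bounds X0 X01 X1 hk kx (erefl w).
have [B4 B5 B6] := ycell_bounds Y0 Y01 Y1 hl.
set E1 := expR (- (beta * x0 / eps)) in B1 B2 B3.
set E2 := expR (- (delta * (Num.min y0 (1 - y1) / sig))) in B4 B5 B6.
have w0 : 0 <= w by exact: weight_ge0.
have E10 : 0 <= E1 by exact: expR_ge0.
have E20 : 0 <= E2 by exact: expR_ge0.
have ei0 : 0 <= eps^-1 by rewrite invr_ge0 ltW.
have si0 : 0 <= sig^-1 by rewrite invr_ge0 ltW.
have D0 : 0 <= D by exact: normr_ge0.
have Kh0 : 0 <= K * h by rewrite mulr_ge0// ltW.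
(* The first version keeps the decay in [y], for derivatives that involve [y]; the second bounds the
   layer function by 2, for pure [x] derivatives, which meet only the width of the cell. *)
have pb (i j : nat) (ij : (i + j <= 2)%N) z v : x0 < z < x1 -> y0 < v < y1 ->
    `|partial i j u (z, v)| <= D * ((1 + eps^-1 ^+ i * E1) * (1 + sig^-1 ^+ j * (2 * E2))) /\
    `|partial i j u (z, v)| <= D * ((1 + eps^-1 ^+ i * E1) * (1 + sig^-1 ^+ j * 2)).
  move=> zI vI; have [z0 z1] := andP zI; have [v0 v1] := andP vI.
  have Ozv : Omega (z, v).
    by split; rewrite /= ?(le_lt_trans X0 z0) ?(lt_le_trans z1 X1) ?(le_lt_trans Y0 v0) ?(lt_le_trans v1 Y1).
  have H := partial_bound e0 d0 db ij Ozv; rewrite /= -/sig in H.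
  have /andP[l0 l2] : 0 <= layerE delta eps v <= 2 by apply: layerE_le2 => //; have [_ /andP[? ?]] := Ozv; rewrite !ltW.
  have lE := layerE_cell vI; rewrite -/E2 in lE.
  have eE : expR (- (beta * z / eps)) <= E1.
    rewrite ler_expR lerN2; apply: ler_wpM2r => //; apply: ler_wpM2l; exact: ltW.
  have ex0 := expR_ge0 (- (beta * z / eps)).
  have ei : 0 <= eps^-1 ^+ i by exact: exprn_ge0.
  have sj : 0 <= sig^-1 ^+ j by exact: exprn_ge0.
  split; apply: (le_trans H); apply: ler_wpM2l => //; apply: ler_pM.
  - by rewrite addr_ge0// mulr_ge0.
  - by rewrite addr_ge0// mulr_ge0.
  - by rewrite lerD2l ler_wpM2l.
  - by rewrite lerD2l ler_wpM2l.
  - by rewrite addr_ge0// mulr_ge0.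
  - by rewrite addr_ge0// mulr_ge0.
  - by rewrite lerD2l ler_wpM2l.
  - by rewrite lerD2l ler_wpM2l.
pose P1 := 1 + eps^-1 * E1; pose P2 := 1 + eps^-1 ^+ 2 * E1.
pose Q1 := 1 + sig^-1 * (2 * E2); pose Q2 := 1 + sig^-1 ^+ 2 * (2 * E2).
have /andP[_ E11] : 0 <= E1 <= 1 by exact: expR_layer_le1.
have P10 : 0 <= P1 by rewrite addr_ge0// mulr_ge0.
have Q10 : 0 <= Q1 by rewrite addr_ge0// !mulr_ge0.
have Q20 : 0 <= Q2 by rewrite addr_ge0// !mulr_ge0// sqr_ge0.
have HSx z v : x0 < z < x1 -> y0 < v < y1 -> `|pdx u (z, v)| <= 3 * (D * P1).
  move=> zI vI; have [_ H] := pb 1%N 0%N isT z v zI vI; apply: (le_trans H).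
  by rewrite expr0 expr1 mul1r -/P1 le_eqVlt; apply/orP; left; apply/eqP; ring.
have HSy z v : x0 < z < x1 -> y0 < v < y1 -> `|pdy u (z, v)| <= 2 * (D * Q1).
  move=> zI vI; have [H _] := pb 0%N 1%N isT z v zI vI; apply: (le_trans H).
  rewrite expr0 expr1 mul1r -/Q1 mulrCA; apply: ler_wpM2r; first exact: mulr_ge0.
  by rewrite (natrD _ 1 1) lerD2l.
have HSxx z v : x0 < z < x1 -> y0 < v < y1 -> `|pdx (pdx u) (z, v)| <= 3 * (D * P2).
  move=> zI vI; have [_ H] := pb 2%N 0%N isT z v zI vI; apply: (le_trans H).
  by rewrite expr0 mul1r -/P2 le_eqVlt; apply/orP; left; apply/eqP; ring.
have HSxy z v : x0 < z < x1 -> y0 < v < y1 -> `|pdx (pdy u) (z, v)| <= D * (P1 * Q1).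
  by move=> zI vI; have [H _] := pb 1%N 1%N isT z v zI vI; apply: (le_trans H); rewrite !expr1.
have HSyy z v : x0 < z < x1 -> y0 < v < y1 -> `|pdy (pdy u) (z, v)| <= 2 * (D * Q2).
  move=> zI vI; have [H _] := pb 0%N 2%N isT z v zI vI; apply: (le_trans H).
  rewrite expr0 mul1r -/Q2 mulrCA; apply: ler_wpM2r; first exact: mulr_ge0.
  by rewrite (natrD _ 1 1) lerD2l.
have rI : 0 <= bary xs k x <= 1.
  rewrite /bary -/x0 -/x1 divr_ge0 ?subr_ge0 ?(ltW kx0) ?(ltW X01)//=.
  by rewrite ler_pdivrMr ?subr_gt0// mul1r lerD2r ltW.
have qI : 0 <= bary ys l y <= 1.
  rewrite /bary -/y0 -/y1 divr_ge0 ?subr_ge0 ?(ltW ly0) ?(ltW Y01)//=.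
  by rewrite ler_pdivrMr ?subr_gt0// mul1r lerD2r ltW.
have lyc : y0 <= y <= y1 by rewrite !ltW.
have kxc : x0 <= x <= x1 by rewrite !ltW.
have V0 := cell_interp_value pu cu X0 X1 X01 Y0 Y1 Y01 HSx HSy kx ly rI qI.
have V1 := cell_interp_dx pu cu X0 X1 X01 Y0 Y1 Y01 HSxx HSxy kx ly qI.
have V2 := cell_interp_dy pu cu X0 X1 X01 Y0 Y1 Y01 HSxy HSyy kx ly rI.
have T0 := tensor_cell gx gy nz ks ls pkl.
have T1 : tensor_x xs ys (nodal u xs ys) (x, y) =
    ((u (x1, y0) * (1 - bary ys l y) + u (x1, y1) * bary ys l y) -
     (u (x0, y0) * (1 - bary ys l y) + u (x0, y1) * bary ys l y)) / (x1 - x0).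
  rewrite tensor_xE (dinterp_cell gx _ _ ks kx); last 2 first.
  - by apply: interp0 => j; have [] := nz 0%N j.
  - by apply: interp0 => j; have [] := nz 0%N j.
  by rewrite !(interp_cell gy _ _ ls lyc)//; have [] := nz k 0%N; have [] := nz k.+1 0%N.
have T2 : tensor_y xs ys (nodal u xs ys) (x, y) =
    ((u (x0, y1) * (1 - bary xs k x) + u (x1, y1) * bary xs k x) -
     (u (x0, y0) * (1 - bary xs k x) + u (x1, y0) * bary xs k x)) / (y1 - y0).
  rewrite tensor_yE (dinterp_cell gy _ _ ls ly); last 2 first.
  - by apply: interp0 => j; have [] := nz j 0%N.
  - by apply: interp0 => j; have [] := nz j 0%N.
  by rewrite !(interp_cell gx _ _ ks kxc)//; have [] := nz 0%N l; have [] := nz 0%N l.+1.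
rewrite T0 T1 T2.
have kx0' : 0 <= x1 - x0 by rewrite subr_ge0 ltW.
have ly0' : 0 <= y1 - y0 by rewrite subr_ge0 ltW.
have DKh : 0 <= D * K * h by rewrite mulr_ge0// ltW.
have EC1 : D * K * h * I1 <= interp_constant * h.
  by rewrite /interp_constant [leRHS]mulrAC ler_wpM2l// lerDl.
have EC2 : D * K * h * I2 <= interp_constant * h.
  by rewrite /interp_constant [leRHS]mulrAC ler_wpM2l// lerDr.
have F1 := ler_wpM2l D0 B1; have F4 := ler_wpM2l D0 B4.
have F2 := ler_wpM2l D0 B2; have F5 := ler_wpM2l D0 B5.
split.
- apply: (le_trans V0).
  apply: le_trans EC1.
  have -> : (x1 - x0) * (3 * (D * P1)) + (y1 - y0) * (2 * (D * Q1)) =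
    3 * (D * ((x1 - x0) * P1)) + 2 * (D * ((y1 - y0) * Q1)) by ring.
  have -> : D * K * h * I1 = 3 * (D * (K * h * (1 + A))) + 2 * (D * (K * h * (1 + 2 * A'))).
    by rewrite /I1; ring.
  by apply: lerD; apply: ler_wpM2l.
- apply: (le_trans V1).
  apply: (@le_trans _ _ (D * K * h * I2 * (1 + w))); last by apply: ler_wpM2r; rewrite ?addr_ge0.
  have Gw : P1 <= (1 + G) * (1 + w).
    apply: (@le_trans _ _ (1 + G * w)); first by rewrite lerD2l.
    have -> : (1 + G) * (1 + w) = 1 + G * w + G + w by ring.
    by rewrite -addrA lerDl addr_ge0.
  (* For the mixed derivative the height of the cell absorbs the [y] factor, and the [x] factor is
     left to the weight. *)
  have F6 : D * ((y1 - y0) * Q1) * P1 <= D * (K * h * (1 + 2 * A')) * ((1 + G) * (1 + w)).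
    by apply: ler_pM => //; rewrite !mulr_ge0.
  have -> : (x1 - x0) * (3 * (D * P2)) + (y1 - y0) * (D * (P1 * Q1)) =
    3 * (D * ((x1 - x0) * P2)) + D * ((y1 - y0) * Q1) * P1 by ring.
  have -> : D * K * h * I2 * (1 + w) = 3 * (D * (K * h * ((1 + A2 * G) * (1 + w)))) +
      D * (K * h * (1 + 2 * A')) * ((1 + G) * (1 + w)).
    by rewrite /I2; ring.
  by apply: lerD => //; apply: ler_wpM2l.
(* Here the roles are exchanged: the width absorbs the [x] factor, and the [y] factor is at most
   [3 * sig^-1]. *)
- have F7 : D * ((x1 - x0) * P1) * Q1 <= D * (K * h * (1 + A)) * (3 * sig^-1).
    by apply: ler_pM => //; rewrite !mulr_ge0.
  set V := _ / _ - _ in V2 *.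
  have HV : `|V| <= interp_constant * h * sig^-1.
    apply: (le_trans V2).
    apply: (@le_trans _ _ (D * K * h * I1 * sig^-1)); last by apply: ler_wpM2r.
    have -> : (x1 - x0) * (D * (P1 * Q1)) + (y1 - y0) * (2 * (D * Q2)) =
      D * ((x1 - x0) * P1) * Q1 + 2 * (D * ((y1 - y0) * Q2)) by ring.
    have -> : D * K * h * I1 * sig^-1 = D * (K * h * (1 + A)) * (3 * sig^-1) +
        2 * (D * (K * h * ((1 + 2 * A') * sig^-1))).
      by rewrite /I1; ring.
    by apply: lerD => //; apply: ler_wpM2l.
  have Ch0 : 0 <= interp_constant * h by rewrite mulr_ge0 ?interp_constant_ge0// ltW.
  apply: (@le_trans _ _ (eps * (interp_constant * h * sig^-1) ^+ 2)).
    apply: ler_wpM2l; first exact: ltW.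
    by rewrite -(sqr_normr V) lerXn2r ?nnegrE// mulr_ge0.
  have -> : eps = sig ^+ 2 by rewrite sqr_sqrtr// ltW.
  by rewrite le_eqVlt; apply/orP; left; apply/eqP; field; rewrite gt_eqF.
Qed.

End Constants.
End LayerGrid.

(** * Duran-Lombardi meshes *)

Section DLMesh.
Context {R : realType}.
Implicit Types (xs ys s : seq R) (y : R).

Section Graded.
Variables (h sig : R).
Hypotheses (h0 : 0 < h) (h1 : h < 1) (sig0 : 0 < sig).

Lemma dl_N_itv : h^-1 <= (dl_N h)%:R < h^-1 + 1.
Proof.
have hi0 : 0 < h^-1 by rewrite invr_gt0.
have c0 : 0 <= Num.ceil h^-1 by rewrite ltW// ceil_gt0.
have E : (dl_N h)%:R = (Num.ceil h^-1)%:~R :> R.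
  by rewrite /dl_N pmulrn gez0_abs.
have /andP[c1 c2] : (Num.ceil h^-1 - 1)%:~R < h^-1 <= (Num.ceil h^-1)%:~R by exact: real_ceil_itv (num_real _).
by rewrite E c2/=; move: c1; rewrite intrB; lra.
Qed.

Lemma dl_N_gt1 : (1 < dl_N h)%N.
Proof.
rewrite -(ltr_nat R); have /andP[c1 _] := dl_N_itv; apply: lt_le_trans c1.
by rewrite invf_gt1.
Qed.

Lemma dl_pt_low i : (i <= dl_N h)%N -> dl_pt h sig i = i%:R * h * sig.
Proof. by case: i => [|i] /=; [rewrite !mul0r|move=> ->]. Qed.

Lemma dl_pt_high i : (dl_N h <= i)%N -> dl_pt h sig i.+1 = (1 + h) * dl_pt h sig i.
Proof. by move=> iN; rewrite /= ltnNge iN/= mulrDl mul1r. Qed.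

Lemma dl_pt_gt0 i : (0 < i)%N -> 0 < dl_pt h sig i.
Proof.
elim: i => // i IHi _; have [iN|Ni] := leqP i.+1 (dl_N h).
  by rewrite dl_pt_low// !mulr_gt0// ltr0n.
have i0 : (0 < i)%N by rewrite (leq_trans _ (ltnSE Ni))// ltnW// dl_N_gt1.
by rewrite dl_pt_high// mulr_gt0 ?addr_gt0// IHi.
Qed.

Lemma dl_pt_step i : 0 < dl_pt h sig i.+1 - dl_pt h sig i <= h * Num.max sig (dl_pt h sig i).
Proof.
have [iN|Ni] := leqP i.+1 (dl_N h).
  rewrite !dl_pt_low//; last exact: ltnW.
  rewrite -natr1; have -> : (i%:R + 1) * h * sig - i%:R * h * sig = h * sig by ring.
  by rewrite mulr_gt0//= ler_pM2l// le_max lexx.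
rewrite dl_pt_high//; have -> : (1 + h) * dl_pt h sig i - dl_pt h sig i = h * dl_pt h sig i by ring.
have i0 : (0 < i)%N by rewrite (leq_trans _ (ltnSE Ni))// ltnW// dl_N_gt1.
by rewrite mulr_gt0 ?dl_pt_gt0//= ler_pM2l// le_max lexx orbT.
Qed.

(** The factor [1 + kappa] is due to a removed node: the second part of the merged last interval is
    shorter than [kappa] times the first. All other intervals satisfy the bound without this
    factor. *)
Lemma dl_graded_steps (kappa L : R) s : 0 < kappa -> dl_graded kappa h sig L s ->
  [/\ (1 < size s)%N, s`_0 = 0, s`_(size s).-1 = L &
    forall i, (i.+1 < size s)%N -> 0 < s`_i.+1 - s`_i <= (1 + kappa) * h * Num.max sig s`_i].
Proof.
move=> k0 [m [Nm mL Lm ->]].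
set m' := if _ then m else m.-1.
(* As [h < 1] there are at least two uniform steps, so [m.-1] and [m.-2] are distinct positive
   indices. *)
have m3 : (2 < m)%N by exact: leq_ltn_trans dl_N_gt1 Nm.
have m'1 : (0 < m')%N.
  by rewrite /m'; case: ifP => _; [rewrite (leq_trans _ m3)|move: m3; case: (m) => [|[|]]].
have sizeE : size (rcons (mkseq (dl_pt h sig) m') L) = m'.+1 by rewrite size_rcons size_mkseq.
have nthE i : (i < m')%N -> (rcons (mkseq (dl_pt h sig) m') L)`_i = dl_pt h sig i.
  by move=> im; rewrite nth_rcons size_mkseq im nth_mkseq.
have nthL : (rcons (mkseq (dl_pt h sig) m') L)`_m' = L.
  by rewrite nth_rcons size_mkseq ltnn eqxx.
have K1 : 1 <= 1 + kappa by rewrite lerDl ltW.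
rewrite sizeE; split => //.
- by rewrite nthE.
- move=> i; rewrite ltnS leq_eqVlt => /predU1P[im|im]; last first.
    rewrite !nthE//; last exact: ltnW.
    have /andP[h2 h3] := dl_pt_step i; rewrite h2 andTb -[leRHS]mulrA (le_trans h3)// ler_peMl//.
    by rewrite mulr_ge0 ?(ltW h0)// le_max (ltW sig0).
  rewrite im nthL nthE -?im//.
  move: im; rewrite /m'; case: ifPn => [_ im|].
    have -> : i = m.-1 by rewrite -im.
    rewrite subr_gt0 mL andTb -[leRHS]mulrA; apply: (@le_trans _ _ (h * Num.max sig (dl_pt h sig m.-1))).
      apply: (@le_trans _ _ (h * dl_pt h sig m.-1)); first by lra.
      by rewrite ler_pM2l// le_max lexx orbT.
    by rewrite ler_peMl// mulr_ge0 ?(ltW h0)// le_max (ltW sig0).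
  rewrite -ltNge => short im.
  have im2 : i = m.-2 by rewrite -im.
  have m1E : m.-1 = m.-2.+1 by rewrite prednK// -ltnS prednK (leq_trans _ m3).
  have /andP[h2 h3] := dl_pt_step m.-2; rewrite -m1E in h2 h3.
  rewrite im2; apply/andP; split; first by lra.
  apply: (@le_trans _ _ ((1 + kappa) * (dl_pt h sig m.-1 - dl_pt h sig m.-2))).
    by move: short; lra.
  by rewrite -[leRHS]mulrA ler_pM2l// ltr_wpDr// ltW.
Qed.

(** It makes the growth of the mesh exponential: j geometric steps multiply a node by at least exp(j
    h/2), which bounds their number by a logarithm. It follows from exp(-h/2) >= 1 - h/2 and (1 +
    h)(1 - h/2) >= 1. *)
Lemma expR_half_le : expR (h / 2) <= 1 + h.
Proof.
have e0 := expR_gt0 (h / 2).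
have H : 1 - h / 2 <= (expR (h / 2))^-1 by rewrite -expRN expR_ge1Dx.
have H2 : (1 - h / 2) * expR (h / 2) <= 1.
  by rewrite -ler_pdivlMr// mul1r.
have : 1 <= (1 + h) * (1 - h / 2).
  have -> : (1 + h) * (1 - h / 2) = 1 + h * (1 - h) / 2 by field.
  have : 0 < h * (1 - h) by rewrite mulr_gt0// subr_gt0.
  by lra.
move=> H3; have := ler_wpM2r (ltW e0) H3; rewrite mul1r -mulrA.
have p : 0 <= 1 + h by have := h0; lra.
by move=> /le_trans; apply; rewrite -[leRHS]mulr1; exact: ler_wpM2l.
Qed.

Lemma dl_pt_growth j : sig * expR (j%:R * (h / 2)) <= dl_pt h sig (dl_N h + j).
Proof.
elim: j => [|j IHj].
  rewrite mul0r expR0 mulr1 addn0 dl_pt_low// -[leLHS]mul1r ler_pM2r//.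
  by have /andP[c1 _] := dl_N_itv; rewrite -ler_pdivrMr// mul1r.
rewrite addnS dl_pt_high ?leq_addr// -natr1 mulrDl mul1r expRD mulrA mulrC.
by apply: ler_pM; [exact: expR_ge0|rewrite mulr_ge0 ?expR_ge0// ltW|exact: expR_half_le|exact: IHj].
Qed.

(** Multiplied by [h], the uniform part contributes at most [1 + h], the geometric part at most
    [- 2 * ln sig] because its nodes stay below 1, and the two remaining indices [2 * h]. *)
Lemma dl_graded_size (kappa L : R) s : L <= 1 -> dl_graded kappa h sig L s ->
  h * (size s)%:R <= 4 - 2 * ln sig.
Proof.
move=> L1 [m [Nm mL _ ->]].
set m' := if _ then m else m.-1.
have m'm : (m' <= m)%N by rewrite /m'; case: ifP => // _; exact: leq_pred.
rewrite size_rcons size_mkseq.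
pose j := (m.-1 - dl_N h)%N.
have mE : m = (dl_N h + j).+1.
  by rewrite /j subnKC; [rewrite prednK// (leq_ltn_trans _ Nm)|rewrite -ltnS prednK// (leq_ltn_trans _ Nm)].
have grow := dl_pt_growth j.
have lt1 : sig * expR (j%:R * (h / 2)) < 1.
  by apply: (le_lt_trans grow); apply: lt_le_trans L1; move: mL; rewrite mE.
have jh : j%:R * (h / 2) < - ln sig.
  rewrite -ltr_expR expRN lnK ?posrE//; move: lt1; rewrite mulrC.
  by rewrite -ltr_pdivlMr// mul1r.
have /andP[_ c2] := dl_N_itv.
have hN : h * (dl_N h)%:R < 1 + h.
  have -> : 1 + h = h * (h^-1 + 1) by field; rewrite gt_eqF.
  by rewrite ltr_pM2l.
have sz : h * m'.+1%:R <= h * ((dl_N h)%:R + j%:R + 2).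
  rewrite ler_pM2l// -!natrD ler_nat; rewrite mE in m'm.
  by rewrite addn2 ltnS.
have := h1; move: sz jh hN; set a := (dl_N h)%:R; set b := j%:R; set c := ln sig; set z := h * _.
by rewrite !mulrDr; lra.
Qed.

End Graded.

Lemma size_dl_ys s (n : nat) : size s = n.+1 ->
  size (s ++ behead (rev [seq 1 - y | y <- s])) = (n + n).+1.
Proof. by move=> sn; rewrite size_cat size_behead size_rev size_map sn. Qed.

(** The node 1/2 is common to both halves: [behead] drops its second copy, so that index [n + j]
    mirrors [n - j]. *)
Lemma nth_dl_ys s (n j : nat) : size s = n.+1 -> s`_n = 2^-1 -> (j <= n)%N ->
  (s ++ behead (rev [seq 1 - y | y <- s]))`_j = s`_j /\
  (s ++ behead (rev [seq 1 - y | y <- s]))`_(n + j) = 1 - s`_(n - j).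
Proof.
move=> sn snE jn; rewrite nth_cat sn ltnS jn; split => //.
rewrite nth_cat sn; have [->|j0] := posnP j.
  by rewrite addn0 ltnS leqnn subn0 snE; lra.
rewrite ltnNge -addn1 leq_add2l j0/= -addn1 subnDl nth_behead subn1 prednK//.
rewrite nth_rev ?size_map ?sn ?ltnS// (nth_map 0) ?sn ?subSS//.
by rewrite ltnS leq_subr.
Qed.

Lemma dl_xlayer (kappa eps h : R) xs : 0 < kappa -> 0 < h -> h < 1 -> 0 < eps ->
  dl_graded kappa h eps 1 xs -> xlayer (1 + kappa) h eps xs.
Proof.
move=> k0 h0 h1 e0 /(dl_graded_steps h0 h1 e0 k0)[s1 s0 sn st]; split.
  by split => // i /st /andP[+ _]; rewrite subr_gt0.
by move=> i /st /andP[].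
Qed.

Lemma dl_ylayer (kappa sig h : R) s : 0 < kappa -> 0 < h -> h < 1 -> 0 < sig ->
  dl_graded kappa h sig 2^-1 s ->
  ylayer (1 + kappa) h sig (s ++ behead (rev [seq 1 - y | y <- s])).
Proof.
move=> k0 h0 h1 e0 /(dl_graded_steps h0 h1 e0 k0)[s1 s0 sn st].
have [n sE] : exists n, size s = n.+1 by exists (size s).-1; rewrite prednK// ltnW.
rewrite sE/= in sn; set ys := _ ++ _; have yE := size_dl_ys sE; rewrite -/ys in yE.
have nE j jn := @nth_dl_ys s n j sE sn jn; rewrite -/ys in nE.
have n0 : (0 < n)%N by move: s1; rewrite sE.
have st_gt i : (i < n)%N -> s`_i < s`_i.+1.
  by move=> iN; have := st i; rewrite sE ltnS => /(_ iN)/andP[+ _]; rewrite subr_gt0.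
have s_le i : (i < n)%N -> s`_i.+1 <= 2^-1.
  have H k : (k <= n)%N -> s`_(n - k) <= 2^-1.
    elim: k => [|k IHk] kn; first by rewrite subn0 sn.
    apply: le_trans (IHk (ltnW kn)); rewrite -[X in _ <= s`_X]subnSK//; apply/ltW/st_gt.
    by rewrite subnS prednK ?subn_gt0// leq_subr.
  by move=> iN; have := H (n - i.+1)%N (leq_subr _ _); rewrite subKn.
have y_low j : (j <= n)%N -> ys`_j = s`_j by move=> /nE[].
have y_high j : (j <= n)%N -> ys`_(n + j) = 1 - s`_(n - j) by move=> /nE[].
have main j : (j.+1 < size ys)%N ->
    0 < ys`_j.+1 - ys`_j <= (1 + kappa) * h * Num.max sig (Num.min ys`_j (1 - ys`_j.+1)).
  rewrite yE ltnS => jn; have [jn'|nj] := ltnP j n.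
    rewrite !y_low//; last exact: ltnW.
    have := st j; rewrite sE ltnS => /(_ jn').
    rewrite min_l//; have := s_le j jn'; have := st_gt j jn'; lra.
  have [i jE] : exists i, j = (n + i)%N by exists (j - n)%N; rewrite subnKC.
  have iN : (i < n)%N by move: jn; rewrite jE ltn_add2l.
  rewrite jE -addnS !y_high//; last exact: ltnW.
  (* The cell mirrors cell [k] of the lower half, and its distance to the side y = 1 is the node of
     index [k] of [s]. *)
  set k := (n - i.+1)%N; have kE : (n - i)%N = k.+1 by rewrite /k subnSK.
  have kn : (k < n)%N by rewrite /k ltn_subrL n0.
  rewrite kE; have := st k; rewrite sE ltnS => /(_ kn).
  have -> : 1 - s`_k - (1 - s`_k.+1) = s`_k.+1 - s`_k by ring.
  have -> : 1 - (1 - s`_k) = s`_k by ring.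
  rewrite min_r//; have := s_le k kn; have := st_gt k kn; lra.
split; last by move=> j /main/andP[].
split.
- by rewrite yE ltnS addn_gt0 n0.
- by rewrite y_low.
- by rewrite yE/= y_high// subnn s0 subr0.
- by move=> j /main/andP[+ _]; rewrite subr_gt0.
Qed.

Lemma count_bound (C l h : R) (M : nat) : 0 < h -> 0 <= C -> 0 <= l -> (0 < M)%N ->
  h ^+ 2 * M%:R <= (C * l) ^+ 2 -> h * l <= C * (1 / Num.sqrt M%:R) * l ^+ 2.
Proof.
move=> h0 C0 l0 M0 H; have q0 : 0 < Num.sqrt M%:R :> R by rewrite sqrtr_gt0 ltr0n.
have H2 : h * Num.sqrt M%:R <= C * l.
  rewrite -(@ler_pXn2r _ 2)// ?nnegrE ?mulr_ge0// ?(ltW h0) ?sqrtr_ge0//.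
  by rewrite exprMn sqr_sqrtr.
have -> : C * (1 / Num.sqrt M%:R) * l ^+ 2 = (C * l / Num.sqrt M%:R) * l by field; rewrite gt_eqF.
by apply: ler_wpM2r => //; rewrite ler_pdivlMr.
Qed.

End DLMesh.

(** * The energy norm of the error *)

Section EnergyNorm.
Context {R : realType}.
Local Notation mu2 := (@leb2 R).
Implicit Types (xs ys : seq R) (u uh w : R * R -> R).

(** Passage from the extended real norm of the statement to real integrals; essential boundedness
    makes both finite. *)
Lemma L2norm_sqr w : bmeas w -> (L2norm w ^+ 2 = (integralO (fun p => w p ^+ 2))%:E)%E.
Proof.
move=> bw; have bw2 : bmeas (fun p => w p ^+ 2) by exact: bmeasM.
have I0 : 0 <= integralO (fun p => w p ^+ 2).
  by apply: integralO_ge0 => //; apply: aeW => p _; exact: sqr_ge0.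
suff -> : L2norm w = (Num.sqrt (integralO (fun p => w p ^+ 2)))%:E.
  by rewrite -EFin_expe sqr_sqrtr.
rewrite /L2norm unlock -powR12_sqrt// -poweR_EFin; congr (_ `^ _)%E.
rewrite /integralO /Rintegral fineK; last first.
  by apply: integrable_fin_num; [exact: measurable_Omega|exact: bmeas_integrable].
rewrite [in RHS]integral_mkcond; apply: eq_integral => p _ /=.
rewrite powR_mulrn ?normr_ge0// sqr_normr /patch.
by case: ifP => // _; rewrite expr0n.
Qed.

Lemma energy_norm_le (eps B : R) w : 0 < eps -> 0 <= B ->
  bmeas w -> bmeas (pdx w) -> bmeas (pdy w) ->
  integralO (fun p => eps * (pdx w p ^+ 2 + pdy w p ^+ 2) + w p ^+ 2) <= B ^+ 2 ->
  (energy_norm eps w <= B%:E)%E.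
Proof.
move=> e0 B0 bw bx by_.
have [sx sy s0] : [/\ bmeas (fun p => pdx w p ^+ 2), bmeas (fun p => pdy w p ^+ 2) & bmeas (fun p => w p ^+ 2)].
  by split; exact: bmeasM.
rewrite integralOD ?integralOZ ?integralOD//; try by apply: bmeasZ; exact: bmeasD.
  2: exact: bmeasD.
move=> H; rewrite /energy_norm !L2norm_sqr// lee_fin.
set I := (X in X `^ _); have I0 : 0 <= I.
  by rewrite addr_ge0 ?mulr_ge0 ?addr_ge0 ?(ltW e0)//; apply: integralO_ge0 => //;
    apply: aeW => p _; exact: sqr_ge0.
by rewrite powR12_sqrt// -(ger0_norm B0) -sqrtr_sqr ler_wsqrtr.
Qed.

Lemma right_deriveB (g k : R -> R) x d e : right_derive g x d -> right_derive k x e ->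
  right_derive (fun t => g t - k t) x (d - e).
Proof.
move=> hg hk a a0; have a2 : 0 < a / 2 by rewrite divr_gt0.
have [r r0 Hr] := hg _ a2; have [s s0 Hs] := hk _ a2.
exists (Num.min r s); first by rewrite lt_min r0.
move=> t; rewrite lt_min => /andP[t0 /andP[tr ts]].
have := Hr t; have := Hs t; rewrite t0 tr ts => /(_ isT) H1 /(_ isT) H2.
have -> : g (x + t) - k (x + t) - (g x - k x) - (d - e) * t =
  (g (x + t) - g x - d * t) - (k (x + t) - k x - e * t) by ring.
by rewrite (le_trans (ler_normB _ _))//; lra.
Qed.

Lemma left_deriveB (g k : R -> R) x d e : left_derive g x d -> left_derive k x e ->
  left_derive (fun t => g t - k t) x (d - e).
Proof.
move=> hg hk a a0; have a2 : 0 < a / 2 by rewrite divr_gt0.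
have [r r0 Hr] := hg _ a2; have [s s0 Hs] := hk _ a2.
exists (Num.min r s); first by rewrite lt_min r0.
move=> t; rewrite lt_min => /andP[t0 /andP[tr ts]].
have := Hr t; have := Hs t; rewrite t0 tr ts => /(_ isT) H1 /(_ isT) H2.
have -> : g (x - t) - k (x - t) - (g x - k x) + (d - e) * t =
  (g (x - t) - g x + d * t) - (k (x - t) - k x + e * t) by ring.
by rewrite (le_trans (ler_normB _ _))//; lra.
Qed.

(** [pdx v] and [pdy v] must be measurable also where they take the default value on mesh lines; for
    this the one-sided derivatives of [u] and [uh] are subtracted. *)
Lemma error_partials xs ys u uh : grid xs -> grid ys -> regular u -> Vh xs ys uh ->
  let v := fun p => u p - uh p in let e := nodal uh xs ys in
  [/\ meas v, meas (pdx v), meas (pdy v),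
    {ae mu2, forall p, Omega p -> pdx v p = pdx u p - tensor_x xs ys e p} &
    {ae mu2, forall p, Omega p -> pdy v p = pdy u p - tensor_y xs ys e p}].
Proof.
move=> gx gy ru huh v e; have [pu _ _ _] := ru.
have [[mu0 _] _ _ _ _] := regular_bounded_meas ru.
have mv : meas v by apply: measB => //; exact: Vh_meas huh.
have dux p : Omega p -> is_derive p.1 1 (fun t => u (t, p.2)) (pdx u p).
  by move=> /pu[dx _ _ _ _]; rewrite /pdx derive1E; exact/derivableP.
have duy p : Omega p -> is_derive p.2 1 (fun t => u (p.1, t)) (pdy u p).
  by move=> /pu[_ dy _ _ _]; rewrite /pdy derive1E; exact/derivableP.
split => //.
- apply: meas_pdx => // p Op; have [dr [dl [hr hl]]] := Vh_sides_x gx gy huh Op.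
  have /is_derive_sides[ur ul] := dux p Op.
  by exists (pdx u p - dr), (pdx u p - dl); split; [exact: right_deriveB|exact: left_deriveB].
- apply: meas_pdy => // p Op; have [dr [dl [hr hl]]] := Vh_sides_y gx gy huh Op.
  have /is_derive_sides[ur ul] := duy p Op.
  by exists (pdy u p - dr), (pdy u p - dl); split; [exact: right_deriveB|exact: left_deriveB].
- apply: filterS (ae_off_xlines xs) => p pn Op.
  have H := Vh_is_derive_x gx gy huh Op pn; have Hu := dux p Op.
  by rewrite {1}/pdx derive1E; have [_ ->] := is_deriveB Hu H.
- apply: filterS (ae_off_ylines ys) => p pn Op.
  have H := Vh_is_derive_y gx gy huh Op pn; have Hu := duy p Op.
  by rewrite {1}/pdy derive1E; have [_ ->] := is_deriveB Hu H.
Qed.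

Lemma energy_norm_error (eps B : R) xs ys u uh : 0 < eps -> 0 <= B ->
  grid xs -> grid ys -> regular u -> Vh xs ys uh -> let e := nodal uh xs ys in
  integralO (fun p => eps * ((pdx u p - tensor_x xs ys e p) ^+ 2 + (pdy u p - tensor_y xs ys e p) ^+ 2)
     + (u p - tensor xs ys e p) ^+ 2) <= B ^+ 2 ->
  (energy_norm eps (fun p => (u p - uh p)%R) <= B%:E)%E.
Proof.
move=> e0 B0 gx gy ru huh e H.
have [mv mvx mvy vxE vyE] := error_partials gx gy ru huh.
have [bu bux buy _ _] := regular_bounded_meas ru.
have v0E p : Omega p -> u p - uh p = u p - tensor xs ys e p.
  by move=> Op; rewrite [uh p](Vh_tensor gx gy huh (Omega_closedW Op)).
have b0 : bmeas (fun p => u p - tensor xs ys e p).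
  by apply: bounded_measW; apply: bounded_measB => //; exact: bounded_meas_tensor.
have bx : bmeas (fun p => pdx u p - tensor_x xs ys e p).
  by apply: bounded_measW; apply: bounded_measB => //; exact: bounded_meas_tensor_x.
have by_ : bmeas (fun p => pdy u p - tensor_y xs ys e p).
  by apply: bounded_measW; apply: bounded_measB => //; exact: bounded_meas_tensor_y.
have sq w : meas w -> meas (fun p => w p ^+ 2) by move=> mw; exact: measM.
apply: energy_norm_le => //.
- by apply: ae_eq_bmeas b0 mv _; apply: aeW => p Op; rewrite v0E.
- by apply: ae_eq_bmeas bx mvx _; apply: filterS vxE => p E Op; rewrite E.
- by apply: ae_eq_bmeas by_ mvy _; apply: filterS vyE => p E Op; rewrite E.
apply: le_trans H; rewrite le_eqVlt; apply/orP; left; apply/eqP.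
have cst (w : R * R -> R) : meas w -> meas (fun p => eps * w p) by move=> mw; apply: measM => //; exact: meas_cst.
have [[m0 _] [mx _] [my _]] := And3 b0 bx by_.
apply: ae_eq_integralO.
- by apply: measD; [apply: cst; apply: measD|]; exact: sq.
- by apply: measD; [apply: cst; apply: measD|]; exact: sq.
by apply: filterS2 vxE vyE => p Ex Ey Op; rewrite Ex// Ey// v0E.
Qed.

End EnergyNorm.

(** * Counting the mesh points and choosing the constants *)

Section Main.
Context {R : realType}.
Implicit Types (xs ys : seq R).

Lemma ln_sqrt (x : R) : 0 < x -> ln (Num.sqrt x) = ln x / 2.
Proof. by move=> x0; rewrite -powR12_sqrt ?ltW// ln_powR mulrC. Qed.

(** With l = |ln eps| >= 1, [h] times the number of nodes is at most 4 + 2 l <= 6 l in [x] and at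
    most 2 (4 + l) <= 10 l in [y], where the half mesh is doubled and the layer width is sqrt eps.
    As 60 <= 8^2, the constant 8 results. *)
Lemma dl_mesh_points (kappa eps h : R) xs ys : 0 < kappa -> 0 < eps <= expR (-1) -> 0 < h < 1 ->
  dl_mesh kappa eps h xs ys ->
  h * `|ln eps| <= 8 * (1 / Num.sqrt (mesh_points xs ys)%:R) * ln eps ^+ 2.
Proof.
move=> k0 /andP[e0 e1] /andP[h0 h1] [hx [s hs ysE]].
have l1 : ln eps <= -1 by rewrite -[leRHS]expRK ler_ln ?posrE ?expR_gt0.
have nE : `|ln eps| = - ln eps by rewrite ler0_norm//; lra.
rewrite -sqr_normr nE; set l := - ln eps.
have q0 : 0 < Num.sqrt eps by rewrite sqrtr_gt0.
have H1 := dl_graded_size h0 h1 e0 (lexx 1) hx.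
have H2 : h * (size s)%:R <= 4 - 2 * ln (Num.sqrt eps).
  by apply: dl_graded_size hs => //; lra.
have [[sx _ _ _] _] := dl_xlayer k0 h0 h1 e0 hx.
have [[sy _ _ _] _] := dl_ylayer k0 h0 h1 q0 hs; rewrite -ysE in sy.
have s0 : (0 < size s)%N.
  by move: sy; rewrite ysE; case: (s) => //.
have yE : size ys = ((size s).-1 + (size s).-1).+1.
  by rewrite ysE; apply: size_dl_ys; rewrite prednK.
have H3 : h * (size ys)%:R <= 10 * l.
  apply: (@le_trans _ _ (2 * (h * (size s)%:R))).
    rewrite mulrCA ler_pM2l// -natrM ler_nat yE mul2n -addnn -[X in (_ <= X + X)%N]prednK//.
    by rewrite addSn addnS ltnW.
  by move: H2; rewrite ln_sqrt//; rewrite /l; lra.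
apply: count_bound => //; first by rewrite /l; lra.
  by rewrite muln_gt0 (ltnW sx) (ltnW sy).
have -> : h ^+ 2 * (mesh_points xs ys)%:R = (h * (size xs)%:R) * (h * (size ys)%:R).
  by rewrite natrM; ring.
apply: (@le_trans _ _ ((6 * l) * (10 * l))).
  apply: ler_pM => //; rewrite ?mulr_ge0 ?(ltW h0)//.
  by move: H1; rewrite /l; lra.
rewrite -subr_ge0 (_ : _ - _ = 4 * l ^+ 2); last by ring.
by rewrite mulr_ge0// sqr_ge0.
Qed.

Lemma bmeas_normr_bound (F : R * R -> R) : bmeas F ->
  exists2 M : R, 0 <= M & {ae leb2, forall p, Omega p -> `|F p| <= M}.
Proof.
move=> [_ [M FM]]; exists `|M| => //.
by apply: filterS FM => p FM /FM /le_trans; apply; exact: ler_norm.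
Qed.

End Main.

Theorem theorem2 (R : realType) (beta gamma : R) (b b_x b_y c : R * R -> R)
    (hdata : problem_data beta gamma b b_x b_y c)
    (delta C' kappa : R) (hdelta : 0 < delta) (hkappa : 0 < kappa) :
  exists eps0 : R, 0 < eps0 < 1 /\
  exists C : R, 0 < C /\
  forall (eps h : R), 0 < eps <= eps0 -> 0 < h < 1 ->
  forall (f u : R * R -> R), in_Lp 2%:E f -> solves eps b c f u ->
    derivative_bounds C' beta delta eps u ->
  forall xs ys : seq R, dl_mesh kappa eps h xs ys ->
  forall uh : R * R -> R, galerkin_solution eps b c f xs ys uh ->
    (energy_norm eps (fun p => u p - uh p)%R <= (C * h * `|ln eps|)%:E)%E /\
    h * `|ln eps|
      <= C * (1 / Num.sqrt (mesh_points xs ys)%:R) * ln eps ^+ 2.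
Proof.
have [[[/in_Loo_bmeas bb /in_Loo_bmeas bbx _ wb _] /in_Loo_bmeas bc] [beta0 _] _ gamma0 cb] := hdata.
have [Mb _ bM] := bmeas_normr_bound bb; have [Mc Mc0 cM] := bmeas_normr_bound bc.
have K0 : 0 < 1 + kappa by rewrite addr_gt0.
have kap0 : 0 < layer_rate beta (1 + kappa) by rewrite divr_gt0// mulr_gt0// addr_gt0.
have C10 := interp_constant_ge0 C' beta0 hdelta K0.
set kap := layer_rate _ _ in kap0; set C1 := interp_constant _ _ _ _ in C10.
(* The energy estimate bounds a square, hence the root; the absolute value spares a proof of the
   sign. This constant depends on neither [eps] nor [h]. The final constant adds the 8 of the point
   count. *)
pose S := Num.sqrt `|error_constant gamma kap C1 Mb Mc|.
have S0 : 0 <= S by exact: sqrtr_ge0.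
(* For [eps] up to this value |ln eps| is at least 1, which absorbs the additive constants of the
   point count and lets the logarithm be inserted in the energy bound. *)
exists (expR (-1)); split; first by rewrite expR_gt0 expR_lt1; lra.
exists (S + 8); split; first by lra.
move=> eps h he hh f u /in_L2_meas mf hu db xs ys hm uh gal.
have /andP[e0 eE] := he; have /andP[h0 h1] := hh.
have e1 : eps <= 1 by rewrite (le_trans eE)// expR_le1; lra.
have q0 : 0 < Num.sqrt eps by rewrite sqrtr_gt0.
split; last first.
  apply: (le_trans (dl_mesh_points hkappa he hh hm)).
  by rewrite !div1r -!mulrA ler_wpM2r ?lerDr// mulr_ge0 ?sqr_ge0// invr_ge0 sqrtr_ge0.
have [hx [s hs ysE]] := hm.
have lx := dl_xlayer hkappa h0 h1 e0 hx.
have ly := dl_ylayer hkappa h0 h1 q0 hs; rewrite -ysE in ly.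
have [gx _] := lx; have [gy _] := ly.
have ru := derivative_bounds_regular e0 hdelta beta0 hu db.
have [_ pde _ _] := hu; have [huh _] := gal.
have l1 : 1 <= `|ln eps|.
  have l1 : ln eps <= -1 by rewrite -[leRHS]expRK ler_ln ?posrE ?expR_gt0.
  by rewrite ler0_norm; lra.
(* The bound actually proved is [S * h]; the logarithm enters only by being at least 1. *)
apply: (@le_trans _ _ (S * h)%:E); last first.
  rewrite lee_fin -[leLHS]mulr1; apply: ler_pM => //; first by rewrite mulr_ge0// ltW.
  by rewrite ler_wpM2r// ?lerDl// ltW.
have he1 : 0 < eps <= 1 by rewrite e0.
have interp := layer_interpolation beta0 hdelta K0 e0 e1 h0 (ltW h1) lx ly ru db.
have H := energy_error gamma0 kap0 C10 Mc0 he1 (ltW h0) bb bbx bc wb bM cM cb gx gy mf ru pde gal interp.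
apply: energy_norm_error gx gy ru huh _ => //; first by rewrite mulr_ge0// ltW.
by rewrite exprMn sqr_sqrtr// (le_trans H)// ler_wpM2r ?sqr_ge0 ?ler_norm.
Qed.
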